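(* The two-variable classical link invariant $\theta(q,E)$ is stronger than the Jones polynomial $V$. That is: for all oriented links $L, L'$ in $S^3$, $\theta(L)=\theta(L')$ implies $V(L)=V(L')$; and there exist oriented links $L, L'$ with $V(L)=V(L')$ but $\theta(L)\neq\theta(L')$.
   Context: The Jones polynomial $V$ is normalized as the ambient isotopy invariant of oriented links with values in $\mathbb{C}[q^{\pm1}]$ with $V(\text{unknot})=1$ and $q^{-2}V(L_+)-q^2V(L_-)=(q-q^{-1})V(L_0)$ for all oriented Conway triples (diagrams identical except near one point, where they have respectively a positive crossing, a negative crossing, and the orientation-respecting smoothing). $\theta=\theta(q,E)$ is the unique ambient isotopy invariant of oriented links with values in $\mathbb{C}[q^{\pm1},E^{\pm1}]$ ($q,E$ indeterminates) such that: (1) $q^{-2}\theta(L_+)-q^2\theta(L_-)=(q-q^{-1})\theta(L_0)$ for every oriented Conway triple whose distinguished crossing is between two different components; (2) $\theta(\mathcal{K})=E^{1-r}V(\mathcal{K})$ for every split union $\mathcal{K}$ of $r\ge1$ knots. The existence and uniqueness of $\theta$ may be assumed. *)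

(* Defs.v *)
From HB Require Import structures.
From mathcomp Require Import all_boot all_order all_algebra fraction complex.
From mathcomp Require Import all_classical all_reals all_analysis.

Set Implicit Arguments.
Unset Strict Implicit.
Unset Printing Implicit Defensive.

Import Order.TTheory GRing.Theory Num.Theory.
Import numFieldNormedType.Exports.

Local Open Scope classical_set_scope.
Local Open Scope ring_scope.

(** * Oriented links in the 3-sphere *)

(* S^3 is R^3 with a point at infinity; x : R^3 is the point Some x of S^3. *)
Notation S3 R := (one_point_compactification 'rV[R]_3).

(* The closed polygon with cyclic list of vertices p, as a curve of period 1:
   with n = size p, it runs affinely along the edge from p_k to p_(k+1)
   (indices mod n) when s goes from k/n to (k+1)/n. *)
Definition loop (R : realType) (p : seq 'rV[R]_3) (s : R) : 'rV[R]_3 :=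
  let n : int := size p in
  let k := Num.floor (s * n%:~R) in
  let t := s * n%:~R - k%:~R in
  (1 - t) *: p`_(`|(k %% n)%Z|) + t *: p`_(`|((k + 1) %% n)%Z|).

(* Links are tame, i.e. polygonal: a nonempty list of pairwise disjoint simple
   closed polygons, each oriented by the order of its vertices.  As any link
   of S^3 can be moved off the point at infinity, all vertices are in R^3. *)
Definition is_link (R : realType) (L : seq (seq 'rV[R]_3)) : Prop :=
  [/\ L <> [::],
      forall p, p \in L -> {in `[0, 1[ &, injective (loop p)}
    & trivIset `I_(size L) (fun i => range (loop (nth [::] L i)))].

Record link (R : realType) := Link {
  comps :> seq (seq 'rV[R]_3);
  linkP : is_link comps }.

Definition support (R : realType) (L : link R) : set 'rV[R]_3 :=
  \bigcup_(i in `I_(size L)) range (loop (nth [::] L i)).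

(** * Ambient isotopy *)

Definition homeomorphism (T U : topologicalType) (f : T -> U) : Prop :=
  continuous f /\
  exists g : U -> T, [/\ continuous g, cancel f g & cancel g f].

Definition ambient_isotopy (R : realType) (H : R -> S3 R -> S3 R) : Prop :=
  [/\ {within [set z : R * S3 R | 0 <= z.1 <= 1],
         continuous (fun z : R * S3 R => H z.1 z.2)},
      forall t : R, 0 <= t <= 1 -> homeomorphism (H t)
    & H 0 =1 id].

(* f and g, of period 1, are the same oriented closed curve: the lifts to R of
   the orientation-preserving homeomorphisms of the circle R/Z are the maps
   phi below. *)
Definition same_oriented_curve (R : realType) (T : Type) (f g : R -> T) : Prop :=
  exists phi : R -> R,
    [/\ continuous phi, {homo phi : s t / s < t},
        forall s, phi (s + 1) = phi s + 1
      & forall s, f s = g (phi s)].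

(* Components are not ordered, hence the permutation L'' of L'. *)
Definition isotopic (R : realType) (L L' : link R) : Prop :=
  exists (H : R -> S3 R -> S3 R) (L'' : seq (seq 'rV[R]_3)),
    [/\ ambient_isotopy H, perm_eq L'' L', size L'' = size L
      & forall i, (i < size L)%N ->
          same_oriented_curve (fun s => H 1 (Some (loop (nth [::] L i) s)))
                              (fun s => Some (loop (nth [::] L'' i) s))].

Definition unknot (R : realType) (L : link R) : Prop :=
  exists (T : link R) (a b c : 'rV[R]_3),
    comps T = [:: [:: a; b; c]] /\ isotopic L T.

(* Up to isotopy, the components lie in pairwise disjoint balls (those of the
   sup norm of 'rV[R]_3, i.e. cubes).  A knot is such a link, with r = 1. *)
Definition split_union_of_knots (R : realType) (L : link R) : Prop :=
  exists (L' : link R) (c : nat -> 'rV[R]_3) (r : nat -> R),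
    [/\ isotopic L L',
        trivIset `I_(size L') (fun i => ball (c i) (r i))
      & forall i, (i < size L')%N ->
          range (loop (nth [::] L' i)) `<=` ball (c i) (r i)].

(** * Conway triples *)

(* A right-handed affine frame placed at the crossing: ux points to the right
   and uy upwards in the plane of the diagram, uz points towards the viewer. *)
Record frame (R : realType) := Frame {
  orig : 'rV[R]_3;
  ux : 'rV[R]_3;
  uy : 'rV[R]_3;
  uz : 'rV[R]_3;
  frame_pos : 0 < \det (\matrix_(i < 3) [:: ux; uy; uz]`_i) }.

Definition at_frame (R : realType) (f : frame R) (x y z : R) : 'rV[R]_3 :=
  orig f + x *: ux f + y *: uy f + z *: uz f.

(* The crossing is seen in the bipyramid on the square SW SE NE NW with apexes
   top and bot.  Both strands go upwards: SW -> NE passes through top or bot,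
   while SE -> NW passes through the origin of the frame.  Hence the crossing
   is positive for top and negative for bot, and the smoothing that respects
   the orientations is SW -> NW, SE -> NE. *)
Definition SW (R : realType) (f : frame R) := at_frame f (-1) (-1) 0.
Definition SE (R : realType) (f : frame R) := at_frame f 1 (-1) 0.
Definition NE (R : realType) (f : frame R) := at_frame f 1 1 0.
Definition NW (R : realType) (f : frame R) := at_frame f (-1) 1 0.
Definition top (R : realType) (f : frame R) := at_frame f 0 0 1.
Definition bot (R : realType) (f : frame R) := at_frame f 0 0 (-1).

Definition bipyramid (R : realType) (f : frame R) : set 'rV[R]_3 :=
  [set p | exists x y z : R,
     [/\ p = at_frame f x y z, `|x| + `|z| <= 1 & `|y| + `|z| <= 1]].

Definition segment (R : realType) (a b : 'rV[R]_3) : set 'rV[R]_3 :=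
  [set (1 - t) *: a + t *: b | t in `[0, 1]%classic].

Definition conway_picture (R : realType) (f : frame R) (Lp Lm L0 : link R) : Prop :=
  [/\ support Lp `&` bipyramid f =
        segment (SW f) (top f) `|` segment (top f) (NE f) `|` segment (SE f) (NW f),
      support Lm `&` bipyramid f =
        segment (SW f) (bot f) `|` segment (bot f) (NE f) `|` segment (SE f) (NW f)
    & support L0 `&` bipyramid f =
        segment (SW f) (NW f) `|` segment (SE f) (NE f)].

(* P and Q are the common vertex lists of the three links between NE and SW,
   resp. NW and SE; S is the list of their common other components. *)
Definition conway_triple_mixed (R : realType) (Lp Lm L0 : link R) : Prop :=
  exists (f : frame R) (P Q : seq 'rV[R]_3) (S : seq (seq 'rV[R]_3)),
    [/\ comps Lp = (SW f :: top f :: NE f :: P) :: (SE f :: NW f :: Q) :: S,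
        comps Lm = (SW f :: bot f :: NE f :: P) :: (SE f :: NW f :: Q) :: S,
        comps L0 = (SW f :: NW f :: Q ++ SE f :: NE f :: P) :: S
      & conway_picture f Lp Lm L0].

(* Same with P from NE to SE and Q from NW to SW. *)
Definition conway_triple_self (R : realType) (Lp Lm L0 : link R) : Prop :=
  exists (f : frame R) (P Q : seq 'rV[R]_3) (S : seq (seq 'rV[R]_3)),
    [/\ comps Lp = (SW f :: top f :: NE f :: P ++ SE f :: NW f :: Q) :: S,
        comps Lm = (SW f :: bot f :: NE f :: P ++ SE f :: NW f :: Q) :: S,
        comps L0 = (SW f :: NW f :: Q) :: (SE f :: NE f :: P) :: S
      & conway_picture f Lp Lm L0].

Definition conway_triple (R : realType) (Lp Lm L0 : link R) : Prop :=
  conway_triple_mixed Lp Lm L0 \/ conway_triple_self Lp Lm L0.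

(** * Laurent polynomials and the invariants *)

(* The field C(q, E), with C = R[i]; the Laurent polynomial rings C[q^±1] and
   C[q^±1, E^±1] are the subrings of it given by the two predicates below. *)
Notation CqE R := {fraction {poly {poly R[i]}}}.

Definition q_ (R : realType) : CqE R := FracField.tofrac ('X%:P).
Definition E_ (R : realType) : CqE R := FracField.tofrac 'X.

Definition laurent_q (R : realType) (x : CqE R) : Prop :=
  exists (p : {poly R[i]}) (n : nat), x = FracField.tofrac p%:P / q_ R ^+ n.

Definition laurent_qE (R : realType) (x : CqE R) : Prop :=
  exists (p : {poly {poly R[i]}}) (n m : nat),
    x = FracField.tofrac p / (q_ R ^+ n * E_ R ^+ m).

Definition isotopy_invariant (R : realType) (I : link R -> CqE R) : Prop :=
  forall L L', isotopic L L' -> I L = I L'.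

Definition skein (R : realType) (I : link R -> CqE R) (Lp Lm L0 : link R) : Prop :=
  q_ R ^- 2 * I Lp - q_ R ^+ 2 * I Lm = (q_ R - (q_ R)^-1) * I L0.

Definition is_jones (R : realType) (V : link R -> CqE R) : Prop :=
  [/\ isotopy_invariant V,
      forall L, laurent_q (V L),
      forall L, unknot L -> V L = 1
    & forall Lp Lm L0, conway_triple Lp Lm L0 -> skein V Lp Lm L0].

Definition is_theta (R : realType) (V theta : link R -> CqE R) : Prop :=
  [/\ isotopy_invariant theta,
      forall L, laurent_qE (theta L),
      forall Lp Lm L0, conway_triple_mixed Lp Lm L0 -> skein theta Lp Lm L0
    & forall K, split_union_of_knots K ->
        theta K = E_ R ^ (1 - (size K)%:Z) * V K].

(* Main.v *)
Require Import Defs.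
From Stdlib Require Import BinInt.
From mathcomp Require Import all_boot all_order all_algebra fraction complex.
From mathcomp Require Import all_classical all_reals all_analysis.
From mathcomp Require Import ring lra zify ssrZ.

Set Implicit Arguments.
Unset Strict Implicit.
Unset Printing Implicit Defensive.

Import Order.TTheory GRing.Theory Num.Theory.
Import numFieldNormedType.Exports.

Local Open Scope classical_set_scope.
Local Open Scope ring_scope.
Delimit Scope Z_scope with BZ.

(* Putting E = 1 in theta gives an invariant that agrees with V on split unions
   of knots and satisfies the skein relation at mixed crossings, so the
   uniqueness of theta yields theta(q,1) = V; hence theta determines V.

   For the second part, reversing a component of a link multiplies V by a power
   of q that depends on linking numbers only, whereas theta also keeps track of
   the split unions of knots met when the components are pulled apart.  The two
   links are the split unions of
   - the (2,4) torus link with linking number 2 and two Hopf links with linking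
     number -1 (clasp2, sigma2, sigma2),
   - the (2,4) torus link with linking number -2 and two Hopf links with linking
     number 1 (sigma4, clasp1, clasp1),
   which differ by the reversal of one component of each summand; the linking
   numbers add up to 0, and V agrees.  In the second link the strands of the
   torus link are parallel, so that smoothing a crossing produces a trefoil,
   while in the first one it produces an unknot, and theta differs.

   Isotopies are sequences of triangle moves: the edge ab of a polygon may be
   replaced by acb if the triangle abc meets the rest of the link only in a and
   b.  Such a move is realized by a shear that is the identity outside a thin
   bipyramid around the triangle.  Polygons have integral vertices, and all
   disjointness conditions are checked by computing separating planes. *)

(** No theorem on reversal or on linking numbers is proved: both invariants are computed on both
    links. The skein relations express the picture in each of the three summands through one disc,
    two discs and a trefoil, so that a value is a product of three factors times the value of three
    discs. For [theta] only crossings between different components may be resolved, and the trefoil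
    has none; its factor is therefore taken from [V] by the formula for split unions, while for [V]
    its self crossings may be resolved. Passing from [V] to [theta] thus divides the factor u = -(q
    + 1/q) of two discs by E but leaves the factor of the trefoil unchanged, and this is why E
    survives in the difference. That difference is a nonzero common factor times an explicit Laurent
    polynomial, which is seen to be nonzero by putting q = E = 2. *)

(** * Polygons as periodic curves *)

Section Loops.
Variable R : realType.
Implicit Types (a b c v w x : 'rV[R]_3) (p q : seq 'rV[R]_3) (s t u : R).

Definition lerp a b t : 'rV[R]_3 := (1 - t) *: a + t *: b.

Lemma lerp0 a b : lerp a b 0 = a.
Proof. by rewrite /lerp subr0 scale1r scale0r addr0. Qed.

Lemma lerp1 a b : lerp a b 1 = b.
Proof. by rewrite /lerp subrr scale0r add0r scale1r. Qed.

Lemma lerpC a b t : lerp a b t = lerp b a (1 - t).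
Proof. by rewrite /lerp subKr addrC. Qed.

Lemma loopE_int p (k : int) t : (0 < size p)%N -> 0 <= t < 1 ->
  loop p ((k%:~R + t) / (size p)%:R) =
  lerp p`_(`|(k %% size p)%Z|) p`_(`|((k + 1) %% size p)%Z|) t.
Proof.
move=> p0 /andP[t0 t1]; rewrite /loop /lerp.
have n0 : (size p)%:R != 0 :> R by rewrite pnatr_eq0 -lt0n.
have -> : (k%:~R + t) / (size p)%:R * (size p : int)%:~R = k%:~R + t.
  by rewrite -mulrA mulVf ?mulr1.
have -> : Num.floor (k%:~R + t) = k.
  by apply: floor_def; rewrite intrD; lra.
by congr (_ *: _ + _ *: _); ring.
Qed.

Lemma loop_edge p i t : (i < size p)%N -> 0 <= t <= 1 ->
  loop p ((i%:R + t) / (size p)%:R) = lerp p`_i p`_(i.+1 %% size p) t.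
Proof.
move=> ip /andP[t0]; rewrite le_eqVlt => /orP[/eqP ->|t1]; last first.
  rewrite -[i%:R]/((i : int)%:~R) loopE_int ?t0 ?(leq_ltn_trans _ ip)//.
  have -> : (i : int) + 1 = i.+1 by lia.
  by rewrite !modz_nat /= modn_small.
have p0 : (0 < size p)%N by exact: leq_ltn_trans ip.
have -> : (i%:R + 1 : R) = ((i.+1 : int)%:~R + 0) by rewrite addr0 natr1.
by rewrite loopE_int ?lexx ?ltr01// modz_nat lerp0 lerp1.
Qed.

Lemma loopD_int p s (r : int) : (0 < size p)%N -> loop p (s + r%:~R) = loop p s.
Proof.
move=> p0; rewrite /loop /=.
have -> : (s + r%:~R) * ((size p) : int)%:~R =
    s * (size p : int)%:~R + (r * size p)%:~R by rewrite intrM mulrDl.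
rewrite floorDrz ?intr_int// intrKfloor.
set k := Num.floor _.
have E : s * ((size p) : int)%:~R + (r * size p)%:~R - (k + r * size p)%:~R
    = s * ((size p) : int)%:~R - k%:~R by rewrite intrD; ring.
have M m : ((m + r * size p) %% size p)%Z = (m %% size p)%Z by rewrite addrC modzMDl.
have -> : k + r * size p + 1 = k + 1 + r * size p by ring.
by rewrite E !M.
Qed.

(** Normal form of a parameter: period r, edge i, position t on that edge. It reduces statements
    about [loop] to a single edge. *)
Lemma paramP (n : nat) s : (0 < n)%N -> exists (r : int) (i : nat) t,
  [/\ (i < n)%N, 0 <= t < 1 & s = (i%:R + t) / n%:R + r%:~R].
Proof.
move=> n0; have n0' : 0 < n%:R :> R by rewrite ltr0n.
pose r := Num.floor s; pose u := (s - r%:~R) * n%:R.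
have /andP[r1 r2] := floor_itv s; rewrite intrD in r2.
have u0 : 0 <= u by rewrite mulr_ge0 ?subr_ge0// ltW.
have un : u < n%:R by rewrite -[ltRHS]mul1r ltr_pM2r// /r; lra.
have /andP[i1 i2] := truncn_itv u0.
exists r, (Num.truncn u), (u - (Num.truncn u)%:R); split.
- by rewrite -(ltr_nat R); apply: le_lt_trans un.
- by rewrite -natr1 in i2; lra.
- by rewrite [X in X / _]addrC subrK mulfK ?subrK// gt_eqF.
Qed.

Definition trace p : set 'rV[R]_3 := [set x | exists i t,
  [/\ (i < size p)%N, 0 <= t <= 1 & x = lerp p`_i p`_(i.+1 %% size p) t]].

Lemma range_loop p : (0 < size p)%N -> range (loop p) = trace p.
Proof.
move=> p0; apply/seteqP; split=> x.
  move=> [s _ <-]; have [r [i [t [ip t01 ->]]]] := paramP s p0.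
  exists i, t; split => //; first by case/andP: t01 => -> /ltW ->.
  by rewrite loopD_int// loop_edge//; case/andP: t01 => -> /ltW ->.
by move=> [i [t [ip t01 ->]]]; exists ((i%:R + t) / (size p)%:R); rewrite ?loop_edge.
Qed.

(** Edges are half open, so that each vertex belongs to exactly one edge and neighbouring edges need
    no exception. *)
Definition simple p := (0 < size p)%N /\
  forall i j t u, (i < size p)%N -> (j < size p)%N -> 0 <= t < 1 -> 0 <= u < 1 ->
    lerp p`_i p`_(i.+1 %% size p) t = lerp p`_j p`_(j.+1 %% size p) u ->
    i = j /\ t = u.

Lemma simple_inj p : simple p -> {in `[0, 1[ &, injective (loop p)}.
Proof.
move=> [p0 H] s s'; rewrite !in_itv /= => s01 s01'.
have n0' : 0 < (size p)%:R :> R by rewrite ltr0n.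
have K z : 0 <= z < 1 -> exists i t,
    [/\ (i < size p)%N, 0 <= t < 1 & z = (i%:R + t) / (size p)%:R].
  move=> z01; have [r [i [t [ip t01 E]]]] := paramP z p0.
  exists i, t; split => //; suff r0 : r = 0 by rewrite E r0 addr0.
  have F : 0 <= (i%:R + t) / (size p)%:R < 1.
    have i1 : i%:R + 1 <= (size p)%:R :> R by rewrite natr1 ler_nat.
    rewrite divr_ge0 ?addr_ge0//=; last by case/andP: t01.
    by rewrite ltr_pdivrMr// mul1r; case/andP: t01; lra.
  have F1 : (-1)%:~R < r%:~R :> R by rewrite mulrN1z; lra.
  have F2 : r%:~R < 1%:~R :> R by rewrite mulr1z; lra.
  by move: F1 F2; rewrite !ltr_int; lia.
have [i [t [ip t01 ->]]] := K _ s01; have [j [u [jp u01 ->]]] := K _ s01'.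
have [t01' u01'] : 0 <= t <= 1 /\ 0 <= u <= 1.
  by move: t01 u01 => /andP[-> /ltW ->] /andP[-> /ltW ->].
by rewrite !loop_edge// => /(H _ _ _ _ ip jp t01 u01)[-> ->].
Qed.

Fixpoint disjoint_traces (L : seq (seq 'rV[R]_3)) : Prop :=
  if L is p :: L' then
    (forall q, q \in L' -> trace p `&` trace q = set0) /\ disjoint_traces L'
  else True.

Lemma disjoint_traces_nth L i j : disjoint_traces L -> (i < j < size L)%N ->
  trace (nth [::] L i) `&` trace (nth [::] L j) = set0.
Proof.
elim: L i j => [|p L IH] i j; first by rewrite ltn0 andbF.
move=> [H1 H2]; case: i j => [|i] [|j] //= h; last exact: IH.
by apply: H1; rewrite mem_nth.
Qed.

Lemma is_link_simple (L : seq (seq 'rV[R]_3)) : L <> [::] ->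
  (forall p, p \in L -> simple p) -> disjoint_traces L -> is_link L.
Proof.
move=> L0 S D; split=> // [p /S/simple_inj//|].
have K i : (i < size L)%N -> range (loop (nth [::] L i)) = trace (nth [::] L i).
  by move=> iL; rewrite range_loop//; case: (S _ (mem_nth [::] iL)).
apply/trivIsetP => i j /= iL jL ij; rewrite !K//.
case: (ltngtP i j) => [h|h|h]; last by rewrite h eqxx in ij.
  by apply: disjoint_traces_nth; rewrite ?h.
by rewrite setIC; apply: disjoint_traces_nth; rewrite ?h.
Qed.

End Loops.

(** * Extension to the 3-sphere, change of order and of starting vertex *)

Section Isotopies.
Variable R : realType.
Implicit Types (p q : seq 'rV[R]_3) (L : link R) (s t : R).

Definition ext (f : 'rV[R]_3 -> 'rV[R]_3) (z : S3 R) : S3 R := omap f z.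

(** At infinity: if W is the compact set left out by a neighbourhood of infinity, then W together
    with the closed ball of radius M is compact, and outside of it every [G t] is the identity. *)
Lemma ext_continuous (G : R -> 'rV[R]_3 -> 'rV[R]_3) (M : R) :
  continuous (fun z : R * 'rV[R]_3 => G z.1 z.2) ->
  (forall t v, M < `|v| -> G t v = v) ->
  continuous (fun z : R * S3 R => ext (G z.1) z.2).
Proof.
move=> cG GM [t [v|]] U /=.
  move=> /(cG (t, v)) [[A B] /= [At Bv] AB].
  exists (A, Some @` B) => /=.
    by split => //; exact: one_point_compactification_some_nbhs.
  by move=> [t' z] /= [At' [v' Bv' <-]]; exact: (AB (t', v')).
move=> [W [cW clW] WU]; pose W' := W `|` [set v : 'rV[R]_3 | `|v| <= M].
exists (setT, (Some @` (~` W')) `|` [set None]) => /=.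
  split; first exact: filterT.
  exists W' => //; have clM : closed [set v : 'rV[R]_3 | `|v| <= M].
    apply: (@preimage_closed _ _ (fun v : 'rV[R]_3 => `|v|) [set r | r <= M]).
      by move=> ? _; exact: norm_continuous.
    exact: closed_le.
  split; last exact: closedU.
  apply: compactU => //; apply: bounded_closed_compact => //.
  exists M; split; first exact: num_real.
  by move=> M' MM' v' /= h; apply: le_trans h (ltW MM').
move=> [t' z] /= [_ [[v' nv' <-]|->]]; last by apply: WU; right.
apply: WU; left; exists v'; first by move=> w; apply: nv'; left.
by rewrite /= GM// ltNge; apply/negP => h; apply: nv'; right.
Qed.

Lemma ext_continuous1 (f : 'rV[R]_3 -> 'rV[R]_3) (M : R) :
  continuous f -> (forall v, M < `|v| -> f v = v) -> continuous (ext f).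
Proof.
move=> cf fM z.
apply: (@continuous_comp _ _ _ (fun z => (0 : R, z))
  (fun z : R * S3 R => ext f z.2)).
  apply: (@cvg_pair _ _ _ (nbhs z) (nbhs (0 : R)) (nbhs z)); first exact: cvg_cst.
  exact: cvg_id.
apply: (@ext_continuous (fun=> f) M) => // -[t v].
by apply: (@continuous_comp _ _ _ snd f); [exact: cvg_snd|exact: cf].
Qed.

Lemma homeomorphism_id (T : topologicalType) : homeomorphism (@id T).
Proof. by split; [move=> x; exact: cvg_id|exists id; split=> // x; exact: cvg_id]. Qed.

Lemma ambient_isotopy_id : ambient_isotopy (fun _ : R => @id (S3 R)).
Proof.
split => //; first by apply: continuous_subspaceT => z; exact: cvg_snd.
by move=> t _; exact: homeomorphism_id.
Qed.

Lemma same_oriented_curve_refl (T : Type) (f g : R -> T) : f =1 g ->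
  same_oriented_curve f g.
Proof.
by move=> fg; exists id; split => // x; exact: cvg_id.
Qed.

Lemma isotopic_perm L L' : perm_eq L L' -> isotopic L L'.
Proof.
move=> LL'; exists (fun _ => id), (comps L); split => //.
  exact: ambient_isotopy_id.
by move=> i iL; exact: same_oriented_curve_refl.
Qed.

Lemma nth_rotmod (p : seq 'rV[R]_3) k i : (k <= size p)%N -> (i < size p)%N ->
  (rot k p)`_i = p`_((i + k) %% size p).
Proof.
move=> kp ip; rewrite /rot nth_cat size_drop.
case: ltnP => h.
  by rewrite nth_drop addnC modn_small//; move: h; rewrite ltn_subRL addnC.
rewrite nth_take; last by move: h ip kp; move: (size p) => n; lia.
congr nth; have -> : (i + k = (i - (size p - k)) + size p)%N.
  by move: h ip kp; move: (size p) => n; lia.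
by rewrite modnDr modn_small//; move: h ip kp; move: (size p) => n; lia.
Qed.

Lemma loop_rot p k s : (0 < size p)%N -> (k <= size p)%N ->
  loop (rot k p) s = loop p (s + k%:R / (size p)%:R).
Proof.
move=> p0 kp; have [r [i [t [ip t01 ->]]]] := paramP s p0.
rewrite loopD_int ?size_rot// -addrA [r%:~R + _]addrC addrA loopD_int//.
have t01' : 0 <= t <= 1 by move: t01 => /andP[-> /ltW ->].
rewrite -{1}(size_rot k p) loop_edge ?size_rot// -mulrDl.
rewrite !nth_rotmod ?ltn_mod//.
have -> : i%:R + t + k%:R = ((i + k)%N : int)%:~R + t by rewrite -pmulrn natrD; ring.
have E : ((i + k)%N : int) + 1 = (i + k).+1 by lia.
by rewrite loopE_int// E !modz_nat/= modnDml addSn.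
Qed.

Lemma isotopic_rot L L' k p (S1 S2 : seq (seq 'rV[R]_3)) :
  (0 < size p)%N -> (k <= size p)%N ->
  comps L = S1 ++ p :: S2 -> perm_eq (S1 ++ rot k p :: S2) L' -> isotopic L L'.
Proof.
move=> p0 kp LE LE'; exists (fun _ => id), (S1 ++ rot k p :: S2).
split => //; [exact: ambient_isotopy_id|by rewrite LE !size_cat|].
move=> i _; rewrite LE !nth_cat.
case: ltnP => h; first exact: same_oriented_curve_refl.
case: (i - size S1)%N => [|j]; last exact: same_oriented_curve_refl.
(* Another starting vertex amounts to a translation of the parameter. *)
exists (fun s => s - k%:R / (size p)%:R); split.
- by move=> x; apply: cvgB; [exact: cvg_id|exact: cvg_cst].
- by move=> s t st; rewrite ltrD2r.
- by move=> s; rewrite addrAC.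
- by move=> s /=; rewrite loop_rot// subrK.
Qed.

End Isotopies.

(** * A piecewise linear family of homeomorphisms of the line *)

Section Tent.
Variable R : realType.
Variables (al be : R).
Hypotheses (al1 : 1 < al) (be0 : 0 < be).
Implicit Types (t k y a b c d : R).

Let clip a b := Num.max 0 (Num.min a b).

Lemma clip_cases a b : (a <= b /\ 0 < a /\ clip a b = a) \/
  (b < a /\ 0 < b /\ clip a b = b) \/ ((a <= 0 \/ b <= 0) /\ clip a b = 0).
Proof.
rewrite /clip /Num.max /Num.min.
case: (ltP a b) => ab; [case: (ltP 0 a) => h|case: (ltP 0 b) => h].
- by left; rewrite ltW.
- by right; right; split => //; left.
- move: ab; rewrite le_eqVlt => /orP[/eqP E|ab]; last by right; left.
  by left; rewrite -E lexx.
- by right; right; split => //; right.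
Qed.

(** Only the branch that realizes the value has to be matched: the smaller of a and b if both are
    positive, and otherwise just the sign. *)
Lemma clip_eq a b c d : (a <= b -> 0 < a -> c = a /\ a <= d) ->
  (b < a -> 0 < b -> d = b /\ b <= c) -> (a <= 0 -> c <= 0 \/ d <= 0) ->
  (b <= 0 -> c <= 0 \/ d <= 0) -> clip c d = clip a b.
Proof.
move=> H1 H2 H3 H4.
case: (clip_cases a b) => [[h1 [h2 ->]]|[[h1 [h2 ->]]|[h ->]]].
- have [-> h] := H1 h1 h2.
  by rewrite /clip min_l// max_r// ltW.
- have [-> h] := H2 h1 h2.
  by rewrite /clip min_r// max_r// ltW.
- have {h} h : c <= 0 \/ d <= 0 by case: h.
  by rewrite /clip max_l// ge_min; case: h => ->; rewrite ?orbT.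
Qed.

(* For k >= 0 and 0 <= t <= 1, the map y |-> y + t * tent k y is piecewise
   linear, fixes the points outside [- be * k, al * k] and sends 0 to t * k; its
   inverse is y |-> y - t * tent_inv t k y. *)
Definition tent k y := clip (k - y / al) (k + y / be).
Definition tent_inv t k y := clip ((al * k - y) / (al - t)) ((y + be * k) / (be + t)).

(** With A = k - y / al one has al * k - y = al * A; after the shift of y by t * A this becomes (al
    - t) * A. With B = k + y / be, likewise, be * k + y = be * B becomes (be + t) * B after a shift
    by t * B. This is the origin of the two denominators, which are positive as t <= 1 < al and 0 <
    be. *)
Lemma tent_invK t k y : 0 <= t <= 1 -> tent_inv t k (y + t * tent k y) = tent k y.
Proof.
move=> /andP[t0 t1]; rewrite /tent_inv {2}/tent.
move: al1 be0 => al1' be0'; have al0 : 0 < al by lra.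
have d1 : 0 < al - t by lra.
have d2 : 0 < be + t by lra.
set A := k - y / al; set B := k + y / be.
have EA : al * k = al * A + y by rewrite /A; field; lra.
have EB : be * k = be * B - y by rewrite /B; field; lra.
rewrite EA EB; rewrite /tent -/A -/B; case: (clip_cases A B).
  move=> [h1 [h2 E]]; rewrite [in LHS]E; apply: clip_eq.
  - move=> _ _; split; first by field; lra.
    by rewrite ler_pdivlMr//; nra.
  - by move=> /lt_geF; rewrite h1.
  - by move=> /le_gtF; rewrite h2.
  - by move=> h; have := lt_le_trans h2 (le_trans h1 h); rewrite ltxx.
case; move=> [h1].
  move=> [h2 E]; rewrite [in LHS]E; apply: clip_eq.
  - by move=> /le_gtF; rewrite h1.
  - move=> _ _; split; first by field; lra.
    by rewrite ler_pdivlMr//; nra.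
  - by move=> h; have := lt_trans h2 (lt_le_trans h1 h); rewrite ltxx.
  - by move=> /le_gtF; rewrite h2.
move=> E; rewrite [in LHS]E mulr0 addr0.
have E1 : (al * A + y - y) / (al - t) <= 0 = (A <= 0).
  by rewrite ler_pdivrMr// mul0r addrK pmulr_rle0.
have E2 : (y + (be * B - y)) / (be + t) <= 0 = (B <= 0).
  by rewrite ler_pdivrMr// mul0r addrC subrK pmulr_rle0.
apply: clip_eq; rewrite ?E1 ?E2; try by [left|right].
- move=> h2 h3; case: h1 => h1; first by rewrite ltNge h1 in h3.
  by have := lt_le_trans h3 (le_trans h2 h1); rewrite ltxx.
- move=> h2 h3; case: h1 => h1; last by rewrite ltNge h1 in h3.
  by have := lt_trans h3 (lt_le_trans h2 h1); rewrite ltxx.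
Qed.

Lemma tentK t k y : 0 <= t <= 1 -> tent k (y - t * tent_inv t k y) = tent_inv t k y.
Proof.
move=> /andP[t0 t1]; rewrite {1}/tent {2}/tent_inv.
move: al1 be0 => al1' be0'; have al0 : 0 < al by lra.
have d1 : 0 < al - t by lra.
have d2 : 0 < be + t by lra.
set A := (al * k - y) / (al - t); set B := (y + be * k) / (be + t).
have EA : k = ((al - t) * A + y) / al by rewrite /A; field; lra.
have EB : k = ((be + t) * B - y) / be by rewrite /B; field; lra.
rewrite {1}EA [k in X in clip _ X]EB.
rewrite /tent_inv -/A -/B; case: (clip_cases A B).
  move=> [h1 [h2 E]]; rewrite [in LHS]E; apply: clip_eq.
  - move=> _ _; split; first by field; lra.
    by rewrite -mulrDl ler_pdivlMr//; nra.
  - by move=> /lt_geF; rewrite h1.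
  - by move=> /le_gtF; rewrite h2.
  - by move=> h; have := lt_le_trans h2 (le_trans h1 h); rewrite ltxx.
case; move=> [h1].
  move=> [h2 E]; rewrite [in LHS]E; apply: clip_eq.
  - by move=> /le_gtF; rewrite h1.
  - move=> _ _; split; first by field; lra.
    by rewrite -mulrBl ler_pdivlMr//; nra.
  - by move=> h; have := lt_trans h2 (lt_le_trans h1 h); rewrite ltxx.
  - by move=> /le_gtF; rewrite h2.
move=> E; rewrite [in LHS]E mulr0 subr0.
have E1 : ((al - t) * A + y) / al - y / al <= 0 = (A <= 0).
  by rewrite -mulrBl addrK ler_pdivrMr// mul0r pmulr_rle0.
have E2 : ((be + t) * B - y) / be + y / be <= 0 = (B <= 0).
  by rewrite -mulrDl subrK ler_pdivrMr// mul0r pmulr_rle0.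
apply: clip_eq; rewrite ?E1 ?E2; try by [left|right].
- move=> h2 h3; case: h1 => h1; first by rewrite ltNge h1 in h3.
  by have := lt_le_trans h3 (le_trans h2 h1); rewrite ltxx.
- move=> h2 h3; case: h1 => h1; last by rewrite ltNge h1 in h3.
  by have := lt_trans h3 (lt_le_trans h2 h1); rewrite ltxx.
Qed.

End Tent.

(** * Reparametrization after the insertion of a vertex *)

Section InsertVertex.
Variable R : realType.
Implicit Types (a b c v w : 'rV[R]_3) (P : seq 'rV[R]_3) (s t r : R).

(* split_clock n counts, with fractions, the passages through the first edge of
   a polygon with n edges.  When this edge is split at its midpoint, the change
   of parameter is therefore s |-> (n s + split_clock n s) / (n + 1). *)
Definition split_clock (n s : R) : R :=
  (Num.floor s)%:~R + Num.min (n * (s - (Num.floor s)%:~R)) 1.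

Lemma split_clockD1 n s : split_clock n (s + 1) = split_clock n s + 1.
Proof.
rewrite /split_clock; have -> : Num.floor (s + 1) = Num.floor s + 1.
  by rewrite floorDrz ?floor1.
rewrite intrD; have -> : s + 1 - ((Num.floor s)%:~R + 1%:~R) = s - (Num.floor s)%:~R.
  by ring.
by ring.
Qed.

(** The lower bound makes the change of parameter strictly increasing, the upper bound makes it
    continuous. *)
Lemma split_clock_lip n s t : 1 <= n -> s <= t ->
  0 <= split_clock n t - split_clock n s <= n * (t - s).
Proof.
move=> n1 st; rewrite /split_clock.
have fl : Num.floor s <= Num.floor t by exact: le_floor.
have /andP[] := floor_itv s; have /andP[] := floor_itv t.
rewrite !intrD; set i := Num.floor s in fl *; set j := Num.floor t in fl *.
move: fl; rewrite le_eqVlt => /orP[/eqP <-|ij] h1 h2 h3 h4.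
  have [k1|k1] := leP (n * (s - i%:~R)) 1; have [k2|k2] := leP (n * (t - i%:~R)) 1; nra.
have : (i + 1)%:~R <= j%:~R :> R by rewrite ler_int; lia.
rewrite intrD => ij'.
have [k1|k1] := leP (n * (s - i%:~R)) 1; have [k2|k2] := leP (n * (t - j%:~R)) 1; nra.
Qed.

Lemma split_clock_continuous n : 1 <= n -> continuous (split_clock n).
Proof.
move=> n1 s; apply/cvgrPdist_lt => e e0.
have en : 0 < e / n by rewrite divr_gt0//; lra.
near=> t.
have lt_st : `|s - t| < e / n.
  by near: t; apply/nbhs_ballP; exists (e / n) => //= t.
rewrite ltr_pdivlMr in lt_st; last by lra.
apply: le_lt_trans lt_st; have [st|/ltW ts] := leP s t.
  have /andP[h1 h2] := split_clock_lip n1 st.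
  by rewrite distrC ger0_norm// distrC ger0_norm ?subr_ge0// mulrC.
have /andP[h1 h2] := split_clock_lip n1 ts.
by rewrite ger0_norm// ger0_norm ?subr_ge0// mulrC.
Unshelve. all: by end_near. Qed.

Lemma split_clockE (n i : nat) (r' : int) t : (i < n)%N -> 0 <= t < 1 ->
  split_clock n%:R ((i%:R + t) / n%:R + r'%:~R) =
    r'%:~R + if i == 0%N then t else 1.
Proof.
move=> iN /andP[t0 t1]; rewrite /split_clock.
have n0 : 0 < n%:R :> R by rewrite ltr0n; lia.
have i1 : i%:R + 1 <= n%:R :> R by rewrite natr1 ler_nat.
have -> : Num.floor ((i%:R + t) / n%:R + r'%:~R) = r'.
  apply: floor_def; rewrite intrD [r'%:~R + _]addrC lerDr ltrD2r.
  rewrite divr_ge0 ?addr_ge0//= ?(ltW n0)//.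
  by rewrite ltr_pdivrMr// mul1r; lra.
congr (_ + _); rewrite addrK mulrC divfK ?(gt_eqF n0)//.
case: i iN i1 => [|i] _ _ /=.
  by rewrite add0r min_l ?(ltW t1).
rewrite min_r// -natr1; have : 0 <= i%:R :> R by [].
by lra.
Qed.

Lemma same_curve_insert_vertex (f : 'rV[R]_3 -> 'rV[R]_3) a b c P :
  (forall t, 0 <= t <= 2^-1 -> f (lerp a b t) = lerp a c (2 * t)) ->
  (forall t, 2^-1 <= t <= 1 -> f (lerp a b t) = lerp c b (2 * t - 1)) ->
  (forall i t, (0 < i < size (a :: b :: P))%N -> 0 <= t <= 1 ->
    let v := lerp (a :: b :: P)`_i (a :: b :: P)`_(i.+1 %% size (a :: b :: P)) t in
    f v = v) ->
  same_oriented_curve (fun s => f (loop (a :: b :: P) s)) (loop (a :: c :: b :: P)).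
Proof.
move=> f1 f2 f3; set p := a :: b :: P; set p' := a :: c :: b :: P.
set n := size p; have n0 : (0 < n)%N by [].
have n1 : 1 <= n%:R :> R by rewrite ler1n.
have np : size p' = n.+1 by [].
exists (fun s => (n%:R * s + split_clock n%:R s) / n.+1%:R); split.
- move=> s; apply: cvgM; last exact: cvg_cst.
  apply: cvgD; last exact: split_clock_continuous.
  by apply: cvgM; [exact: cvg_cst|exact: cvg_id].
- move=> s t st; rewrite ltr_pM2r ?invr_gt0 ?ltr0n//.
  have /andP[h _] := split_clock_lip n1 (ltW st); nra.
- move=> s; rewrite split_clockD1.
  have -> : n%:R * (s + 1) + (split_clock n%:R s + 1) =
    n%:R * s + split_clock n%:R s + n.+1%:R by rewrite -natr1; ring.
  by rewrite mulrDl mulfV// pnatr_eq0.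
move=> s; have [r [i [t [iN t01 ->]]]] := paramP s n0.
have t01' : 0 <= t <= 1 by case/andP: t01 => -> /ltW ->.
rewrite split_clockE// loopD_int// loop_edge//.
have n0' : n%:R != 0 :> R by rewrite pnatr_eq0.
have n0'' : n.+1%:R != 0 :> R by rewrite pnatr_eq0.
case: (posnP i) => [i0|ip]; last first.
  rewrite f3 ?ip//. rewrite /=.
  have -> : (n%:R * ((i%:R + t) / n%:R + r%:~R) + (r%:~R + 1))
     / n.+1%:R = (i.+1%:R + t) / (size p')%:R + r%:~R.
    rewrite np -(natr1 i); move: n0' n0''; rewrite -(natr1 n).
    by move: (n%:R : R) => N N0 N1; field; rewrite N0 N1.
  rewrite loopD_int// loop_edge ?np//.
  have -> : p'`_i.+1 = p`_i by case: (i) ip.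
  congr lerp; have [E|E] := eqVneq i.+1 n; first by rewrite E !modnn.
  have iN' : (i.+1 < n)%N by rewrite ltn_neqAle E.
  by rewrite !modn_small ?np ?ltnS//; case: (i) ip.
rewrite i0 /=.
have -> : (n%:R * ((0 + t) / n%:R + r%:~R) + (r%:~R + t)) / n.+1%:R =
    2 * t / n.+1%:R + r%:~R.
  move: n0' n0''; rewrite -(natr1 n).
  by move: (n%:R : R) => N N0 N1; field; rewrite N0 N1.
rewrite loopD_int//.
rewrite -[X in f X]/(lerp a b t).
have [h|h] := leP t 2^-1.
  rewrite f1; last by case/andP: t01 => -> _; rewrite h.
  have -> : 2 * t / n.+1%:R = (0%:R + 2 * t) / (size p')%:R by rewrite add0r np.
  by rewrite loop_edge//; move: t01; lra.
rewrite f2; last by case/andP: t01' => _ ->; rewrite ltW.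
have -> : 2 * t / n.+1%:R = (1%:R + (2 * t - 1)) / (size p')%:R.
  by congr (_ / _); ring.
by rewrite loop_edge//; move: t01; lra.
Qed.

End InsertVertex.

(** * Room around a triangle *)

Section TriangleMove.
Variable R : realType.
Implicit Types (p : 'rV[R]_3) (s t r X Y Z x y z eps : R).

Definition triangle (a b c : 'rV[R]_3) : set 'rV[R]_3 := [set p | exists s t,
  [/\ 0 <= s, 0 <= t, s + t <= 1 & p = a + s *: (b - a) + t *: (c - a)]].

Lemma small_eps_seq (n : nat) (Q : nat -> R -> Prop) :
  (forall i, (i < n)%N -> exists2 e0, 0 < e0 & forall e, 0 < e <= e0 -> Q i e) ->
  exists2 e0, 0 < e0 & forall e, 0 < e <= e0 -> forall i, (i < n)%N -> Q i e.
Proof.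
elim: n => [|n IH] H; first by exists 1.
have [|e1 e10 H1] := IH; first by move=> i i_n; apply: H; exact: ltnW.
have [e2 e20 H2] := H n (ltnSn n).
exists (Num.min e1 e2); first by rewrite lt_min e10.
move=> e; rewrite le_min => /and3P[e0 ee1 ee2] i.
by rewrite ltnS leq_eqVlt => /orP[/eqP ->|i_n];
  [apply: H2; rewrite e0|apply: H1 => //; rewrite e0].
Qed.

(* In the coordinates of the tent, a segment that issues from the corner
   (1, 0, 0) of the triangle |x| + y <= 1, 0 <= y, z = 0. *)
Lemma small_eps_corner X Y Z :
  (forall s, 0 < s <= 1 -> ~ [/\ `|1 + s * X| + s * Y <= 1, 0 <= s * Y & s * Z = 0]) ->
  exists2 e0, 0 < e0 & forall e, 0 < e <= e0 -> forall s, 0 <= s <= 1 ->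
    let k := 1 - `|1 + s * X| - `|s * Z| / e in
    k - s * Y / (1 + e) <= 0 \/ k + s * Y / e <= 0.
Proof.
move=> H.
(* The bound |1 + s X| >= 1 + s X makes both quantities at most s times an expression free of s, so
   that only the direction (X, Y, Z) matters. *)
suff [e0 e00 H0] : exists2 e0, 0 < e0 & forall e, 0 < e <= e0 ->
    - X - `|Z| / e - Y / (1 + e) <= 0 \/ - X - `|Z| / e + Y / e <= 0.
  exists e0 => // e he s /andP[s0 s1] k.
  have kb : k <= s * (- X - `|Z| / e).
    rewrite /k normrM (ger0_norm s0); have := ler_norm (1 + s * X).
    by rewrite mulrBr mulrA; lra.
  have e1 : 0 < 1 + e by case/andP: he; lra.
  have [h|h] := H0 e he; [left|right].
    by apply: le_trans (_ : s * (- X - `|Z| / e - Y / (1 + e)) <= 0); [nra|exact: mulr_ge0_le0].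
  by apply: le_trans (_ : s * (- X - `|Z| / e + Y / e) <= 0); [nra|exact: mulr_ge0_le0].
have nX := ler_norm (- X); rewrite normrN in nX.
have nY := ler_norm (- Y); rewrite normrN in nY.
have [Z0|Z0] := eqVneq Z 0; last first.
  have Zp : 0 < `|Z| by rewrite normr_gt0.
  have D : 0 < `|X| + `|Y| + 1 by rewrite ltr_wpDl// addr_ge0.
  exists (`|Z| / (`|X| + `|Y| + 1)); first by rewrite divr_gt0.
  move=> e /andP[e0]; rewrite ler_pdivlMr// mulrC -ler_pdivlMr// => he.
  left; have e1 : 0 < 1 + e by lra.
  have : - Y / (1 + e) <= `|Y|.
    rewrite ler_pdivrMr//; have := normr_ge0 Y; nra.
  by rewrite mulNr; lra.
have [Y0|Y0] := ltP Y 0.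
  have D : 0 < `|X| + 1 by rewrite ltr_wpDl.
  exists (- Y / (`|X| + 1)); first by rewrite divr_gt0// oppr_gt0.
  move=> e /andP[e0]; rewrite ler_pdivlMr// mulrC -ler_pdivlMr// => he.
  by right; rewrite Z0 normr0 mul0r; move: he; rewrite mulNr; lra.
have [X0|X0] := leP 0 X.
  exists 1 => // e /andP[e0 _]; left; rewrite Z0 normr0 mul0r.
  have : 0 <= Y / (1 + e) by rewrite divr_ge0//; lra.
  by lra.
(* Here X < 0 <= Y and Z = 0: if X + Y <= 0, a short initial piece of the segment would run inside
   the triangle. *)
have XY : 0 < X + Y.
  rewrite ltNge; apply/negP => XY.
  pose s := Num.min 1 (- X)^-1.
  have s0 : 0 < s by rewrite /s lt_min ltr01 invr_gt0; lra.
  have s1 : s <= 1 by rewrite /s ge_min lexx.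
  have s2 : s * - X <= 1.
    by rewrite -ler_pdivlMr ?div1r ?oppr_gt0// /s ge_min lexx orbT.
  apply: (H s); rewrite ?s0//; split.
  - by rewrite ger0_norm; nra.
  - exact: mulr_ge0 (ltW _) _.
  - by rewrite Z0 mulr0.
exists ((X + Y) / - X); first by rewrite divr_gt0//; lra.
move=> e /andP[e0]; rewrite ler_pdivlMr ?oppr_gt0// => he.
left; rewrite Z0 normr0 mul0r subr0.
have : - X <= Y / (1 + e) by rewrite ler_pdivlMr; nra.
by lra.
Qed.

(** Compactness: the function g below is continuous, nonnegative and zero exactly on the triangle,
    so it has a positive minimum along the segment. Where both quantities are positive, g < 2 e;
    half the minimum is therefore a suitable bound. *)
Lemma small_eps_disjoint (x y z : R -> R) :
  continuous x -> continuous y -> continuous z ->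
  (forall t, 0 <= t <= 1 -> ~ [/\ `|x t| + y t <= 1, 0 <= y t & z t = 0]) ->
  exists2 e0, 0 < e0 & forall e, 0 < e <= e0 -> forall t, 0 <= t <= 1 ->
    let k := 1 - `|x t| - `|z t| / e in
    k - y t / (1 + e) <= 0 \/ k + y t / e <= 0.
Proof.
move=> cx cy cz H.
pose g := (fun t => Num.max 0 (- y t) + `|z t| + Num.max 0 (`|x t| + Num.max 0 (y t) - 1)) : R -> R.
have cmax (f : R -> R) : continuous f -> continuous (fun t => Num.max 0 (f t)).
  by move=> cf t; apply: (@continuous_max _ _ (fun=> 0) f); [exact: cvg_cst|exact: cf].
have cg : continuous g.
  move=> t; apply: cvgD.
    apply: cvgD; last by apply: cvg_norm; exact: cz.
    by apply: (cmax (fun t => - y t)) => ?; apply: cvgN; exact: cy.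
  apply: (cmax (fun t => `|x t| + Num.max 0 (y t) - 1)) => ?.
  apply: cvgB; last exact: cvg_cst.
  apply: cvgD; first by apply: cvg_norm; exact: cx.
  exact: cmax.
have [t0 t01 gmin] := @EVT_min R g 0 1 ler01 (continuous_subspaceT cg).
rewrite in_itv /= in t01.
have m0 r : 0 <= Num.max 0 r by rewrite le_max lexx.
have mr r : r <= Num.max 0 r by rewrite le_max lexx orbT.
have g0 : 0 < g t0.
  rewrite lt_neqAle andbC !addr_ge0//=; apply/negP => /eqP g0.
  apply: (H t0 t01); move: (g0); rewrite /g => g0'.
  have := m0 (- y t0); have := mr (- y t0); have := normr_ge0 (z t0).
  have := m0 (`|x t0| + Num.max 0 (y t0) - 1).
  have := mr (`|x t0| + Num.max 0 (y t0) - 1); have := mr (y t0).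
  move=> *; split; [lra|lra|].
  by apply/eqP; rewrite -normr_le0; lra.
exists (g t0 / 2); first by rewrite divr_gt0.
move=> e /andP[e0 he] t t01' k.
have {}gmin : 2 * e <= g t by have := gmin t; rewrite in_itv /= => /(_ t01'); lra.
have [h1|h1] := leP (k - y t / (1 + e)) 0; first by left.
have [h2|h2] := leP (k + y t / e) 0; first by right.
have e1 : 0 < 1 + e by lra.
rewrite /k in h1 h2.
have z0 : 0 <= `|z t| / e by rewrite divr_ge0// ltW.
have zE : `|z t| = `|z t| / e * e by rewrite divfK// gt_eqF.
have x0 := normr_ge0 (x t).
exfalso; move: gmin; apply/negP; rewrite -ltNge /g.
have [y0|y0] := ltP (y t) 0.
  have yE : y t = y t / e * e by rewrite divfK// gt_eqF.
  have h3 : (`|z t| / e - y t / e) * e < 1 * e by rewrite ltr_pM2r//; lra.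
  have y1 : y t / (1 + e) <= 0 by rewrite ler_pdivrMr// mul0r ltW.
  have y2 : y t / e <= 0 by rewrite ler_pdivrMr// mul0r ltW.
  rewrite (max_r (_ : 0 <= - y t)); last by lra.
  by rewrite max_l; lra.
have yE : y t = y t / (1 + e) * (1 + e) by rewrite divfK// gt_eqF.
have y1 : 0 <= y t / (1 + e) by rewrite divr_ge0// ltW.
rewrite (max_l (_ : - y t <= 0)); last by lra.
have h3 : (`|z t| / e) * e < 1 * e by rewrite ltr_pM2r//; lra.
have h4 : `|x t| + y t < 1 + e by rewrite yE; nra.
by rewrite add0r; have [h|h] := leP (`|x t| + y t - 1) 0; lra.
Qed.

End TriangleMove.

(* Applying cvgD and the like at a point of 'rV_3 unfolds the neighbourhood
   filter of the product topology; over an abstract source it does not. *)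
Section ContinuousOperations.
Variables (R : realType) (T : topologicalType) (V : normedModType R).

Lemma continuous_fD (f g : T -> V) : continuous f -> continuous g ->
  continuous (fun x => f x + g x).
Proof. by move=> cf cg x; apply: cvgD; [exact: cf|exact: cg]. Qed.

Lemma continuous_fB (f g : T -> V) : continuous f -> continuous g ->
  continuous (fun x => f x - g x).
Proof. by move=> cf cg x; apply: cvgB; [exact: cf|exact: cg]. Qed.

Lemma continuous_fM (f g : T -> R) : continuous f -> continuous g ->
  continuous (fun x => f x * g x).
Proof. by move=> cf cg x; apply: cvgM; [exact: cf|exact: cg]. Qed.

Lemma continuous_fZ (f : T -> R) (v : V) : continuous f ->
  continuous (fun x => f x *: v).
Proof. by move=> cf x; apply: cvgZr_tmp; exact: cf. Qed.

Lemma continuous_fnorm (f : T -> R) : continuous f -> continuous (fun x => `|f x|).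
Proof. by move=> cf x; apply: cvg_norm; exact: cf. Qed.

Lemma continuous_clip (f g : T -> R) : continuous f -> continuous g ->
  continuous (fun x => Num.max 0 (Num.min (f x) (g x))).
Proof.
move=> cf cg x.
apply: (@continuous_max _ _ (fun=> 0) (fun x => Num.min (f x) (g x))).
  exact: cvg_cst.
by apply: (@continuous_min _ _ f g); [exact: cf|exact: cg].
Qed.

Lemma continuous_fcst (U : topologicalType) (u : U) : continuous (fun _ : T => u).
Proof. by move=> x; exact: cvg_cst. Qed.

Lemma continuous_fid : continuous (fun x : T => x).
Proof. by move=> x; exact: cvg_id. Qed.

Lemma continuous_fcomp (T' U : topologicalType) (g : T -> T') (f : T' -> U) :
  continuous g -> continuous f -> continuous (fun x => f (g x)).
Proof. by move=> cg cf x; apply: continuous_comp; [exact: cg|exact: cf]. Qed.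

End ContinuousOperations.

(** * The shear that pushes an edge across a triangle *)

Section TentIsotopy.
Variable R : realType.
Variables a b c n : 'rV[R]_3.
Implicit Types (p u v : 'rV[R]_3) (s t r eps : R).

Definition tri_frame : 'M[R]_3 := \matrix_(i < 3) [:: b - a; c - a; n]`_i.

Hypothesis frame_unit : tri_frame \in unitmx.

Let co (i : 'I_3) v : R := (v *m invmx tri_frame) 0 i.

Let coD i u v : co i (u + v) = co i u + co i v.
Proof. by rewrite /co mulmxDl mxE. Qed.

Let coZ i s v : co i (s *: v) = s * co i v.
Proof. by rewrite /co -scalemxAl mxE. Qed.

Let co_row i (j : 'I_3) : co i [:: b - a; c - a; n]`_j = (j == i)%:R.
Proof.
have -> : [:: b - a; c - a; n]`_j = row j tri_frame by rewrite rowK.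
by rewrite /co -row_mul mulmxV// row1 mxE eqxx /= eq_sym.
Qed.

Let i0 : 'I_3 := ord0.
Let i1 : 'I_3 := lift ord0 ord0.
Let i2 : 'I_3 := lift ord0 (lift ord0 ord0).

Let coE v : v = co i0 v *: (b - a) + co i1 v *: (c - a) + co i2 v *: n.
Proof.
rewrite -[LHS](mulmxKV frame_unit) mulmx_sum_row !big_ord_recl big_ord0 addr0 addrA.
by rewrite !rowK.
Qed.

Let co_continuous i : continuous (co i).
Proof.
have -> : co i = fun v => v 0 i0 * invmx tri_frame i0 i +
    (v 0 i1 * invmx tri_frame i1 i + v 0 i2 * invmx tri_frame i2 i).
  by apply/funext => u; rewrite /co mxE !big_ord_recl big_ord0 addr0.
have cM j : continuous (fun v : 'rV[R]_3 => v 0 j * invmx tri_frame j i).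
  by apply: continuous_fM; [exact: coord_continuous|exact: continuous_fcst].
by apply: (@continuous_fD R _ R); [exact: cM|apply: (@continuous_fD R _ R); exact: cM].
Qed.

(** In the coordinates (xc, yc, zc) the points a, b, c are (-1, 0, 0), (1, 0, 0), (0, 1, 0); w leads
    from the midpoint of ab to c and is the unit vector of the second axis. *)
Let w := c - 2^-1 *: (a + b).
Let xc p := 2 * co i0 (p - a) - 1 + co i1 (p - a).
Let yc p := co i1 (p - a).
Let zc p := co i2 (p - a).

Let wE : w = - 2^-1 *: (b - a) + (c - a).
Proof. by apply/rowP => i; rewrite !mxE; field. Qed.

Let co_e (i : 'I_3) : co i (b - a) = (i0 == i)%:R. Proof. exact: (co_row i i0). Qed.
Let co_f (i : 'I_3) : co i (c - a) = (i1 == i)%:R. Proof. exact: (co_row i i1). Qed.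

Let co_w (i : 'I_3) : co i w = - 2^-1 * (i0 == i)%:R + (i1 == i)%:R.
Proof. by rewrite wE (coD i (_ *: _)) coZ co_e co_f. Qed.

Let xcw p s : xc (p + s *: w) = xc p.
Proof. by rewrite /xc (addrAC p) !(coD _ (p - a)) !coZ !co_w /=; field. Qed.
Let ycw p s : yc (p + s *: w) = yc p + s.
Proof. by rewrite /yc (addrAC p) !(coD _ (p - a)) !coZ !co_w /=; field. Qed.
Let zcw p s : zc (p + s *: w) = zc p.
Proof. by rewrite /zc (addrAC p) !(coD _ (p - a)) !coZ !co_w /=; field. Qed.

Let coordsE p : p = a + (2^-1 * (1 + xc p - yc p)) *: (b - a) + yc p *: (c - a) + zc p *: n.
Proof.
rewrite -[LHS](subrK a) {1}[p - a]coE addrC -!addrA; congr (_ + (_ *: _ + _)).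
by rewrite /xc /yc; field.
Qed.

Let triangleP p : `|xc p| + yc p <= 1 -> 0 <= yc p -> zc p = 0 -> triangle a b c p.
Proof.
move=> h1 h2 h3; exists (2^-1 * (1 + xc p - yc p)), (yc p).
have := ler_norm (xc p); have := ler_norm (- xc p); rewrite normrN => h4 h5.
by split=> //; [lra|lra|rewrite {1}[p]coordsE h3 scale0r addr0].
Qed.

Let sub_lerp u v t : lerp u v t - a = (1 - t) *: (u - a) + t *: (v - a).
Proof. by apply/rowP => i; rewrite !mxE; ring. Qed.

Let xc_lerp u v t : xc (lerp u v t) = (1 - t) * xc u + t * xc v.
Proof.
rewrite /xc sub_lerp !(coD _ (_ *: _)) !coZ.
move: (co i0 (u - a)) (co i1 (u - a)) (co i0 (v - a)) (co i1 (v - a)) => A B C D.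
by ring.
Qed.
Let yc_lerp u v t : yc (lerp u v t) = (1 - t) * yc u + t * yc v.
Proof. by rewrite /yc sub_lerp (coD _ (_ *: _)) !coZ. Qed.
Let zc_lerp u v t : zc (lerp u v t) = (1 - t) * zc u + t * zc v.
Proof. by rewrite /zc sub_lerp (coD _ (_ *: _)) !coZ. Qed.

Let xca : xc a = -1. Proof. by rewrite /xc subrr -[0](scale0r a) !coZ; ring. Qed.
Let yca : yc a = 0. Proof. by rewrite /yc subrr -[0](scale0r a) !coZ; ring. Qed.
Let zca : zc a = 0. Proof. by rewrite /zc subrr -[0](scale0r a) !coZ; ring. Qed.
Let xcb : xc b = 1. Proof. by rewrite /xc !co_e /=; ring. Qed.
Let ycb : yc b = 0. Proof. by rewrite /yc !co_e. Qed.
Let zcb : zc b = 0. Proof. by rewrite /zc !co_e. Qed.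

Let kap eps p := 1 - `|xc p| - `|zc p| / eps.

(** On the edge ab the bump is 1 - |xc|, the height of the triangle above that point, so that at
    time 1 the edge lies on ac and cb. The support shrinks to the triangle as [eps] tends to 0. *)
Definition tent_bump eps p := tent (1 + eps) eps (kap eps p) (yc p).

Let bump_eq0 eps p :
  kap eps p - yc p / (1 + eps) <= 0 \/ kap eps p + yc p / eps <= 0 -> tent_bump eps p = 0.
Proof.
by move=> h; rewrite /tent_bump /tent max_l// ge_min; case: h => ->; rewrite ?orbT.
Qed.

Let affine_continuous r s : continuous (fun t : R => (1 - t) * r + t * s).
Proof.
move=> t; apply: cvgD; apply: cvgM; try exact: cvg_cst; last exact: cvg_id.
by apply: cvgB; [exact: cvg_cst|exact: cvg_id].
Qed.

Definition misses u v := forall t, 0 <= t <= 1 -> ~ triangle a b c (lerp u v t).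

(** Meant for the two neighbours of the edge ab in its polygon: one starts at b, the other ends at
    a. *)
Definition touches u v :=
  (u = b /\ forall t, 0 < t <= 1 -> ~ triangle a b c (lerp u v t)) \/
  (v = a /\ forall t, 0 <= t < 1 -> ~ triangle a b c (lerp u v t)).

Lemma bump_misses u v : misses u v ->
  exists2 e0, 0 < e0 & forall e, 0 < e <= e0 ->
    forall t, 0 <= t <= 1 -> tent_bump e (lerp u v t) = 0.
Proof.
move=> H.
have [||||e0 e00 He] := @small_eps_disjoint R (fun t => (1 - t) * xc u + t * xc v)
  (fun t => (1 - t) * yc u + t * yc v) (fun t => (1 - t) * zc u + t * zc v).
- exact: affine_continuous.
- exact: affine_continuous.
- exact: affine_continuous.
- move=> t t01; rewrite -xc_lerp -yc_lerp -zc_lerp => -[h1 h2 h3].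
  by apply: (H t t01); exact: triangleP.
exists e0 => // e he t t01; apply: bump_eq0.
by have := He e he t t01; rewrite /kap xc_lerp yc_lerp zc_lerp.
Qed.

Lemma bump_touches u v : touches u v ->
  exists2 e0, 0 < e0 & forall e, 0 < e <= e0 ->
    forall t, 0 <= t <= 1 -> tent_bump e (lerp u v t) = 0.
Proof.
move=> [[-> H]|[-> H]].
  have E s : [/\ xc (lerp b v s) = 1 + s * (xc v - 1), yc (lerp b v s) = s * yc v
      & zc (lerp b v s) = s * zc v].
    by rewrite xc_lerp yc_lerp zc_lerp xcb ycb zcb; split; ring.
  have [|e0 e00 He] := @small_eps_corner R (xc v - 1) (yc v) (zc v).
    move=> s s01; have [<- <- <-] := E s => -[h1 h2 h3].
    by apply: (H s s01); exact: triangleP.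
  exists e0 => // e he t t01; apply: bump_eq0.
  by have := He e he t t01; rewrite /kap; have [-> -> ->] := E t.
(* The corner a is carried to the corner b by changing the sign of xc and reversing the segment. *)
have E s : [/\ xc (lerp u a s) = - (1 + (1 - s) * (- xc u - 1)),
    yc (lerp u a s) = (1 - s) * yc u & zc (lerp u a s) = (1 - s) * zc u].
  by rewrite xc_lerp yc_lerp zc_lerp xca yca zca; split; ring.
have [|e0 e00 He] := @small_eps_corner R (- xc u - 1) (yc u) (zc u).
  move=> s s01; rewrite -normrN; have := E (1 - s); rewrite subKr.
  move=> [<- <- <-] [h1 h2 h3].
  by apply: (H (1 - s)); [lra|exact: triangleP].
exists e0 => // e he t t01; apply: bump_eq0.
have := He e he (1 - t); rewrite /kap -normrN; have [-> -> ->] := E t.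
by apply; lra.
Qed.

Section Isotopy.
Variable eps : R.
Hypothesis eps01 : 0 < eps <= 1.

Let move_by t p := p + (t * tent_bump eps p) *: w.
Let move_inv t p := p - (t * tent_inv (1 + eps) eps t (kap eps p) (yc p)) *: w.

Let al1 : 1 < 1 + eps. Proof. by case/andP: eps01; rewrite ltrDl. Qed.
Let be0 : 0 < eps. Proof. by case/andP: eps01. Qed.

Let kapw p s : kap eps (p + s *: w) = kap eps p.
Proof. by rewrite /kap xcw zcw. Qed.

Let move_byK t : 0 <= t <= 1 -> cancel (move_by t) (move_inv t).
Proof.
move=> t01 p; rewrite /move_inv /move_by kapw ycw /tent_bump tent_invK//.
by rewrite addrK.
Qed.

Let move_invK t : 0 <= t <= 1 -> cancel (move_inv t) (move_by t).
Proof.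
move=> t01 p; rewrite /move_by /move_inv /tent_bump -scaleNr kapw ycw tentK//.
by rewrite scaleNr subrK.
Qed.

Let Bd := `|a| + 2 * `|b - a| + 2 * `|c - a| + `|n|.

(** If both branches of the tent are positive, then |xc| <= 1, |zc| <= eps and - eps <= yc <= 1 +
    eps. As eps <= 1, the bound [Bd] is the same for every eps. *)
Let bump_far p : Bd < `|p| -> tent_bump eps p = 0.
Proof.
move=> h; apply: bump_eq0.
have [h1|h1] := leP (kap eps p - yc p / (1 + eps)) 0; first by left.
have [h2|h2] := leP (kap eps p + yc p / eps) 0; first by right.
have /andP[e0 e1] := eps01; have a1 := al1.
exfalso; move: h; apply/negP; rewrite -leNgt.
rewrite /kap in h1 h2.
have z0 : 0 <= `|zc p| / eps by rewrite divr_ge0// ltW.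
have zE : `|zc p| = `|zc p| / eps * eps by rewrite divfK// gt_eqF.
have x0 := normr_ge0 (xc p).
have [y1 y2 x1 z1] : [/\ yc p <= 2, - 1 <= yc p, `|xc p| <= 1 & `|zc p| <= 1].
  have yE : yc p = yc p / eps * eps by rewrite divfK// gt_eqF.
  have yE' : yc p = yc p / (1 + eps) * (1 + eps) by rewrite divfK// gt_eqF//; lra.
  have [y0|y0] := leP 0 (yc p).
    have q0 : 0 <= yc p / (1 + eps) by rewrite divr_ge0//; lra.
    by split; [rewrite yE'; nra|lra|lra|rewrite zE; nra].
  have q0 : yc p / eps <= 0 by rewrite ler_pdivrMr// mul0r ltW.
  by split; [lra|rewrite yE; nra|lra|rewrite zE; nra].
have {}y1 : `|yc p| <= 2 by rewrite ler_norml; lra.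
rewrite [p]coordsE; apply: le_trans (ler_normD _ _) _.
apply: lerD; last by rewrite normrZ ler_piMl.
apply: le_trans (ler_normD _ _) _.
apply: lerD; last by rewrite normrZ ler_wpM2r.
apply: le_trans (ler_normD _ _) _.
apply: lerD; first by [].
rewrite normrZ ler_wpM2r//; move: x1 y1; rewrite !ler_norml; lra.
Qed.

Let co_sub_continuous i : continuous (fun p => co i (p - a)).
Proof.
apply: (@continuous_fcomp _ _ _ (fun p => p - a) (co i)); last exact: co_continuous.
by apply: continuous_fB; [exact: continuous_fid|exact: continuous_fcst].
Qed.

Let kap_continuous : continuous (kap eps).
Proof.
apply: (@continuous_fB R _ R).
  apply: (@continuous_fB R _ R); first exact: continuous_fcst.
  apply: continuous_fnorm; apply: (@continuous_fD R _ R); last exact: co_sub_continuous.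
  apply: (@continuous_fB R _ R); last exact: continuous_fcst.
  by apply: continuous_fM; [exact: continuous_fcst|exact: co_sub_continuous].
apply: continuous_fM; last exact: continuous_fcst.
by apply: continuous_fnorm; exact: co_sub_continuous.
Qed.

Let bump_continuous : continuous (tent_bump eps).
Proof.
apply: continuous_clip.
  apply: (@continuous_fB R _ R); first exact: kap_continuous.
  by apply: continuous_fM; [exact: co_sub_continuous|exact: continuous_fcst].
apply: (@continuous_fD R _ R); first exact: kap_continuous.
by apply: continuous_fM; [exact: co_sub_continuous|exact: continuous_fcst].
Qed.

Let move_inv_continuous t : continuous (move_inv t).
Proof.
apply: continuous_fB; first exact: continuous_fid.
apply: continuous_fZ; apply: continuous_fM; first exact: continuous_fcst.
apply: continuous_clip; (apply: continuous_fM; last exact: continuous_fcst).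
  apply: (@continuous_fB R _ R); last exact: co_sub_continuous.
  by apply: continuous_fM; [exact: continuous_fcst|exact: kap_continuous].
apply: (@continuous_fD R _ R); first exact: co_sub_continuous.
by apply: continuous_fM; [exact: continuous_fcst|exact: kap_continuous].
Qed.

Let move_by_continuous : continuous (fun z : R * 'rV[R]_3 => move_by z.1 z.2).
Proof.
apply: continuous_fD; first by move=> z; exact: cvg_snd.
apply: continuous_fZ; apply: continuous_fM; first by move=> z; exact: cvg_fst.
apply: (@continuous_fcomp _ _ _ snd (tent_bump eps)); last exact: bump_continuous.
by move=> z; exact: cvg_snd.
Qed.

Definition tent_isotopy t : S3 R -> S3 R := ext (move_by t).

Lemma tent_isotopyP : ambient_isotopy tent_isotopy.
Proof.
have far t v : Bd < `|v| -> move_by t v = v.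
  by move=> /bump_far; rewrite /move_by => ->; rewrite mulr0 scale0r addr0.
have cH := ext_continuous move_by_continuous far.
split; first exact: continuous_subspaceT.
  move=> t t01; split.
    apply: (ext_continuous1 (M := Bd)); last exact: far.
    apply: (@continuous_fcomp _ _ _ (fun p => (t, p))
      (fun z : R * 'rV[R]_3 => move_by z.1 z.2)); last exact: move_by_continuous.
    move=> p; apply: (@cvg_pair _ _ _ (nbhs p) (nbhs t) (nbhs p)).
      exact: cvg_cst.
    exact: cvg_id.
  exists (ext (move_inv t)); split.
  - apply: (ext_continuous1 (M := Bd)); first exact: move_inv_continuous.
    by move=> v vB; rewrite -{1}(far t v vB) move_byK.
  - by move=> [p|] //=; rewrite move_byK.
  - by move=> [p|] //=; rewrite move_invK.
by move=> [p|] //=; rewrite /move_by mul0r scale0r addr0.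
Qed.

Lemma tent_isotopy_edge t : 0 <= t <= 1 -> tent_isotopy 1 (Some (lerp a b t)) =
  Some (if t <= 2^-1 then lerp a c (2 * t) else lerp c b (2 * t - 1)).
Proof.
move=> t01; rewrite /tent_isotopy /= /move_by mul1r /tent_bump /tent.
rewrite /kap xc_lerp yc_lerp zc_lerp xca xcb yca ycb zca zcb !mulr0 !addr0.
rewrite normr0 !mul0r !subr0 addr0 /Num.min ltxx.
congr Some; case: ifPn => h.
  rewrite ler0_norm; last by lra.
  rewrite max_r; last by lra.
  by apply/rowP => i; rewrite !mxE; field.
rewrite -ltNge in h; rewrite ger0_norm; last by lra.
rewrite max_r; last by lra.
by apply/rowP => i; rewrite !mxE; field.
Qed.

Lemma tent_isotopy_fix p : tent_bump eps p = 0 -> tent_isotopy 1 (Some p) = Some p.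
Proof. by move=> h; rewrite /tent_isotopy /= /move_by h mulr0 scale0r addr0. Qed.

End Isotopy.
End TentIsotopy.

(** Each of the finitely many other edges is left fixed by the shear once eps is small enough; with
    a common eps, the isotopy at time 1 moves nothing of the link but the edge ab. *)
Theorem isotopic_triangle (R : realType) (L L' : link R) (a b c n : 'rV[R]_3)
    (P : seq 'rV[R]_3) (S : seq (seq 'rV[R]_3)) :
  tri_frame a b c n \in unitmx ->
  comps L = (a :: b :: P) :: S -> comps L' = (a :: c :: b :: P) :: S ->
  (forall i, (0 < i < size (a :: b :: P))%N ->
    let u := (a :: b :: P)`_i in
    let v := (a :: b :: P)`_(i.+1 %% size (a :: b :: P)) in
    misses a b c u v \/ touches a b c u v) ->
  (forall q, q \in S -> (0 < size q)%N) ->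
  (forall q i, q \in S -> (i < size q)%N -> misses a b c q`_i q`_(i.+1 %% size q)) ->
  isotopic L L'.
Proof.
move=> fu LE LE' HP S0 HS; set p := a :: b :: P in LE HP.
have [e1 e10 H1] : exists2 e0, 0 < e0 & forall e, 0 < e <= e0 ->
    forall i, (i < size p)%N -> (0 < i)%N -> forall t, 0 <= t <= 1 ->
      tent_bump a b c n e (lerp p`_i p`_(i.+1 %% size p) t) = 0.
  apply: small_eps_seq => -[|i] iP; first by exists 1.
  have [h|h] := HP i.+1 iP.
    by have [e0 e00 He] := bump_misses fu h; exists e0 => // e /He.
  by have [e0 e00 He] := bump_touches fu h; exists e0 => // e /He.
have [e2 e20 H2] : exists2 e0, 0 < e0 & forall e, 0 < e <= e0 ->
    forall j, (j < size S)%N -> forall i, (i < size (nth [::] S j))%N ->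
      forall t, 0 <= t <= 1 ->
      tent_bump a b c n e
        (lerp (nth [::] S j)`_i (nth [::] S j)`_(i.+1 %% size (nth [::] S j)) t) = 0.
  apply: small_eps_seq => j jS; apply: small_eps_seq => i iq.
  by apply: bump_misses => //; apply: HS => //; exact: mem_nth.
pose e := Num.min 1 (Num.min e1 e2).
have e0 : 0 < e by rewrite !lt_min ltr01 e10.
have e01 : 0 < e <= 1 by rewrite e0 ge_min lexx.
have {}H1 := H1 e ltac:(by rewrite e0 !ge_min lexx !orbT).
have {}H2 := H2 e ltac:(by rewrite e0 !ge_min lexx !orbT).
exists (tent_isotopy a b c n e), (comps L'); split => //.
- exact: tent_isotopyP.
- by rewrite LE LE'.
move=> [_|j]; rewrite LE LE'; last first.
  move=> /= jS; have q0 := S0 _ (mem_nth [::] jS).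
  apply: same_oriented_curve_refl => s.
  have [r [i [t [iq t01 ->]]]] := paramP s q0.
  have t01' : 0 <= t <= 1 by move: t01 => /andP[-> /ltW ->].
  rewrite loopD_int// loop_edge//; apply: tent_isotopy_fix.
  exact: H2.
(* The isotopy sends [Some] to [Some], so the default of [odflt] never occurs. *)
pose f v := odflt v (tent_isotopy a b c n e 1 (Some v)).
have [t ht|t ht|i t /andP[i0 ip] ht|phi [c1 c2 c3 c4]] :=
  @same_curve_insert_vertex R f a b c P.
- rewrite /f tent_isotopy_edge//; last by lra.
  by case/andP: ht => _ ->.
- rewrite /f tent_isotopy_edge//; last by lra.
  case: ifPn => //= h; have -> : t = 2^-1 by lra.
  by rewrite mulfV// subrr lerp1 lerp0.
- by move=> v; rewrite /f (tent_isotopy_fix (H1 _ ip i0 _ ht)).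
exists phi; split => // s /=; rewrite -c4; exact: erefl.
Qed.

Section Det3.
Variable R : comNzRingType.

Lemma det3 (u v w : 'rV[R]_3) : let M := \matrix_(i < 3) [:: u; v; w]`_i in
  let i0 : 'I_3 := ord0 in let i1 := lift ord0 ord0 in let i2 := lift ord0 (lift ord0 ord0) in
  \det M = u 0 i0 * (v 0 i1 * w 0 i2 - v 0 i2 * w 0 i1)
         + u 0 i1 * (v 0 i2 * w 0 i0 - v 0 i0 * w 0 i2)
         + u 0 i2 * (v 0 i0 * w 0 i1 - v 0 i1 * w 0 i0).
Proof.
move=> M i0 i1 i2.
have rowE (x : 'rV[R]_3) : x = \row_(j < 3) [:: x 0 i0; x 0 i1; x 0 i2]`_j.
  by apply/rowP => -[[|[|[|j]]] jP] //; rewrite mxE /=; congr (x 0 _); apply: val_inj.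
rewrite /M {1}[u]rowE {1}[v]rowE {1}[w]rowE.
move: (u 0 i0) (u 0 i1) (u 0 i2) (v 0 i0) (v 0 i1) (v 0 i2) (w 0 i0) (w 0 i1) (w 0 i2).
move=> u0 u1 u2 v0 v1 v2 w0 w1 w2.
rewrite (expand_det_row _ i0) !big_ord_recl big_ord0 /cofactor.
rewrite !(expand_det_row _ ord0) !big_ord_recl !big_ord0 /cofactor !det_mx11 !mxE /=.
rewrite /bump /= !(addn0, add0n, expr0, expr1, addn1, expr2). ring.
Qed.

End Det3.

(** * Integral polygons and decidable disjointness *)

Notation zpoint := (Z * Z * Z)%type.

(** Coordinates are binary integers because the checks are run by [vm_compute] on concrete
    pictures. *)
Definition zsub (a b : zpoint) : zpoint :=
  (Z.sub a.1.1 b.1.1, Z.sub a.1.2 b.1.2, Z.sub a.2 b.2).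
Definition zdot (a b : zpoint) : Z :=
  Z.add (Z.mul a.1.1 b.1.1) (Z.add (Z.mul a.1.2 b.1.2) (Z.mul a.2 b.2)).
Definition zcross (a b : zpoint) : zpoint :=
  (Z.sub (Z.mul a.1.2 b.2) (Z.mul a.2 b.1.2),
   Z.sub (Z.mul a.2 b.1.1) (Z.mul a.1.1 b.2),
   Z.sub (Z.mul a.1.1 b.1.2) (Z.mul a.1.2 b.1.1)).

(** Most edges lie in the plane z = 0, where cross products of differences give only the normal of
    that plane; products with an axis supply the separating planes perpendicular to it. *)
Definition zaxes : seq zpoint :=
  let o := Z0 in let e := Zpos xH in let m := Zneg xH in
  [:: (e, o, o); (o, e, o); (o, o, e); (m, o, o); (o, m, o); (o, o, m)].

(* Two disjoint polytopes are separated by a plane with a normal among these: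
   differences of vertices, and cross products of two of them. *)
Definition normals (A : seq zpoint) : seq zpoint :=
  let D := zaxes ++ [seq zsub a b | a <- A, b <- A] in
  D ++ [seq zcross d e | d <- D, e <- D].

Definition apart (A B : seq zpoint) : bool :=
  has (fun N => all (fun a => all (fun b => Z.ltb (zdot N a) (zdot N b)) B) A)
      (normals (A ++ B)).

(* The hull of v and A meets the segment from v to b only at v. *)
Definition meets_only (v : zpoint) (A : seq zpoint) (b : zpoint) : bool :=
  has (fun N => let m := zdot N v in
         Z.ltb m (zdot N b) && all (fun a => Z.leb (zdot N a) m) A)
      (normals (v :: b :: A)).

Definition z0 : zpoint := (Z0, Z0, Z0).

Definition znext (p : seq zpoint) i := nth z0 p (i.+1 %% size p).

(** Neighbouring edges share a vertex and cannot be strictly separated. The first exception is for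
    consecutive edges, the second for the last edge and the first. *)
Definition zsimple (p : seq zpoint) : bool :=
  [&& (2 < size p)%N, all (fun i => nth z0 p i != znext p i) (iota 0 (size p))
    & all (fun j => all (fun i =>
    if j == i.+1 then meets_only (nth z0 p j) [:: nth z0 p i] (znext p j)
    else if (i == 0%N) && (j.+1 == size p) then
      meets_only (nth z0 p 0) [:: nth z0 p 1] (nth z0 p j)
    else apart [:: nth z0 p i; znext p i] [:: nth z0 p j; znext p j])
    (iota 0 j)) (iota 0 (size p))].

Definition zmisses (A : seq zpoint) (p : seq zpoint) : bool :=
  all (fun i => apart A [:: nth z0 p i; znext p i]) (iota 0 (size p)).

Definition zdisjoint (p q : seq zpoint) : bool :=
  all (fun i => zmisses [:: nth z0 p i; znext p i] q) (iota 0 (size p)).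

(** Only the first coordinate is bounded: pictures are kept apart along that axis alone. *)
Definition in_slab (K : Z) (a : zpoint) : bool :=
  Z.ltb (Z.opp K) a.1.1 && Z.ltb a.1.1 K.

Definition zbox (K : Z) (X : seq (seq zpoint)) : bool :=
  all (all (in_slab K)) X.

Definition zlink (K : Z) (X : seq (seq zpoint)) : bool :=
  [&& ~~ nilp X, all zsimple X, pairwise zdisjoint X & zbox K X].

(** The frame b - a, c - a, n has determinant n.n, whence the first test. The two [meets_only] tests
    concern the edge that leaves b and the edge that arrives at a. *)
Definition ztriangle (a b c : zpoint) (P : seq zpoint) (X : seq (seq zpoint)) : bool :=
  let n := zcross (zsub b a) (zsub c a) in
  [&& ~~ Z.eqb (zdot n n) Z0, ~~ nilp P,
      meets_only b [:: a; c] (nth z0 P 0),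
      meets_only a [:: b; c] (nth z0 P (size P).-1),
      all (fun i => apart [:: a; b; c] [:: nth z0 P i; nth z0 P i.+1]) (iota 0 (size P).-1)
    & all (zmisses [:: a; b; c]) X].

(** * From integral checks to real polygons *)

Section Realization.
Variable R : realType.
Implicit Types (o v x : 'rV[R]_3) (N a b c : zpoint) (A B p q : seq zpoint).
Implicit Types (s t : R) (K : Z) (X Y : seq (seq zpoint)) (S : seq (seq 'rV[R]_3)).

Definition zr (z : Z) : R := (int_of_Z z)%:~R.

Lemma zrD (x y : Z) : zr (Z.add x y) = zr x + zr y.
Proof. by rewrite /zr -intrD; congr intmul; lia. Qed.
Lemma zrN (x : Z) : zr (Z.opp x) = - zr x.
Proof. by rewrite /zr -intrN; congr intmul; lia. Qed.
Lemma zrB (x y : Z) : zr (Z.sub x y) = zr x - zr y.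
Proof. by rewrite -Z.add_opp_r zrD zrN. Qed.
Lemma zrM (x y : Z) : zr (Z.mul x y) = zr x * zr y.
Proof. by rewrite /zr -intrM; congr intmul; lia. Qed.
Lemma zr_lt (x y : Z) : Z.ltb x y -> zr x < zr y.
Proof. by move=> h; rewrite /zr ltr_int; lia. Qed.
Lemma zr_le (x y : Z) : Z.leb x y -> zr x <= zr y.
Proof. by move=> h; rewrite /zr ler_int; lia. Qed.
Lemma zr_eq0 (x : Z) : ~~ Z.eqb x Z0 -> zr x != 0.
Proof. by move=> h; rewrite /zr intr_eq0; lia. Qed.

Definition zrow a : 'rV[R]_3 := \row_(i < 3) [:: zr a.1.1; zr a.1.2; zr a.2]`_i.

Definition pt o a : 'rV[R]_3 := o + zrow a.

Definition lin N v : R := zr N.1.1 * v 0 ord0 +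
  (zr N.1.2 * v 0 (lift ord0 ord0) + zr N.2 * v 0 (lift ord0 (lift ord0 ord0))).

Lemma zr_inj : injective zr.
Proof. by move=> x y /intr_inj E; lia. Qed.

Lemma pt_inj o : injective (pt o).
Proof.
move=> [[a1 a2] a3] [[b1 b2] b3] /addrI /rowP E.
have := E ord0; have := E (lift ord0 ord0); have := E (lift ord0 (lift ord0 ord0)).
by rewrite !mxE /= => /zr_inj -> /zr_inj -> /zr_inj ->.
Qed.

Lemma lin_pt N o a : lin N (pt o a) = lin N o + zr (zdot N a).
Proof. by rewrite /lin /pt /zdot !mxE /= !(zrD, zrM); ring. Qed.

Lemma linD N x v : lin N (x + v) = lin N x + lin N v.
Proof. by rewrite /lin !mxE; ring. Qed.

Lemma linZ N t v : lin N (t *: v) = t * lin N v.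
Proof. by rewrite /lin !mxE; ring. Qed.

Lemma linB N x v : lin N (x - v) = lin N x - lin N v.
Proof. by rewrite /lin !mxE; ring. Qed.

Definition zopp N : zpoint := (Z.opp N.1.1, Z.opp N.1.2, Z.opp N.2).

Lemma lin_opp N v : lin (zopp N) v = - lin N v.
Proof. by rewrite /lin /zopp !zrN; ring. Qed.

Lemma convex3_lt (r1 r2 r3 x1 x2 x3 y r : R) : 0 <= r1 -> 0 <= r2 -> 0 <= r3 ->
  r1 + r2 + r3 = 1 -> x1 < r -> x2 < r -> x3 < r ->
  y = r1 * x1 + r2 * x2 + r3 * x3 -> y < r.
Proof.
move=> p1 p2 p3 p h1 h2 h3 ->.
(* Some weights may vanish; strictness is kept by the smallest gap d, since every value is at most r
   - d and hence so is y. *)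
pose d := Num.min (r - x1) (Num.min (r - x2) (r - x3)).
have d0 : 0 < d by rewrite !lt_min !subr_gt0 h1 h2.
have [d1 d2 d3] : [/\ d <= r - x1, d <= r - x2 & d <= r - x3].
  by rewrite !ge_min !lexx !orbT.
have q1 : 0 <= r1 * (r - x1 - d) by rewrite mulr_ge0// subr_ge0.
have q2 : 0 <= r2 * (r - x2 - d) by rewrite mulr_ge0// subr_ge0.
have q3 : 0 <= r3 * (r - x3 - d) by rewrite mulr_ge0// subr_ge0.
have -> : r1 = 1 - r2 - r3 by lra.
have := q1; have -> : r1 = 1 - r2 - r3 by lra.
by lra.
Qed.

(* For A nonempty this is membership in the convex hull of A, expressed by
   integral linear forms. *)
Definition in_hull o A x := forall N r,
  (forall a, a \in A -> lin N (pt o a) < r) -> lin N x < r.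

Lemma in_hull_lerp o a b t : 0 <= t <= 1 -> in_hull o [:: a; b] (lerp (pt o a) (pt o b) t).
Proof.
move=> t01 N r H; have := H a; have := H b; rewrite !inE !eqxx orbT => /(_ isT) h2 /(_ isT) h1.
rewrite /lerp linD !linZ.
move: h1 h2; move: (lin N (pt o a)) (lin N (pt o b)) => A B h1 h2.
by refine (@convex3_lt (1 - t) t 0 A B B _ r _ _ _ _ h1 h2 h2 _); lra.
Qed.

Lemma in_hull_triangle o a b c x : triangle (pt o a) (pt o b) (pt o c) x ->
  in_hull o [:: a; b; c] x.
Proof.
move=> [s [t [s0 t0 st ->]]] N r H.
have := H a; have := H b; have := H c; rewrite !inE !eqxx !orbT.
move=> /(_ isT) h3 /(_ isT) h2 /(_ isT) h1.
move: (pt o a) (pt o b) (pt o c) h1 h2 h3 => A B C h1 h2 h3.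
rewrite !(linB, linZ, linD).
by refine (@convex3_lt (1 - s - t) s t _ _ _ _ r _ _ _ _ h1 h2 h3 _); lra.
Qed.

Lemma in_hull_sub o A B x : {subset A <= B} -> in_hull o A x -> in_hull o B x.
Proof. by move=> AB H N r h; apply: H => a /AB; exact: h. Qed.

Lemma apartP o A B x : apart A B -> in_hull o A x -> in_hull o B x -> False.
Proof.
move=> /hasP[N _ /allP H] hA hB.
(* Membership in the hull of A puts N x strictly below N on each point of B; membership in the hull
   of B, applied to -N, then puts N x strictly above itself. *)
suff : lin (zopp N) x < - lin N x by rewrite lin_opp ltxx.
apply: hB => b bB; rewrite lin_opp ltrN2; apply: hA => a aA.
by rewrite !lin_pt ltrD2l zr_lt//; move/allP : (H a aA); apply.
Qed.

Lemma meets_onlyP o a A b t : meets_only a A b -> 0 <= t ->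
  in_hull o (a :: A) (lerp (pt o a) (pt o b) t) -> t = 0.
Proof.
move=> /hasP[N _ /andP[ab /allP H]] t0 h.
have hb : lin N (pt o a) < lin N (pt o b) by rewrite !lin_pt ltrD2l zr_lt.
set y := lerp _ _ _ in h.
have : lin N y <= lin N (pt o a).
  rewrite leNgt; apply/negP => hv.
  have := h N (lin N y); rewrite ltxx => F; suff : false by []; apply: F.
  move=> c; rewrite inE => /orP[/eqP ->//|/H aA].
  by apply: le_lt_trans hv; rewrite !lin_pt lerD2l zr_le.
rewrite /y /lerp linD !linZ => h1; apply/eqP; rewrite eq_le t0 andbT; nra.
Qed.

Definition zpoly o p := map (pt o) p.

Lemma nth_zpoly o p i : (i < size p)%N -> (zpoly o p)`_i = pt o (nth z0 p i).
Proof. by move=> ip; rewrite (nth_map z0). Qed.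

Lemma nth_znext o p i : (0 < size p)%N -> (zpoly o p)`_(i.+1 %% size p) = pt o (znext p i).
Proof. by move=> p0; rewrite nth_zpoly// ltn_mod. Qed.

Lemma zsimpleP o p : zsimple p -> simple (zpoly o p).
Proof.
move=> /and3P[p2 /allP nondeg H]; have p0 : (0 < size p)%N by exact: leq_trans p2.
split; first by rewrite size_map.
rewrite size_map.
suff K i j t u : (i <= j)%N -> (j < size p)%N -> 0 <= t < 1 -> 0 <= u < 1 ->
    lerp (zpoly o p)`_i (zpoly o p)`_(i.+1 %% size p) t =
    lerp (zpoly o p)`_j (zpoly o p)`_(j.+1 %% size p) u -> i = j /\ t = u.
  move=> i j t u ip jp t01 u01 E; have [ij|/ltnW ji] := leqP i j; first exact: K E.
  by have [-> ->] := K j i u t ji ip u01 t01 (esym E).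
have chk k l : (k < l < size p)%N ->
    if l == k.+1 then meets_only (nth z0 p l) [:: nth z0 p k] (znext p l)
    else if (k == 0%N) && (l.+1 == size p) then
      meets_only (nth z0 p 0) [:: nth z0 p 1] (nth z0 p l)
    else apart [:: nth z0 p k; znext p k] [:: nth z0 p l; znext p l].
  move=> /andP[kl lp]; move/allP: H => /(_ l); rewrite mem_iota add0n lp => /(_ isT).
  by move=> /allP /(_ k); rewrite mem_iota add0n kl => /(_ isT).
move=> ij jp t01 u01; have ip : (i < size p)%N by exact: leq_ltn_trans ij jp.
rewrite !nth_zpoly// ?ltn_mod// -!/(znext _ _) => E.
have t01' : 0 <= t <= 1 by move: t01 => /andP[-> /ltW ->].
have u01' : 0 <= u <= 1 by move: u01 => /andP[-> /ltW ->].
have inI : in_hull o [:: nth z0 p i; znext p i] (lerp (pt o (nth z0 p i)) (pt o (znext p i)) t).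
  exact: in_hull_lerp.
have inJ : in_hull o [:: nth z0 p j; znext p j] (lerp (pt o (nth z0 p j)) (pt o (znext p j)) u).
  exact: in_hull_lerp.
have ne k : (k < size p)%N -> pt o (nth z0 p k) != pt o (znext p k).
  by move=> kp; rewrite (inj_eq (@pt_inj o)) nondeg// mem_iota.
move: ij; rewrite leq_eqVlt => /orP[/eqP ij|ij].
  split => //; move: E; rewrite -ij => E.
  have /eqP : (t - u) *: (pt o (znext p i) - pt o (nth z0 p i)) = 0.
    have -> : (t - u) *: (pt o (znext p i) - pt o (nth z0 p i)) =
      lerp (pt o (nth z0 p i)) (pt o (znext p i)) t -
      lerp (pt o (nth z0 p i)) (pt o (znext p i)) u.
      by apply/rowP => k; rewrite !mxE; ring.
    by rewrite E subrr.
  rewrite scaler_eq0 !subr_eq0 => /orP[/eqP//|/eqP F].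
  by have := ne i ip; rewrite F eqxx.
exfalso; have /chk : (i < j < size p)%N by rewrite ij.
case: ifP => [/eqP ji|_].
  have zj : znext p i = nth z0 p j by rewrite /znext -ji modn_small.
  (* The common point is the shared vertex, which on edge i has the excluded parameter 1. *)
  move=> h; have u0 : u = 0.
    apply: (meets_onlyP (o := o) h); first by case/andP: u01.
    by rewrite -E; apply: in_hull_sub inI => a; rewrite zj !inE orbC.
  move: E; rewrite u0 lerp0 -zj => E.
  have /eqP : (1 - t) *: (pt o (nth z0 p i) - pt o (znext p i)) = 0.
    have -> : (1 - t) *: (pt o (nth z0 p i) - pt o (znext p i)) =
      lerp (pt o (nth z0 p i)) (pt o (znext p i)) t - pt o (znext p i).
      by apply/rowP => k; rewrite !mxE; ring.
    by rewrite E subrr.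
  rewrite scaler_eq0 !subr_eq0 => /orP[/eqP t1|/eqP F].
    by move: t01; rewrite -t1 ltxx andbF.
  by have := ne i ip; rewrite F eqxx.
case: ifP => [/andP[/eqP i0 /eqP jn]|_]; last first.
  by move=> h; apply: (apartP h inI); rewrite E.
have zj : znext p j = nth z0 p 0 by rewrite /znext jn modnn.
have zi : znext p i = nth z0 p 1 by rewrite /znext i0 modn_small// (ltnW p2).
move=> h; have : 1 - u = 0.
  apply: (meets_onlyP (o := o) h); first by case/andP: u01 => _ /ltW; rewrite subr_ge0.
  by rewrite -lerpC -zj -E zj zi i0; move: inI; rewrite zi i0.
by case/andP: u01; lra.
Qed.

Lemma in_trace o p x : (0 < size p)%N -> trace (zpoly o p) x ->
  exists2 i, (i < size p)%N & in_hull o [:: nth z0 p i; znext p i] x.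
Proof.
move=> p0 [i [t [ip t01 ->]]]; rewrite size_map in ip *; exists i => //.
by rewrite nth_zpoly// nth_znext//; exact: in_hull_lerp.
Qed.

Lemma zmissesP o A p x : zmisses A p -> in_hull o A x -> ~ trace (zpoly o p) x.
Proof.
move=> H hA tx; have p0 : (0 < size p)%N.
  by move: tx => [i [t [ip _ _]]]; rewrite size_map in ip; exact: leq_ltn_trans ip.
have [i ip hi] := in_trace p0 tx.
move/allP : H => /(_ i); rewrite mem_iota => /(_ ip) h.
exact: (apartP h hA hi).
Qed.

Lemma zdisjointP o p q : zdisjoint p q -> trace (zpoly o p) `&` trace (zpoly o q) = set0.
Proof.
move=> H; apply/seteqP; split=> // x [tp tq].
have p0 : (0 < size p)%N.
  by move: tp => [i [t [ip _ _]]]; rewrite size_map in ip; exact: leq_ltn_trans ip.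
have [i ip hi] := in_trace p0 tp.
move/allP : H => /(_ i); rewrite mem_iota => /(_ ip) h.
exact: (zmissesP h hi).
Qed.

End Realization.

(** * Pictures placed beside a distant context *)

Section LocalPictures.
Variable R : realType.
Implicit Types (o v x : 'rV[R]_3) (N a b c : zpoint) (A B p P : seq zpoint) (q : seq 'rV[R]_3).
Implicit Types (s t : R) (K : Z) (X Y : seq (seq zpoint)) (S : seq (seq 'rV[R]_3)).

Definition good S := (forall q, q \in S -> simple q) /\ disjoint_traces S.

(** Each polygon of the context lies entirely on one side of the slab, so its edges avoid the hull
    of any points of the picture, in particular every triangle of a move. *)
Definition away o K S := forall q, q \in S -> (0 < size q)%N /\
  ((forall v, v \in q -> o 0 ord0 + zr R K <= v 0 ord0) \/
   (forall v, v \in q -> v 0 ord0 <= o 0 ord0 - zr R K)).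

Definition place o X : seq (seq 'rV[R]_3) := map (zpoly o) X.

Let ex : zpoint := (Zpos xH, Z0, Z0).

Let lin_ex v : lin ex v = v 0 ord0.
Proof.
rewrite /lin /ex /= (_ : zr R (Zpos xH) = 1)// (_ : zr R Z0 = 0)//.
by rewrite mul1r !mul0r !addr0.
Qed.

Lemma in_hull_box o K A x : all (in_slab K) A -> in_hull o A x ->
  o 0 ord0 - zr R K < x 0 ord0 < o 0 ord0 + zr R K.
Proof.
move=> /allP KA hA; apply/andP; split.
  rewrite -ltrN2 -[x 0 ord0]lin_ex -lin_opp; apply: hA => a /KA /andP[/(zr_lt R) h _].
  by rewrite lin_opp ltrN2 lin_ex /pt !mxE /=; rewrite zrN in h; lra.
rewrite -[x 0 ord0]lin_ex; apply: hA => a /KA /andP[_ /(zr_lt R) h].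
by rewrite lin_ex /pt !mxE /=; lra.
Qed.

Lemma away_misses o K A S q i t : all (in_slab K) A -> away o K S -> q \in S ->
  (i < size q)%N -> 0 <= t <= 1 ->
  ~ in_hull o A (lerp q`_i q`_(i.+1 %% size q) t).
Proof.
move=> KA aS qS iq t01 /(in_hull_box KA) /andP[h1 h2].
have [q0 h] := aS q qS.
have m1 : q`_i \in q by exact: mem_nth.
have m2 : q`_(i.+1 %% size q) \in q by rewrite mem_nth// ltn_mod.
move: h1 h2; rewrite /lerp !mxE; case: h => h; have := h _ m1; have := h _ m2.
  by move=> k1 k2 _; apply/negP; rewrite -leNgt; nra.
by move=> k1 k2 + _; apply/negP; rewrite -leNgt; nra.
Qed.

Lemma away_trace o K A S q x : all (in_slab K) A -> away o K S -> q \in S ->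
  trace q x -> ~ in_hull o A x.
Proof. by move=> KA aS qS [i [t [iq t01 ->]]]; exact: (away_misses KA aS qS iq t01). Qed.

Lemma in_slab_edge K X p i : zbox K X -> p \in X -> (i < size p)%N ->
  all (in_slab K) [:: nth z0 p i; znext p i].
Proof.
move=> /allP bX /bX /allP bp ip; rewrite /= andbT.
apply/andP; split; apply: bp; apply: mem_nth => //.
by rewrite ltn_mod; exact: leq_ltn_trans ip.
Qed.

Lemma good_place o K X S : zlink K X -> away o K S -> good S -> good (place o X ++ S).
Proof.
move=> /and4P[_ /allP sX dX bX] aS [sS dS]; split.
  by move=> p; rewrite mem_cat => /orP[/mapP[q /sX qX ->]|/sS//]; exact: zsimpleP.
elim: X sX dX bX => [//|p X IH] sX pw bX; move: pw => /= /andP[/allP pX dX]; split; last first.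
  apply: IH => //; first by move=> q qX; apply: sX; rewrite inE qX orbT.
  by case/andP: bX.
move=> q; rewrite mem_cat => /orP[/mapP[r /pX rX ->]|qS]; first exact: zdisjointP.
apply/seteqP; split=> // x [tp tq].
have p0 : (0 < size p)%N.
  by move: tp => [i [t [ip _ _]]]; rewrite size_map in ip; exact: leq_ltn_trans ip.
have [i ip hi] := in_trace p0 tp.
have KA := in_slab_edge bX (mem_head _ _) ip.
exact: (away_trace KA aS qS tq).
Qed.

Lemma link_place o K X S : zlink K X -> away o K S -> good S -> is_link (place o X ++ S).
Proof.
move=> zX aS gS; have [h1 h2] := good_place zX aS gS.
by apply: is_link_simple => //; case/and4P: zX; case: (X).
Qed.

(* Junk value 0 if S is not a link. *)
Definition value (F : link R -> CqE R) S : CqE R :=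
  if pselect (is_link S) is left h then F (Link h) else 0.

Lemma valueE (F : link R -> CqE R) (L : link R) : value F (comps L) = F L.
Proof.
rewrite /value; case: pselect => [h|]; last by case: L.
by case: L h => L h' h /=; congr (F (Link _)); exact: Prop_irrelevance.
Qed.

(** Origin and context are arbitrary, so that a deformation checked once can be used in every slot,
    whatever the other slots contain. *)
Definition same_value K X Y := forall F o S, isotopy_invariant F ->
  away o K S -> good S -> value F (place o X ++ S) = value F (place o Y ++ S).

Lemma same_value_isotopic K X Y : zlink K X -> zlink K Y ->
  (forall o S (L L' : link R), away o K S -> comps L = place o X ++ S ->
     comps L' = place o Y ++ S -> isotopic L L') -> same_value K X Y.
Proof.
move=> zX zY H F o S iF aS gS.
have lX := link_place zX aS gS; have lY := link_place zY aS gS.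
rewrite -[place o X ++ S]/(comps (Link lX)) -[place o Y ++ S]/(comps (Link lY)).
by rewrite !valueE; apply: iF; exact: (H o S (Link lX) (Link lY) aS erefl erefl).
Qed.

Lemma same_value_triangle K a b c P X :
  zlink K ((a :: b :: P) :: X) -> zlink K ((a :: c :: b :: P) :: X) ->
  ztriangle a b c P X ->
  same_value K ((a :: b :: P) :: X) ((a :: c :: b :: P) :: X).
Proof.
move=> zX zY /and5P[nz P0 mb ma /andP[/allP mP /allP mX]].
apply: same_value_isotopic => // o S L L' aS LE LE'.
pose n := zrow R (zcross (zsub b a) (zsub c a)).
have KT : all (in_slab K) [:: a; b; c].
  by case/and4P: zY => _ _ _ /andP[/= /and4P[h1 h2 h3 _] _]; apply/and4P.
have tri x : triangle (pt o a) (pt o b) (pt o c) x -> in_hull o [:: a; b; c] x.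
  exact: in_hull_triangle.
apply: (isotopic_triangle (n := n) _ LE LE').
- rewrite unitmxE det3 unitfE; apply: contra_neq (zr_eq0 R nz) => E.
  by rewrite -[RHS]E /n /zdot /zcross /zsub /pt !mxE /= !(zrD, zrM, zrB); ring.
- move=> i; rewrite -[pt o a :: pt o b :: _]/(zpoly o (a :: b :: P)) size_map => /andP[i0 iP].
  have P1 : (0 < size P)%N by case: (P) P0.
  rewrite nth_zpoly// nth_znext//; move: i0 iP; case: i => [//|[|i]] _ /= iP.
    right; left; split.
      by [].
    move=> t /andP[t0 t1] /tri h.
    have En : znext (a :: b :: P) 1 = nth z0 P 0 by rewrite /znext modn_small//=; lia.
    rewrite En in h.
    have : in_hull o (b :: [:: a; c]) (lerp (pt o b) (pt o (nth z0 P 0)) t).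
      apply: in_hull_sub h => d; rewrite !inE; by case: (d == a); case: (d == b).
    by move=> /(meets_onlyP mb (ltW t0)) E; rewrite E ltxx in t0.
  have [E|E] := eqVneq i (size P).-1.
    have En : znext (a :: b :: P) i.+2 = a.
      by rewrite /znext (_ : i.+3 = size (a :: b :: P)) ?modnn//= E; lia.
    right; right; split; first by rewrite En.
    move=> t /andP[t0 t1] /tri h.
    rewrite En lerpC E in h.
    have t1' : 0 <= 1 - t by lra.
    have := meets_onlyP (o := o) ma t1'.
    have h' : in_hull o (a :: [:: b; c]) (lerp (pt o a) (pt o (nth z0 P (size P).-1)) (1 - t)).
      exact: h.
    by move=> /(_ h'); lra.
  left=> t t01 /tri h.
  have En : znext (a :: b :: P) i.+2 = nth z0 P i.+1 by rewrite /znext modn_small//=; lia.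
  rewrite En in h; have := mP i; rewrite mem_iota add0n.
  have -> : (i < (size P).-1)%N by lia.
  by move=> /(_ isT) /(apartP (o := o)); apply; [exact: h|exact: in_hull_lerp].
- move=> q; rewrite mem_cat => /orP[/mapP[p pX ->]|/aS[]//].
  rewrite size_map; case/and4P: zX => _ /allP /(_ p); rewrite inE pX orbT => /(_ isT).
  by case/and3P => p2 _ _ _ _; lia.
move=> q i; rewrite mem_cat => /orP[/mapP[p pX ->]|qS] iq t t01 /tri h.
  apply: (zmissesP (mX p pX) h); exists i, t; split => //.
exact: (away_misses KT aS qS iq t01 h).
Qed.

Lemma same_value_turn K X Y i k : zlink K X -> zlink K Y -> (i < size X)%N ->
  (k <= size (nth [::] X i))%N ->
  Y = rot k (nth [::] X i) :: take i X ++ drop i.+1 X -> same_value K X Y.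
Proof.
move=> zX zY iX kX YE; apply: same_value_isotopic => // o S L L' aS LE LE'.
set p := nth [::] X i in kX YE.
have XE : X = take i X ++ p :: drop i.+1 X by rewrite -{1}(cat_take_drop i X) (drop_nth [::]).
apply: (@isotopic_rot R L L' k (zpoly o p) (place o (take i X)) (place o (drop i.+1 X) ++ S)).
- rewrite size_map; case/and4P: zX => _ /allP /(_ p); rewrite mem_nth// => /(_ isT).
  by case/and3P => p2 _ _ _ _; lia.
- by rewrite size_map.
- by rewrite LE {1}XE /place map_cat -catA.
- rewrite LE' YE /place /= map_cat /zpoly map_rot -catA.
  by rewrite -cat1s perm_catCA.
Qed.

End LocalPictures.

(** * Sequences of triangle moves as certificates *)

(** [Turn i k] brings component i to the front, started at its vertex k; [Ins] and [Del] then act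
    only on the beginning of the first polygon, where they add or remove the second vertex. *)
Inductive move := Turn of nat & nat | Ins of zpoint | Del.

Definition apply_move (m : move) (X : seq (seq zpoint)) : seq (seq zpoint) :=
  match m, X with
  | Turn i k, _ => rot k (nth [::] X i) :: take i X ++ drop i.+1 X
  | Ins c, (a :: b :: P) :: X' => (a :: c :: b :: P) :: X'
  | Del, (a :: c :: b :: P) :: X' => (a :: b :: P) :: X'
  | _, _ => [::]
  end.

Definition move_ok (m : move) (X : seq (seq zpoint)) : bool :=
  match m, X with
  | Turn i k, _ => (i < size X)%N && (k <= size (nth [::] X i))%N
  | Ins c, (a :: b :: P) :: X' => ztriangle a b c P X'
  | Del, (a :: c :: b :: P) :: X' => ztriangle a b c P X'
  | _, _ => false
  end.

Fixpoint deforms (K : Z) (X : seq (seq zpoint)) (ms : seq move) (Y : seq (seq zpoint)) : bool :=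
  zlink K X && if ms is m :: ms' then move_ok m X && deforms K (apply_move m X) ms' Y
               else X == Y.

Lemma deforms_zlink K X ms Y : deforms K X ms Y -> zlink K X.
Proof. by case: ms => [|m ms] /andP[]. Qed.

Lemma deformsP (R : realType) K X ms Y : deforms K X ms Y -> same_value R K X Y.
Proof.
elim: ms X => [|m ms IH] X /= /andP[zX]; first by move=> /eqP -> F o S.
move=> /andP[ok h]; have zY := deforms_zlink h; have {IH}h := IH _ h.
suff H : same_value R K X (apply_move m X).
  by move=> F o S iF aS gS; rewrite H//; exact: h.
case: m ok zY {h} => [i k|c|]; rewrite /apply_move /move_ok.
- by move=> /andP[iX kX] zY; exact: (same_value_turn zX zY iX kX).
- move: zX; case: X => [//|[|a [|b P]] X] // zX ok zY.
  exact: same_value_triangle.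
(* A deletion is an insertion read backwards. *)
- move: zX; case: X => [//|[|a [|c [|b P]]] X] // zX ok zY F o S iF aS gS.
  by apply/esym; apply: (same_value_triangle (K := K)).
Qed.

(** * Conway triples of integral pictures *)

Definition zadd (a b : zpoint) : zpoint :=
  (Z.add a.1.1 b.1.1, Z.add a.1.2 b.1.2, Z.add a.2 b.2).

Record zframe := ZFrame { zc : zpoint; zu : zpoint; zv : zpoint; zw : zpoint }.

Definition zSW f := zsub (zsub (zc f) (zu f)) (zv f).
Definition zSE f := zsub (zadd (zc f) (zu f)) (zv f).
Definition zNE f := zadd (zadd (zc f) (zu f)) (zv f).
Definition zNW f := zadd (zsub (zc f) (zu f)) (zv f).
Definition ztop f := zadd (zc f) (zw f).
Definition zbot f := zsub (zc f) (zw f).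
Definition zbipyramid f := [:: zSW f; zSE f; zNE f; zNW f; ztop f; zbot f].

(* The broken line a, P, b meets the hull of A only at a and b. *)
Definition leaves_hull (A : seq zpoint) (a : zpoint) (P : seq zpoint) (b : zpoint) : bool :=
  [&& ~~ nilp P, meets_only a A (nth z0 P 0), meets_only b A (last z0 P)
    & all (fun i => apart A [:: nth z0 P i; nth z0 P i.+1]) (iota 0 (size P).-1)].

Definition frame_ok (K : Z) f : bool :=
  Z.ltb Z0 (zdot (zu f) (zcross (zv f) (zw f))) &&
  all (in_slab K) (zbipyramid f).

Definition mixed_p f P Q := [:: [:: zSW f, ztop f, zNE f & P]; [:: zSE f, zNW f & Q]].
Definition mixed_m f P Q := [:: [:: zSW f, zbot f, zNE f & P]; [:: zSE f, zNW f & Q]].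
Definition mixed_0 f P Q := [:: [:: zSW f, zNW f & Q ++ [:: zSE f, zNE f & P]]].
Definition self_p f P Q := [:: [:: zSW f, ztop f, zNE f & P ++ [:: zSE f, zNW f & Q]]].
Definition self_m f P Q := [:: [:: zSW f, zbot f, zNE f & P ++ [:: zSE f, zNW f & Q]]].
Definition self_0 f P Q := [:: [:: zSW f, zNW f & Q]; [:: zSE f, zNE f & P]].

Definition mixed_ok K f P Q : bool :=
  [&& frame_ok K f, leaves_hull (zbipyramid f) (zNE f) P (zSW f)
    & leaves_hull (zbipyramid f) (zNW f) Q (zSE f)].

Definition self_ok K f P Q : bool :=
  [&& frame_ok K f, leaves_hull (zbipyramid f) (zNE f) P (zSE f)
    & leaves_hull (zbipyramid f) (zNW f) Q (zSW f)].

Section Chains.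
Variable R : realType.
Implicit Types (a b c x : 'rV[R]_3) (l p : seq 'rV[R]_3).

(** An open broken line. Cutting a closed polygon into such lines separates the part inside the
    bipyramid from the arcs P and Q outside. *)
Fixpoint chain a l b : set 'rV[R]_3 :=
  if l is c :: l' then segment a c `|` chain c l' b else segment a b.

Lemma segmentP a b x : segment a b x <-> exists2 t, 0 <= t <= 1 & x = lerp a b t.
Proof.
split; first by move=> [t /=]; rewrite in_itv /= => t01 <-; exists t.
by move=> [t t01 ->]; exists t => //=; rewrite in_itv.
Qed.

Lemma segmentL a b : segment a b a.
Proof. by apply/segmentP; exists 0; rewrite ?lerp0 ?lexx ?ler01. Qed.

Lemma segmentR a b : segment a b b.
Proof. by apply/segmentP; exists 1; rewrite ?lerp1 ?lexx ?ler01. Qed.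

Lemma chainP a l b x : chain a l b x <-> exists i t,
  [/\ (i <= size l)%N, 0 <= t <= 1 & x = lerp (a :: l)`_i (rcons l b)`_i t].
Proof.
elim: l a => [|c l IH] a /=.
  rewrite segmentP; split; first by move=> [t t01 ->]; exists 0%N, t.
  by move=> [[|i] [t [// _ t01 ->]]]; exists t.
split.
  move=> [/segmentP[t t01 ->]|/IH[i [t [il t01 ->]]]]; first by exists 0%N, t.
  by exists i.+1, t.
move=> [[|i] [t [il t01 xE]]]; first by left; apply/segmentP; exists t.
by right; apply/IH; exists i, t.
Qed.

Lemma trace_chain a l : trace (a :: l) = chain a l a.
Proof.
have E i : (i <= size l)%N -> (a :: l)`_(i.+1 %% size (a :: l)) = (rcons l a)`_i.
  rewrite leq_eqVlt => /orP[/eqP ->|il]; first by rewrite modnn nth_rcons ltnn eqxx.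
  by rewrite modn_small//= nth_rcons il.
apply/seteqP; split=> x.
  by move=> [i [t [il t01 ->]]]; apply/chainP; exists i, t; rewrite E.
by move=> /chainP[i [t [il t01 ->]]]; exists i, t; rewrite E.
Qed.

Lemma chain_cat a l1 c l2 b : chain a (l1 ++ c :: l2) b = chain a l1 c `|` chain c l2 b.
Proof. by elim: l1 a => [//|d l1 IH] a /=; rewrite IH setUA. Qed.

Lemma supportP (L : link R) x : (forall q, q \in comps L -> (0 < size q)%N) ->
  Defs.support L x <-> exists2 q, q \in comps L & trace q x.
Proof.
move=> L0; split.
  move=> [i /= iL h]; have qL := mem_nth [::] iL.
  by exists (nth [::] L i) => //; rewrite -range_loop// L0.
move=> [q qL tq]; exists (index q L); first by rewrite /= index_mem.
by rewrite nth_index// range_loop// L0.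
Qed.

End Chains.

Section ConwayTriples.
Variable R : realType.
Variable o : 'rV[R]_3.
Variable f : zframe.
Hypothesis f_pos : Z.ltb Z0 (zdot (zu f) (zcross (zv f) (zw f))).

Lemma zframe_pos :
  0 < \det (\matrix_(i < 3) [:: zrow R (zu f); zrow R (zv f); zrow R (zw f)]`_i).
Proof.
rewrite det3; have := zr_lt R f_pos; rewrite (_ : zr R Z0 = 0)//.
by rewrite /zdot /zcross !mxE /= !(zrD, zrB, zrM) addrA.
Qed.

Definition fr : frame R := @Frame R (pt o (zc f)) _ _ _ zframe_pos.

Lemma pt_SW : pt o (zSW f) = SW fr.
Proof.
by apply/rowP => -[[|[|[|i]]] iP] //; rewrite /SW /at_frame /pt !mxE /= !(zrD, zrB); ring.
Qed.

Lemma pt_SE : pt o (zSE f) = SE fr.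
Proof.
by apply/rowP => -[[|[|[|i]]] iP] //; rewrite /SE /at_frame /pt !mxE /= !(zrD, zrB); ring.
Qed.

Lemma pt_NE : pt o (zNE f) = NE fr.
Proof.
by apply/rowP => -[[|[|[|i]]] iP] //; rewrite /NE /at_frame /pt !mxE /= !(zrD, zrB); ring.
Qed.

Lemma pt_NW : pt o (zNW f) = NW fr.
Proof.
by apply/rowP => -[[|[|[|i]]] iP] //; rewrite /NW /at_frame /pt !mxE /= !(zrD, zrB); ring.
Qed.

Lemma pt_top : pt o (ztop f) = Defs.top fr.
Proof.
by apply/rowP => -[[|[|[|i]]] iP] //; rewrite /Defs.top /at_frame /pt !mxE /= !(zrD, zrB); ring.
Qed.

Lemma pt_bot : pt o (zbot f) = Defs.bot fr.
Proof.
by apply/rowP => -[[|[|[|i]]] iP] //; rewrite /Defs.bot /at_frame /pt !mxE /= !(zrD, zrB); ring.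
Qed.

Lemma lin_at_frame N x y z : lin N (at_frame fr x y z) =
  lin N (orig fr) + x * lin N (ux fr) + y * lin N (uy fr) + z * lin N (uz fr).
Proof. by rewrite /at_frame !(linD, linZ). Qed.

(** A linear form with coefficients A, B, C in the frame is at most (1 - |c|) (|A| + |B|) + |c| |C|
    on the bipyramid, hence at most the larger of |A| + |B| and |C|; these are its maxima over the
    four corners and the two apexes. *)
Lemma bipyramid_in_hull x : bipyramid fr x -> in_hull o (zbipyramid f) x.
Proof.
move=> [a [b [c [-> h1 h2]]]] N r H.
have K (p : zpoint) : p \in zbipyramid f -> lin N (pt o p) < r by exact: H.
have := K (zSW f); have := K (zSE f); have := K (zNE f); have := K (zNW f).
have := K (ztop f); have := K (zbot f); rewrite !inE !eqxx !orbT.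
rewrite pt_SW pt_SE pt_NE pt_NW pt_top pt_bot /SW /SE /NE /NW /Defs.top /Defs.bot !lin_at_frame.
move: (lin N (orig fr)) (lin N (ux fr)) (lin N (uy fr)) (lin N (uz fr)) => O A B C.
move=> /(_ isT) k1 /(_ isT) k2 /(_ isT) k3 /(_ isT) k4 /(_ isT) k5 /(_ isT) k6.
pose m := Num.max (`|A| + `|B|) `|C|.
have mr : O + m < r.
  rewrite -ltrBrDl /m gt_max; apply/andP; split.
    by have [a0|a0] := ger0P A; have [b0|b0] := ger0P B; lra.
  by have [c0|c0] := ger0P C; lra.
have c1 : 0 <= `|c| by [].
have c2 : `|c| <= 1 by have := normr_ge0 a; lra.
have e1 : a * A <= (1 - `|c|) * `|A|.
  apply: le_trans (ler_norm _) _; rewrite normrM ler_wpM2r//; lra.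
have e2 : b * B <= (1 - `|c|) * `|B|.
  apply: le_trans (ler_norm _) _; rewrite normrM ler_wpM2r//; lra.
have e3 : c * C <= `|c| * m.
  by apply: le_trans (ler_norm _) _; rewrite normrM ler_wpM2l// le_max lexx orbT.
have e4 : (1 - `|c|) * (`|A| + `|B|) <= (1 - `|c|) * m.
  by rewrite ler_wpM2l ?subr_ge0// le_max lexx.
by lra.
Qed.

Lemma segment_bipyramid x1 y1 z1 x2 y2 z2 x :
  `|x1| + `|z1| <= 1 -> `|y1| + `|z1| <= 1 -> `|x2| + `|z2| <= 1 -> `|y2| + `|z2| <= 1 ->
  segment (at_frame fr x1 y1 z1) (at_frame fr x2 y2 z2) x -> bipyramid fr x.
Proof.
move=> h1 h2 h3 h4 /segmentP[t /andP[t0 t1] ->].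
exists ((1 - t) * x1 + t * x2), ((1 - t) * y1 + t * y2), ((1 - t) * z1 + t * z2); split.
- by apply/rowP => i; rewrite /lerp /at_frame !mxE; ring.
- have := ler_normD ((1 - t) * x1) (t * x2); have := ler_normD ((1 - t) * z1) (t * z2).
  rewrite !normrM (ger0_norm t0) (ger0_norm (_ : 0 <= 1 - t)) ?subr_ge0//.
  by move=> *; nra.
- have := ler_normD ((1 - t) * y1) (t * y2); have := ler_normD ((1 - t) * z1) (t * z2).
  rewrite !normrM (ger0_norm t0) (ger0_norm (_ : 0 <= 1 - t)) ?subr_ge0//.
  by move=> *; nra.
Qed.

Lemma leaves_hullP a P b x : leaves_hull (zbipyramid f) a P b ->
  a \in zbipyramid f -> b \in zbipyramid f ->
  chain (pt o a) (zpoly o P) (pt o b) x -> bipyramid fr x -> x = pt o a \/ x = pt o b.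
Proof.
move=> /and4P[P0 ma mb /allP mP] aB bB /chainP[i [t [iP t01 ->]]] /bipyramid_in_hull h.
have {P0}P0 : (0 < size P)%N by case: (P) P0.
rewrite size_map in iP; move: iP h; rewrite leq_eqVlt => /orP[/eqP ->|].
  have -> : (pt o a :: zpoly o P)`_(size P) = pt o (last z0 P).
    by rewrite -(prednK P0) /= nth_zpoly ?prednK// nth_last.
  have -> : (rcons (zpoly o P) (pt o b))`_(size P) = pt o b.
    by rewrite nth_rcons size_map ltnn eqxx.
  rewrite lerpC => h; right.
  have t1 : 0 <= 1 - t by lra.
  have := meets_onlyP (o := o) mb t1; rewrite -lerpC.
  have h' : in_hull o (b :: zbipyramid f) (lerp (pt o (last z0 P)) (pt o b) t).
    rewrite lerpC; apply: in_hull_sub h => p pB; by rewrite inE pB orbT.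
  by move=> /(_ h') E; rewrite (_ : t = 1) ?lerp1//; lra.
move=> iP; rewrite nth_rcons size_map iP nth_zpoly//.
case: i iP => [|i] iP /=.
  move=> h; left; have t0 : 0 <= t by lra.
  have h' : in_hull o (a :: zbipyramid f) (lerp (pt o a) (pt o (nth z0 P 0)) t).
    by apply: in_hull_sub h => p pB; rewrite inE pB orbT.
  by rewrite (meets_onlyP ma t0 h') lerp0.
rewrite nth_zpoly; last by lia.
move=> h; exfalso; have := mP i; rewrite mem_iota add0n.
have -> : (i < (size P).-1)%N by lia.
by move=> /(_ isT) /(apartP (o := o)); apply; [exact: h|exact: in_hull_lerp].
Qed.

End ConwayTriples.

(** * Skein relations beside a context *)

Section PlacedConwayTriples.
Variable R : realType.
Implicit Types (o x : 'rV[R]_3) (S : seq (seq 'rV[R]_3)) (P Q : seq zpoint) (f : zframe).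

Fixpoint traces S : set 'rV[R]_3 := if S is q :: S' then trace q `|` traces S' else set0.

Lemma traces_cat S1 S2 : traces (S1 ++ S2) = traces S1 `|` traces S2.
Proof. by elim: S1 => [|q S1 IH] /=; rewrite ?set0U// IH setUA. Qed.

Lemma tracesP S x : traces S x <-> exists2 q, q \in S & trace q x.
Proof.
elim: S => [|q S IH] /=; first by split => // -[].
split.
  move=> [h|/IH[p pS h]]; first by exists q => //; exact: mem_head.
  by exists p => //; rewrite inE pS orbT.
move=> [p]; rewrite inE => /orP[/eqP -> h|pS h]; first by left.
by right; apply/IH; exists p.
Qed.

Lemma support_traces (L : link R) S : good S -> comps L = S -> Defs.support L = traces S.
Proof.
move=> [gS _] LE; have S0 q : q \in comps L -> (0 < size q)%N by rewrite LE => /gS[].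
apply/seteqP; split=> x; first by move=> /(supportP _ S0); rewrite LE => /tracesP.
by move=> /tracesP h; apply/(supportP _ S0); rewrite LE.
Qed.

Section Picture.
Variables (o : 'rV[R]_3) (K : Z) (f : zframe) (S : seq (seq 'rV[R]_3)).
Hypothesis f_ok : frame_ok K f.
Hypothesis aS : away o K S.

Let fp := proj1 (andP f_ok).
Let F := fr o fp.

Lemma context_bipyramid x : traces S x -> ~ bipyramid F x.
Proof.
move=> /tracesP[q qS h] /bipyramid_in_hull.
exact: (away_trace (proj2 (andP f_ok)) aS qS h).
Qed.

Let seg_bip (x1 y1 z1 x2 y2 z2 : R) := @segment_bipyramid R o f fp x1 y1 z1 x2 y2 z2.

Ltac seg_in := rewrite /SW /SE /NE /NW /Defs.top /Defs.bot; apply: seg_bip;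
  rewrite ?normrN ?normr1 ?normr0 ?addr0 ?add0r //.

Lemma seg_SW_top x : segment (SW F) (Defs.top F) x -> bipyramid F x. Proof. by seg_in. Qed.
Lemma seg_top_NE x : segment (Defs.top F) (NE F) x -> bipyramid F x. Proof. by seg_in. Qed.
Lemma seg_SW_bot x : segment (SW F) (Defs.bot F) x -> bipyramid F x. Proof. by seg_in. Qed.
Lemma seg_bot_NE x : segment (Defs.bot F) (NE F) x -> bipyramid F x. Proof. by seg_in. Qed.
Lemma seg_SE_NW x : segment (SE F) (NW F) x -> bipyramid F x. Proof. by seg_in. Qed.
Lemma seg_SW_NW x : segment (SW F) (NW F) x -> bipyramid F x. Proof. by seg_in. Qed.
Lemma seg_SE_NE x : segment (SE F) (NE F) x -> bipyramid F x. Proof. by seg_in. Qed.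

Let corners := (@pt_SW R o f fp, @pt_SE R o f fp, @pt_NE R o f fp, @pt_NW R o f fp,
  @pt_top R o f fp, @pt_bot R o f fp).

Variables P Q : seq zpoint.

Section Mixed.
Hypothesis h1 : leaves_hull (zbipyramid f) (zNE f) P (zSW f).
Hypothesis h2 : leaves_hull (zbipyramid f) (zNW f) Q (zSE f).

Let c1 x : chain (NE F) (zpoly o P) (SW F) x -> bipyramid F x -> x = NE F \/ x = SW F.
Proof.
rewrite -!corners; apply: (leaves_hullP h1); by rewrite !inE eqxx ?orbT.
Qed.

Let c2 x : chain (NW F) (zpoly o Q) (SE F) x -> bipyramid F x -> x = NW F \/ x = SE F.
Proof.
rewrite -!corners; apply: (leaves_hullP h2); by rewrite !inE eqxx ?orbT.
Qed.

Lemma mixed_picture (Lp Lm L0 : link R) :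
  good (place o (mixed_p f P Q) ++ S) -> good (place o (mixed_m f P Q) ++ S) ->
  good (place o (mixed_0 f P Q) ++ S) ->
  comps Lp = place o (mixed_p f P Q) ++ S -> comps Lm = place o (mixed_m f P Q) ++ S ->
  comps L0 = place o (mixed_0 f P Q) ++ S -> conway_triple_mixed Lp Lm L0.
Proof.
move=> gp gm g0 Ep Em E0.
exists F, (zpoly o P), (zpoly o Q), S; split.
- by rewrite Ep /= !corners.
- by rewrite Em /= !corners.
- by rewrite E0 /= /zpoly map_cat /= !corners.
split.
- rewrite (support_traces gp Ep) traces_cat /= !trace_chain /= !corners.
  apply/seteqP; split=> x; rewrite /setU /setI /mkset /=.
    have := @c1 x; have := @c2 x; have := @context_bipyramid x => k1 k2 k3 [h hb].
    (* The arcs P and Q meet the bipyramid only in their ends, and each of the four ends lies on a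
       segment of the picture; what remains is propositional. *)
    have := fun E : x = _ => eq_ind_r (segment (Defs.top F) (NE F)) (segmentR _ _) E.
    have := fun E : x = _ => eq_ind_r (segment (SW F) (Defs.top F)) (segmentL _ _) E.
    have := fun E : x = _ => eq_ind_r (segment (SE F) (NW F)) (segmentR _ _) E.
    have := fun E : x = _ => eq_ind_r (segment (SE F) (NW F)) (segmentL _ _) E.
    tauto.
  have := @seg_SW_top x; have := @seg_top_NE x; have := @seg_SE_NW x; tauto.
- rewrite (support_traces gm Em) traces_cat /= !trace_chain /= !corners.
  apply/seteqP; split=> x; rewrite /setU /setI /mkset /=.
    have := @c1 x; have := @c2 x; have := @context_bipyramid x => k1 k2 k3 [h hb].
    have := fun E : x = _ => eq_ind_r (segment (Defs.bot F) (NE F)) (segmentR _ _) E.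
    have := fun E : x = _ => eq_ind_r (segment (SW F) (Defs.bot F)) (segmentL _ _) E.
    have := fun E : x = _ => eq_ind_r (segment (SE F) (NW F)) (segmentR _ _) E.
    have := fun E : x = _ => eq_ind_r (segment (SE F) (NW F)) (segmentL _ _) E.
    tauto.
  have := @seg_SW_bot x; have := @seg_bot_NE x; have := @seg_SE_NW x; tauto.
rewrite (support_traces g0 E0) traces_cat /= trace_chain /= /zpoly map_cat /= chain_cat /= !corners.
apply/seteqP; split=> x; rewrite /setU /setI /mkset /=.
  have := @c1 x; have := @c2 x; have := @context_bipyramid x => k1 k2 k3 [h hb].
  have := fun E : x = _ => eq_ind_r (segment (SE F) (NE F)) (segmentR _ _) E.
  have := fun E : x = _ => eq_ind_r (segment (SW F) (NW F)) (segmentL _ _) E.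
  have := fun E : x = _ => eq_ind_r (segment (SW F) (NW F)) (segmentR _ _) E.
  have := fun E : x = _ => eq_ind_r (segment (SE F) (NE F)) (segmentL _ _) E.
  tauto.
have := @seg_SW_NW x; have := @seg_SE_NE x; tauto.
Qed.
End Mixed.

Section Self.
Hypothesis h1 : leaves_hull (zbipyramid f) (zNE f) P (zSE f).
Hypothesis h2 : leaves_hull (zbipyramid f) (zNW f) Q (zSW f).

Let c1 x : chain (NE F) (zpoly o P) (SE F) x -> bipyramid F x -> x = NE F \/ x = SE F.
Proof.
rewrite -!corners; apply: (leaves_hullP h1); by rewrite !inE eqxx ?orbT.
Qed.

Let c2 x : chain (NW F) (zpoly o Q) (SW F) x -> bipyramid F x -> x = NW F \/ x = SW F.
Proof.
rewrite -!corners; apply: (leaves_hullP h2); by rewrite !inE eqxx ?orbT.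
Qed.

Lemma self_picture (Lp Lm L0 : link R) :
  good (place o (self_p f P Q) ++ S) -> good (place o (self_m f P Q) ++ S) ->
  good (place o (self_0 f P Q) ++ S) ->
  comps Lp = place o (self_p f P Q) ++ S -> comps Lm = place o (self_m f P Q) ++ S ->
  comps L0 = place o (self_0 f P Q) ++ S -> conway_triple_self Lp Lm L0.
Proof.
move=> gp gm g0 Ep Em E0.
exists F, (zpoly o P), (zpoly o Q), S; split.
- by rewrite Ep /= /zpoly map_cat /= !corners.
- by rewrite Em /= /zpoly map_cat /= !corners.
- by rewrite E0 /= !corners.
split.
- rewrite (support_traces gp Ep) traces_cat /= !trace_chain /= /zpoly map_cat /=.
  rewrite chain_cat /= !corners.
  apply/seteqP; split=> x; rewrite /setU /setI /mkset /=.
    have := @c1 x; have := @c2 x; have := @context_bipyramid x => k1 k2 k3 [h hb].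
    have := fun E : x = _ => eq_ind_r (segment (Defs.top F) (NE F)) (segmentR _ _) E.
    have := fun E : x = _ => eq_ind_r (segment (SW F) (Defs.top F)) (segmentL _ _) E.
    have := fun E : x = _ => eq_ind_r (segment (SE F) (NW F)) (segmentR _ _) E.
    have := fun E : x = _ => eq_ind_r (segment (SE F) (NW F)) (segmentL _ _) E.
    tauto.
  have := @seg_SW_top x; have := @seg_top_NE x; have := @seg_SE_NW x; tauto.
- rewrite (support_traces gm Em) traces_cat /= !trace_chain /= /zpoly map_cat /=.
  rewrite chain_cat /= !corners.
  apply/seteqP; split=> x; rewrite /setU /setI /mkset /=.
    have := @c1 x; have := @c2 x; have := @context_bipyramid x => k1 k2 k3 [h hb].
    have := fun E : x = _ => eq_ind_r (segment (Defs.bot F) (NE F)) (segmentR _ _) E.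
    have := fun E : x = _ => eq_ind_r (segment (SW F) (Defs.bot F)) (segmentL _ _) E.
    have := fun E : x = _ => eq_ind_r (segment (SE F) (NW F)) (segmentR _ _) E.
    have := fun E : x = _ => eq_ind_r (segment (SE F) (NW F)) (segmentL _ _) E.
    tauto.
  have := @seg_SW_bot x; have := @seg_bot_NE x; have := @seg_SE_NW x; tauto.
rewrite (support_traces g0 E0) traces_cat /= !trace_chain /= !corners.
apply/seteqP; split=> x; rewrite /setU /setI /mkset /=.
  have := @c1 x; have := @c2 x; have := @context_bipyramid x => k1 k2 k3 [h hb].
  have := fun E : x = _ => eq_ind_r (segment (SE F) (NE F)) (segmentR _ _) E.
  have := fun E : x = _ => eq_ind_r (segment (SW F) (NW F)) (segmentL _ _) E.
  have := fun E : x = _ => eq_ind_r (segment (SW F) (NW F)) (segmentR _ _) E.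
  have := fun E : x = _ => eq_ind_r (segment (SE F) (NE F)) (segmentL _ _) E.
  tauto.
have := @seg_SW_NW x; have := @seg_SE_NE x; tauto.
Qed.
End Self.
End Picture.

Definition skein_eq (A B C : CqE R) : Prop :=
  q_ R ^- 2 * A - q_ R ^+ 2 * B = (q_ R - (q_ R)^-1) * C.

Definition mixed_skein (F : link R -> CqE R) := forall Lp Lm L0,
  conway_triple_mixed Lp Lm L0 -> skein F Lp Lm L0.

Definition self_skein (F : link R -> CqE R) := forall Lp Lm L0,
  conway_triple_self Lp Lm L0 -> skein F Lp Lm L0.

Lemma place_mixed_skein (F : link R -> CqE R) o K f P Q S : mixed_skein F ->
  mixed_ok K f P Q -> zlink K (mixed_p f P Q) -> zlink K (mixed_m f P Q) ->
  zlink K (mixed_0 f P Q) -> away o K S -> good S ->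
  skein_eq (value F (place o (mixed_p f P Q) ++ S)) (value F (place o (mixed_m f P Q) ++ S))
    (value F (place o (mixed_0 f P Q) ++ S)).
Proof.
move=> sF /and3P[fK h1 h2] zp zm z0' aS gS.
have := sF (Link (link_place zp aS gS)) (Link (link_place zm aS gS)) (Link (link_place z0' aS gS)).
rewrite /skein -!valueE; apply.
exact: (mixed_picture fK aS h1 h2 (good_place zp aS gS) (good_place zm aS gS)
  (good_place z0' aS gS)).
Qed.

Lemma place_self_skein (F : link R -> CqE R) o K f P Q S : self_skein F ->
  self_ok K f P Q -> zlink K (self_p f P Q) -> zlink K (self_m f P Q) ->
  zlink K (self_0 f P Q) -> away o K S -> good S ->
  skein_eq (value F (place o (self_p f P Q) ++ S)) (value F (place o (self_m f P Q) ++ S))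
    (value F (place o (self_0 f P Q) ++ S)).
Proof.
move=> sF /and3P[fK h1 h2] zp zm z0' aS gS.
have := sF (Link (link_place zp aS gS)) (Link (link_place zm aS gS)) (Link (link_place z0' aS gS)).
rewrite /skein -!valueE; apply.
exact: (self_picture fK aS h1 h2 (good_place zp aS gS) (good_place zm aS gS)
  (good_place z0' aS gS)).
Qed.

End PlacedConwayTriples.

(* The local pictures are closed two-strand twists, with crossings at the heights
   -3, -1, 1, 3 of the vertical axis; the left strand is closed on the left and
   the right strand on the right.  sigma_n is the closure of n negative crossings
   of parallel strands, clasp_k that of 2k positive crossings of antiparallel
   strands: clasp2 is sigma4 with one component reversed, clasp1 is sigma2 with
   one component reversed, and sigma3 is a trefoil.  The lists P and Q are those
   of the definition of a Conway triple at the lowest crossing. *)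
Definition upright (y : Z) := ZFrame (0, y, 0)%BZ (1, 0, 0)%BZ (0, 1, 0)%BZ (0, 0, 1)%BZ.
(** Both strands of a crossing run in the direction of the third vertex given here, that is, to the
    right: along the vertical axis of the twist one goes down and the other goes up. *)
Definition lying (y : Z) := ZFrame (0, y, 0)%BZ (0, -1, 0)%BZ (1, 0, 0)%BZ (0, 0, 1)%BZ.

Definition left_disc : seq zpoint := [:: (-1, 2, 0); (-1, 4, 0); (-5, 0, 0)]%BZ.
Definition right_disc : seq zpoint := [:: (1, 2, 0); (1, 4, 0); (5, 0, 0)]%BZ.

Definition disc := [:: left_disc].
Definition two_discs := [:: left_disc; right_disc].

Definition sigma4_P : seq zpoint :=
  [:: (-1, 0, 0); (0, 1, -1); (1, 2, 0); (-1, 4, 0); (-5, 0, 0)]%BZ.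
Definition sigma4_Q : seq zpoint :=
  [:: (0, -1, -1); (1, 0, 0); (-1, 2, 0); (0, 3, -1); (1, 4, 0); (5, 0, 0)]%BZ.
Definition sigma4 := mixed_m (upright (-3)) sigma4_P sigma4_Q.

Definition sigma3_P : seq zpoint :=
  [:: (-1, 2, 0); (0, 3, -1); (1, 4, 0); (5, 0, 0); (1, -4, 0)]%BZ.
Definition sigma3_Q : seq zpoint :=
  [:: (0, 1, -1); (1, 2, 0); (-1, 4, 0); (-5, 0, 0); (-1, -4, 0)]%BZ.
Definition sigma3 := self_m (upright (-1)) sigma3_P sigma3_Q.

Definition sigma2_P : seq zpoint :=
  [:: (-1, 4, 0); (-5, 0, 0); (-1, -4, 0); (-1, -2, 0)]%BZ.
Definition sigma2_Q : seq zpoint :=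
  [:: (0, 3, -1); (1, 4, 0); (5, 0, 0); (1, -4, 0); (1, -2, 0)]%BZ.
Definition sigma2 := mixed_m (upright (1)) sigma2_P sigma2_Q.

Definition sigma1_P : seq zpoint :=
  [:: (5, 0, 0); (1, -4, 0); (1, -2, 0); (1, 0, 0)]%BZ.
Definition sigma1_Q : seq zpoint :=
  [:: (-5, 0, 0); (-1, -4, 0); (-1, -2, 0); (-1, 0, 0)]%BZ.

Definition clasp2_P : seq zpoint :=
  [:: (5, 0, 0); (1, 4, 0); (-1, 2, 0); (0, 1, 1); (1, 0, 0)]%BZ.
Definition clasp2_Q : seq zpoint :=
  [:: (0, -1, 1); (-1, 0, 0); (1, 2, 0); (0, 3, 1); (-1, 4, 0); (-5, 0, 0)]%BZ.
Definition clasp2 := mixed_p (lying (-3)) clasp2_P clasp2_Q.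

Definition clasp1_P : seq zpoint :=
  [:: (1, -2, 0); (1, -4, 0); (5, 0, 0); (1, 4, 0)]%BZ.
Definition clasp1_Q : seq zpoint :=
  [:: (0, 3, 1); (-1, 4, 0); (-5, 0, 0); (-1, -4, 0); (-1, -2, 0)]%BZ.
Definition clasp1 := mixed_p (lying (1)) clasp1_P clasp1_Q.

(** * Deformations of the switched and smoothed twists *)

(** The switched crossing cancels against its neighbour, and two crossings remain. *)
Lemma sigma4_p_deforms : exists ms,
  deforms 10 (mixed_p (upright (-3)) sigma4_P sigma4_Q) ms
    sigma2.
Proof.
exists [:: Turn 1 5; Del; Turn 0 2; Del; Turn 1 0; Del; Turn 1 5; Del; Del; Del; Turn 1 0;
    Del; Del; Turn 0 4; Del; Turn 1 2; Ins (1, 4, 0)%BZ; Turn 1 0; Turn 1 2;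
    Ins (1, -4, 0)%BZ; Turn 1 0; Turn 1 1; Ins (1, -2, 0)%BZ; Turn 1 0; Turn 1 1;
    Ins (1, 0, 0)%BZ; Turn 0 1; Turn 1 0; Ins (-1, -4, 0)%BZ; Turn 1 0; Turn 1 1;
    Ins (-1, -2, 0)%BZ; Turn 1 0; Turn 1 1; Ins (-1, 0, 0)%BZ; Turn 1 0; Turn 1 1].
by vm_compute.
Qed.

Lemma sigma4_0_deforms : exists ms,
  deforms 10 (mixed_0 (upright (-3)) sigma4_P sigma4_Q) ms
    sigma3.
Proof.
exists [:: Turn 0 14; Del; Del; Turn 0 4; Del; Turn 0 1; Del; Ins (1, -4, 0)%BZ; Turn 0 11;
    Ins (1, 4, 0)%BZ; Turn 0 9; Ins (-1, -4, 0)%BZ; Turn 0 1; Ins (-1, -2, 0)%BZ;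
    Turn 0 1].
by vm_compute.
Qed.

(** Two of the three crossings cancel, and the last one is a kink. *)
Lemma sigma3_p_deforms : exists ms,
  deforms 10 (self_p (upright (-1)) sigma3_P sigma3_Q) ms
    disc.
Proof.
exists [:: Turn 0 14; Del; Turn 0 13; Del; Turn 0 12; Del; Turn 0 11; Del; Del; Turn 0 9; Del;
    Turn 0 8; Del; Turn 0 7; Del; Del; Turn 0 5; Del; Turn 0 4; Del; Turn 0 3; Del;
    Ins (-5, 0, 0)%BZ; Turn 0 3; Del; Ins (-1, 4, 0)%BZ; Turn 0 3; Del].
by vm_compute.
Qed.

Lemma sigma3_0_deforms : exists ms,
  deforms 10 (self_0 (upright (-1)) sigma3_P sigma3_Q) ms
    sigma2.
Proof.
exists [:: Del; Turn 0 5; Del; Turn 0 4; Del; Turn 1 0; Del; Turn 0 5; Del; Turn 0 4; Del;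
    Turn 0 2; Del; Ins (1, 4, 0)%BZ; Turn 1 0; Turn 1 2; Ins (1, -4, 0)%BZ; Turn 1 0;
    Turn 1 1; Ins (1, -2, 0)%BZ; Turn 1 0; Turn 1 1; Ins (1, 0, 0)%BZ; Turn 0 1;
    Turn 1 0; Ins (-1, -4, 0)%BZ; Turn 1 0; Turn 1 1; Ins (-1, -2, 0)%BZ; Turn 1 0;
    Turn 1 1; Ins (-1, 0, 0)%BZ; Turn 1 0; Turn 1 1].
by vm_compute.
Qed.

Lemma sigma2_p_deforms : exists ms,
  deforms 10 (mixed_p (upright 1) sigma2_P sigma2_Q) ms
    two_discs.
Proof.
exists [:: Turn 0 6; Del; Turn 0 5; Del; Turn 0 4; Del; Turn 0 3; Del; Turn 1 6; Del;
    Turn 0 5; Del; Turn 0 4; Del; Del; Turn 1 1; Ins (-5, 0, 0)%BZ; Turn 0 3; Del;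
    Turn 0 2; Ins (-1, 2, 0)%BZ; Turn 0 3; Del; Turn 1 1; Ins (1, 2, 0)%BZ; Turn 0 3;
    Del; Turn 0 1; Turn 1 1].
by vm_compute.
Qed.

Lemma sigma2_0_deforms : exists ms,
  deforms 10 (mixed_0 (upright 1) sigma2_P sigma2_Q) ms
    disc.
Proof.
exists [:: Del; Turn 0 9; Del; Del; Del; Turn 0 6; Del; Turn 0 7; Del; Turn 0 6; Del;
    Turn 0 5; Del; Turn 0 4; Del; Turn 0 2; Del; Ins (-1, 2, 0)%BZ; Turn 0 1; Del].
by vm_compute.
Qed.

(** A single crossing is a kink whatever its sign, while its smoothing is a pair of discs; the
    resulting relation gives the effect on [V] of adding a split disc. *)
Lemma sigma1_p_deforms : exists ms,
  deforms 10 (self_p (upright 3) sigma1_P sigma1_Q) ms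
    disc.
Proof.
exists [:: Turn 0 3; Del; Turn 0 10; Del; Turn 0 6; Del; Turn 0 5; Del; Del; Del; Turn 0 2;
    Del; Turn 0 2; Del; Del; Turn 0 2; Del; Turn 0 1].
by vm_compute.
Qed.

Lemma sigma1_m_deforms : exists ms,
  deforms 10 (self_m (upright 3) sigma1_P sigma1_Q) ms
    disc.
Proof.
exists [:: Turn 0 3; Del; Turn 0 10; Del; Turn 0 6; Del; Turn 0 5; Del; Del; Del; Turn 0 2;
    Del; Turn 0 2; Del; Del; Turn 0 2; Del; Turn 0 1].
by vm_compute.
Qed.

Lemma sigma1_0_deforms : exists ms,
  deforms 10 (self_0 (upright 3) sigma1_P sigma1_Q) ms
    two_discs.
Proof.
exists [:: Turn 1 2; Del; Del; Del; Turn 1 2; Del; Turn 0 3; Del; Turn 0 1; Del;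
    Ins (0, 1, 1)%BZ; Turn 0 3; Del; Turn 0 2; Ins (-5, 0, 0)%BZ; Turn 0 3; Del;
    Ins (-1, 4, 0)%BZ; Turn 0 3; Del; Turn 1 1; Turn 1 0].
by vm_compute.
Qed.

Lemma clasp2_m_deforms : exists ms,
  deforms 10 (mixed_m (lying (-3)) clasp2_P clasp2_Q) ms
    clasp1.
Proof.
exists [:: Turn 0 7; Del; Turn 0 6; Del; Turn 0 1; Del; Turn 0 4; Del; Turn 1 7; Del; Del;
    Del; Del; Turn 0 2; Del; Ins (-1, 4, 0)%BZ; Turn 1 0; Turn 1 2; Ins (-1, -4, 0)%BZ;
    Turn 1 0; Turn 1 1; Ins (-1, -2, 0)%BZ; Turn 1 0; Turn 1 1; Ins (-1, 0, 0)%BZ;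
    Turn 0 1; Turn 1 0; Ins (1, -4, 0)%BZ; Ins (1, -2, 0)%BZ; Ins (1, 0, 0)%BZ;
    Turn 1 0; Turn 1 6].
by vm_compute.
Qed.

(** Smoothing antiparallel strands cuts the twist across, and the remaining crossings become kinks
    of one closed curve. *)
Lemma clasp2_0_deforms : exists ms,
  deforms 10 (mixed_0 (lying (-3)) clasp2_P clasp2_Q) ms
    disc.
Proof.
exists [:: Del; Turn 0 13; Del; Turn 0 7; Del; Turn 0 5; Del; Del; Turn 0 8; Del; Del; Del;
    Turn 0 4; Del; Turn 0 1; Del; Turn 0 3; Del; Turn 0 1; Del; Turn 0 2;
    Ins (-1, 2, 0)%BZ; Turn 0 1; Del].
by vm_compute.
Qed.

Lemma clasp1_m_deforms : exists ms,
  deforms 10 (mixed_m (lying 1) clasp1_P clasp1_Q) ms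
    two_discs.
Proof.
exists [:: Turn 1 6; Del; Turn 1 3; Del; Turn 1 4; Del; Turn 1 4; Del; Del; Turn 1 1; Del;
    Turn 0 3; Del; Turn 1 2; Del; Turn 0 2; Ins (1, 2, 0)%BZ; Turn 0 3; Del;
    Ins (5, 0, 0)%BZ; Turn 0 3; Del; Turn 1 1; Ins (-1, 2, 0)%BZ; Turn 0 3; Del;
    Turn 1 2; Turn 1 1].
by vm_compute.
Qed.

Lemma clasp1_0_deforms : exists ms,
  deforms 10 (mixed_0 (lying 1) clasp1_P clasp1_Q) ms
    disc.
Proof.
exists [:: Turn 0 12; Del; Turn 0 11; Del; Del; Turn 0 9; Del; Turn 0 8; Del; Turn 0 7; Del;
    Turn 0 6; Del; Turn 0 5; Del; Turn 0 4; Del; Turn 0 3; Del; Turn 0 1;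
    Ins (-1, 2, 0)%BZ; Turn 0 3; Del; Turn 0 1].
by vm_compute.
Qed.

Definition shift (d : Z) (p : seq zpoint) : seq zpoint :=
  [seq (Z.add d a.1.1, a.1.2, a.2) | a <- p].

(** Brings the disc of the middle slot beside the disc of the first one, where the relation between
    one disc and two applies. The picture spans all three slots, hence the wider slab. *)
Lemma three_discs_deforms : exists ms,
  deforms 60 [:: left_disc; shift 20 left_disc; shift 40 left_disc] ms
    [:: left_disc; right_disc; shift 40 left_disc].
Proof.
exists [:: Turn 1 1; Ins (1, 2, 0)%BZ; Turn 0 1; Del; Turn 0 1; Ins (3, 1, 2)%BZ; Turn 0 3;
    Del; Turn 0 1; Ins (1, 4, 0)%BZ; Turn 0 3; Del; Turn 0 2; Ins (5, 0, 0)%BZ;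
    Turn 0 3; Del; Turn 2 0; Turn 1 2; Turn 2 0].
by vm_compute.
Qed.

Lemma two_far_discs_deforms : exists ms,
  deforms 60 [:: left_disc; shift 40 left_disc] ms
    two_discs.
Proof.
exists [:: Turn 1 1; Ins (1, 2, 0)%BZ; Turn 0 1; Del; Turn 0 1; Ins (3, 1, 2)%BZ; Turn 0 3;
    Del; Turn 0 1; Ins (1, 4, 0)%BZ; Turn 0 3; Del; Turn 0 2; Ins (5, 0, 0)%BZ;
    Turn 0 3; Del; Turn 0 2; Turn 1 0].
by vm_compute.
Qed.

(** * Three slots *)

Section ThreeSlots.
Variable R : realType.
Implicit Types (o : 'rV[R]_3) (F : link R -> CqE R) (S : seq (seq 'rV[R]_3)).

Record picture := Picture { diagram :> seq (seq zpoint); diagramP : zlink 10 diagram }.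

(* Local pictures have width less than 20, so that different slots are disjoint. *)
Definition slot (k : Z) : 'rV[R]_3 := zrow R (Z.mul 20 k, Z0, Z0).

Lemma slot_x k : slot k 0 ord0 = zr R (Z.mul 20 k).
Proof. by rewrite mxE. Qed.

Lemma away_cat o K S1 S2 : away o K S1 -> away o K S2 -> away o K (S1 ++ S2).
Proof. by move=> a1 a2 q; rewrite mem_cat => /orP[/a1|/a2]. Qed.

Lemma away_slot (i j : Z) (X : picture) : i != j -> away (slot i) 10%BZ (place (slot j) X).
Proof.
move=> ij q /mapP[p pX ->]; case/and4P: (diagramP X) => _ /allP sX _ /allP bX.
split; first by rewrite size_map; case/and3P: (sX p pX) => /ltnW/ltnW.
have xP v : v \in zpoly (slot j) p -> exists2 a : Z, Z.ltb (Z.opp 10) a && Z.ltb a 10 &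
    v 0 ord0 = zr R (Z.add (Z.mul 20 j) a).
  move=> /mapP[a ap ->]; exists a.1.1; first by move/allP: (bX p pX); apply.
  by rewrite /pt mxE slot_x mxE zrD.
have [h|h] : Z.ltb i j \/ Z.ltb j i by move: ij => /eqP; lia.
  left=> v /xP[a a10 ->]; rewrite slot_x -zrD; apply: zr_le.
  by move: a10 h; lia.
right=> v /xP[a a10 ->]; rewrite slot_x -zrB; apply: zr_le.
by move: a10 h; lia.
Qed.

Lemma good0 : good ([::] : seq (seq 'rV[R]_3)).
Proof. by split. Qed.

Lemma away0 o K : away o K ([::] : seq (seq 'rV[R]_3)).
Proof. by []. Qed.

Lemma good_slot o (X : picture) : good (place o X).
Proof.
rewrite -[place o X]cats0.
by apply: (good_place (diagramP X)); [exact: away0|exact: good0].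
Qed.

Lemma good_slots i j (X Y : picture) : i != j -> good (place (slot i) X ++ place (slot j) Y).
Proof.
move=> ij; apply: (good_place (diagramP X)); last exact: good_slot.
exact: away_slot.
Qed.

Lemma value_perm F S1 S2 : isotopy_invariant F -> is_link S1 -> is_link S2 ->
  perm_eq S1 S2 -> value F S1 = value F S2.
Proof.
move=> iF l1 l2 e; rewrite -[S1]/(comps (Link l1)) -[S2]/(comps (Link l2)) !valueE.
by apply: iF; exact: isotopic_perm.
Qed.

Definition value3 F (X Y Z : picture) :=
  value F (place (slot 0) X ++ place (slot 1) Y ++ place (slot 2) Z).

Lemma link3 i j k (X Y Z : picture) : i != j -> i != k -> j != k ->
  is_link (place (slot i) X ++ place (slot j) Y ++ place (slot k) Z).
Proof.
move=> ij ik jk; apply: (link_place (diagramP X)); last exact: good_slots.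
by apply: away_cat; exact: away_slot.
Qed.

(** Components are unordered, so any slot may be listed first, the other two being its context. The
    relation is abstract in order to cover all skein relations. *)
Lemma value3_rel F (rel : (picture -> CqE R) -> Prop) : isotopy_invariant F ->
  (forall o S, away o 10%BZ S -> good S -> rel (fun X => value F (place o X ++ S))) ->
  forall Y Z, [/\ rel (fun X => value3 F X Y Z), rel (fun X => value3 F Y X Z)
    & rel (fun X => value3 F Y Z X)].
Proof.
move=> iF H Y Z; split.
- by apply: H; [apply: away_cat; exact: away_slot|exact: good_slots].
- have -> : (fun X => value3 F Y X Z) =
      (fun X : picture => value F (place (slot 1) X ++ (place (slot 0) Y ++ place (slot 2) Z))).
    apply/funext => X; apply: value_perm => //; try exact: link3.
    by rewrite perm_catCA.
  by apply: H; [apply: away_cat; exact: away_slot|exact: good_slots].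
have -> : (fun X => value3 F Y Z X) =
    (fun X : picture => value F (place (slot 2) X ++ (place (slot 0) Y ++ place (slot 1) Z))).
  apply/funext => X; apply: value_perm => //; try exact: link3.
  by rewrite catA perm_catC.
by apply: H; [apply: away_cat; exact: away_slot|exact: good_slots].
Qed.

End ThreeSlots.

(** * Split unions recognized by cubes *)

Section SplitUnions.
Variable R : realType.

Implicit Types (B : seq ('rV[R]_3 * R)) (b : 'rV[R]_3 * R).

Definition covers b (p : seq 'rV[R]_3) : bool := all (fun v => `[< ball b.1 b.2 v >]) p.

Definition precedes b b' : bool := b.1 0 ord0 + b.2 <= b'.1 0 ord0 - b'.2.

(** Cubes are convex, so containing the vertices is enough; cubes ordered along the first axis are
    disjoint. The link itself serves as its isotopic copy. *)
Lemma split_union_balls (L : link R) B :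
  (forall p, p \in comps L -> (0 < size p)%N) ->
  all2 covers B L -> pairwise precedes B -> split_union_of_knots L.
Proof.
move=> L0; rewrite all2E => /andP[/eqP sB /all_nthP cB] /(pairwiseP (0, 0)) pB.
have HB i v : (i < size L)%N -> v \in nth [::] L i ->
    ball (nth (0, 0) B i).1 (nth (0, 0) B i).2 v.
  move=> iL vL; have := cB ((0, 0), [::]) i; rewrite size_zip sB minnn => /(_ iL).
  by rewrite nth_zip//= => /allP /(_ v vL) /asboolP.
have HD i j : (i < j < size L)%N ->
    (nth (0, 0) B i).1 0 ord0 + (nth (0, 0) B i).2 <=
    (nth (0, 0) B j).1 0 ord0 - (nth (0, 0) B j).2.
  move=> /andP[ij jL]; apply: pB => //; rewrite inE sB//.
  exact: ltn_trans jL.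
exists L, (fun i => (nth (0, 0) B i).1), (fun i => (nth (0, 0) B i).2); split.
- exact: isotopic_perm.
- apply/trivIsetP => i j /= iL jL ij.
  wlog ij' : i j iL jL ij / (i < j)%N.
    move=> H; have [h|h|h] := ltngtP i j; first exact: H.
      by rewrite setIC; apply: H => //; rewrite eq_sym.
    by rewrite h eqxx in ij.
  apply/seteqP; split=> // v [[_ /(_ 0 ord0) h1] [_ /(_ 0 ord0) h2]].
  have := HD i j; rewrite ij' jL => /(_ isT).
  move: h1 h2; rewrite /ball /= !ltr_norml => /andP[h1 h1'] /andP[h2 h2']; lra.
move=> i iL x; have p0 := L0 _ (mem_nth [::] iL).
rewrite range_loop// => -[k [t [kp t01 ->]]].
have [r0 hu] := HB i _ iL (mem_nth 0 kp).
have kp' : (k.+1 %% size (nth [::] L i) < size (nth [::] L i))%N by rewrite ltn_mod.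
have [_ hv] := HB i _ iL (mem_nth 0 kp').
split=> // a b; move: (hu a b) (hv a b).
rewrite (ord1 a) /lerp !mxE /ball /=.
move: ((nth (0, 0) B i).1 0 b) ((nth [::] L i)`_k 0 b) => c u.
move: ((nth [::] L i)`_(k.+1 %% size (nth [::] L i)) 0 b) (nth (0, 0) B i).2 => v r.
rewrite !ltr_norml => /andP[h1 h2] /andP[h3 h4].
pose d := Num.min (Num.min (c - u + r) (r - (c - u))) (Num.min (c - v + r) (r - (c - v))).
have d0 : 0 < d by rewrite !lt_min; lra.
have [[d1 d2] [d3 d4]] : (d <= c - u + r /\ d <= r - (c - u)) /\
    (d <= c - v + r /\ d <= r - (c - v)).
  by rewrite /d !ge_min !lexx !orbT.
by apply/andP; split; nra.
Qed.

End SplitUnions.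

(** * Skein relations among the pictures *)

Section Pictures.
Variable R : realType.

Definition P_disc := Picture (erefl : zlink 10 disc).
Definition P_two := Picture (erefl : zlink 10 two_discs).
Definition P_sigma2 := Picture (erefl : zlink 10 sigma2).
Definition P_sigma3 := Picture (erefl : zlink 10 sigma3).
Definition P_sigma4 := Picture (erefl : zlink 10 sigma4).
Definition P_clasp1 := Picture (erefl : zlink 10 clasp1).
Definition P_clasp2 := Picture (erefl : zlink 10 clasp2).

Variable F : link R -> CqE R.
Hypothesis iF : isotopy_invariant F.
Variables (o : 'rV[R]_3) (S : seq (seq 'rV[R]_3)).
Hypotheses (aS : away o 10%BZ S) (gS : good S).

Let val X := value F (place o X ++ S).

Lemma mixed_relation f P Q X Y Z : mixed_skein F ->
  [&& mixed_ok 10 f P Q, zlink 10 (mixed_p f P Q), zlink 10 (mixed_m f P Q)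
    & zlink 10 (mixed_0 f P Q)] ->
  same_value R 10 (mixed_p f P Q) X -> same_value R 10 (mixed_m f P Q) Y ->
  same_value R 10 (mixed_0 f P Q) Z -> skein_eq (val X) (val Y) (val Z).
Proof.
move=> sF /and4P[ok zp zm z0'] hX hY hZ.
rewrite /val -(hX F o S iF aS gS) -(hY F o S iF aS gS) -(hZ F o S iF aS gS).
exact: (place_mixed_skein sF ok zp zm z0' aS gS).
Qed.

Lemma self_relation f P Q X Y Z : self_skein F ->
  [&& self_ok 10 f P Q, zlink 10 (self_p f P Q), zlink 10 (self_m f P Q)
    & zlink 10 (self_0 f P Q)] ->
  same_value R 10 (self_p f P Q) X -> same_value R 10 (self_m f P Q) Y ->
  same_value R 10 (self_0 f P Q) Z -> skein_eq (val X) (val Y) (val Z).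
Proof.
move=> sF /and4P[ok zp zm z0'] hX hY hZ.
rewrite /val -(hX F o S iF aS gS) -(hY F o S iF aS gS) -(hZ F o S iF aS gS).
exact: (place_self_skein sF ok zp zm z0' aS gS).
Qed.

Let same_refl X : same_value R 10 X X. Proof. by []. Qed.

Lemma sigma4_relation : mixed_skein F -> skein_eq (val sigma2) (val sigma4) (val sigma3).
Proof.
move=> sF; have [? hp] := sigma4_p_deforms; have [? h0] := sigma4_0_deforms.
apply: (mixed_relation sF _ (deformsP (R := R) hp) (@same_refl sigma4) (deformsP (R := R) h0)).
by vm_compute.
Qed.

Lemma sigma3_relation : self_skein F -> skein_eq (val disc) (val sigma3) (val sigma2).
Proof.
move=> sF; have [? hp] := sigma3_p_deforms; have [? h0] := sigma3_0_deforms.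
apply: (self_relation sF _ (deformsP (R := R) hp) (@same_refl sigma3) (deformsP (R := R) h0)).
by vm_compute.
Qed.

Lemma sigma2_relation : mixed_skein F -> skein_eq (val two_discs) (val sigma2) (val disc).
Proof.
move=> sF; have [? hp] := sigma2_p_deforms; have [? h0] := sigma2_0_deforms.
apply: (mixed_relation sF _ (deformsP (R := R) hp) (@same_refl sigma2) (deformsP (R := R) h0)).
by vm_compute.
Qed.

Lemma sigma1_relation : self_skein F -> skein_eq (val disc) (val disc) (val two_discs).
Proof.
move=> sF; have [? hp] := sigma1_p_deforms; have [? hm] := sigma1_m_deforms.
have [? h0] := sigma1_0_deforms.
apply: (self_relation sF _ (deformsP (R := R) hp) (deformsP (R := R) hm) (deformsP (R := R) h0)).
by vm_compute.
Qed.

Lemma clasp2_relation : mixed_skein F -> skein_eq (val clasp2) (val clasp1) (val disc).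
Proof.
move=> sF; have [? hm] := clasp2_m_deforms; have [? h0] := clasp2_0_deforms.
apply: (mixed_relation sF _ (@same_refl clasp2) (deformsP (R := R) hm) (deformsP (R := R) h0)).
by vm_compute.
Qed.

Lemma clasp1_relation : mixed_skein F -> skein_eq (val clasp1) (val two_discs) (val disc).
Proof.
move=> sF; have [? hm] := clasp1_m_deforms; have [? h0] := clasp1_0_deforms.
apply: (mixed_relation sF _ (@same_refl clasp1) (deformsP (R := R) hm) (deformsP (R := R) h0)).
by vm_compute.
Qed.

End Pictures.

(* A pair B stands for the cube with centre B.1 and radius B.2. *)
Definition in_zcube (p : seq zpoint) (B : zpoint * Z) : bool :=
  let near x y := Z.ltb (Z.abs (Z.sub x y)) B.2 in
  all (fun v : zpoint => [&& near B.1.1.1 v.1.1, near B.1.1.2 v.1.2 & near B.1.2 v.2]) p.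

Definition left_of (B B' : zpoint * Z) : bool :=
  Z.leb (Z.add B.1.1.1 B.2) (Z.sub B'.1.1.1 B'.2).

Definition cubes_in_slot (B : zpoint * Z) : bool :=
  Z.leb (Z.opp 10) (Z.sub B.1.1.1 B.2) && Z.leb (Z.add B.1.1.1 B.2) 10.

Definition cubes_ok (X : seq (seq zpoint)) (Bs : seq (zpoint * Z)) : bool :=
  [&& size Bs == size X, all2 in_zcube X Bs, pairwise left_of Bs, all (fun B => Z.ltb Z0 B.2) Bs
    & all cubes_in_slot Bs].

Section SplitPictures.
Variable R : realType.
Implicit Types (X Y : picture).

Definition split_picture X := exists Bs, cubes_ok X Bs.

Let slot_ball (k : Z) (B : zpoint * Z) : 'rV[R]_3 * R := (pt (slot R k) B.1, zr R B.2).

Let slot_ballP k p B v : Z.ltb Z0 B.2 -> in_zcube p B -> v \in zpoly (slot R k) p ->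
  ball (slot_ball k B).1 (slot_ball k B).2 v.
Proof.
move=> B0 /allP pB /mapP[a /pB /and3P[h1 h2 h3] ->]; split; first exact: (zr_lt R B0).
have near x y : Z.ltb (Z.abs (Z.sub x y)) B.2 -> `|zr R x - zr R y| < zr R B.2.
  move=> h; rewrite -zrB ltr_norml -zrN; apply/andP; split; apply: zr_lt; lia.
move=> i; rewrite (ord1 i) => -[[|[|[|j]]] jP] //; rewrite /ball /= /pt !mxE /=;
  rewrite opprD addrACA subrr add0r; exact: near.
Qed.

Let pt_x (o : 'rV[R]_3) a : pt o a 0 ord0 = o 0 ord0 + zr R a.1.1.
Proof. by rewrite /pt !mxE. Qed.

Let left_of_precedes k k' B B' :
  cubes_in_slot B -> cubes_in_slot B' -> Z.ltb k k' || (Z.eqb k k' && left_of B B') ->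
  precedes (slot_ball k B) (slot_ball k' B').
Proof.
rewrite /precedes /slot_ball /= !pt_x !slot_x -!zrD -zrB.
rewrite /cubes_in_slot /left_of => h h' h''; apply: zr_le; lia.
Qed.

Lemma split_union3 X Y (Z : picture) (L : link R) :
  split_picture X -> split_picture Y -> split_picture Z ->
  comps L = place (slot R 0) X ++ place (slot R 1) Y ++ place (slot R 2) Z ->
  split_union_of_knots L.
Proof.
have cov k (W : picture) Bs : cubes_ok W Bs ->
    all2 (@covers R) (map (slot_ball k) Bs) (place (slot R k) W).
  move=> /and5P[_ + _ + _]; elim: (diagram W) Bs => [|p W' IH] [|B Bs]//=.
  move=> /andP[pB h] /andP[B0 h']; rewrite IH// andbT.
  by apply/allP => v vp; apply/asboolP; exact: slot_ballP pB vp.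
have sz k (W : picture) Bs : cubes_ok W Bs ->
    size (map (slot_ball k) Bs) = size (place (slot R k) W).
  by move=> /and5P[/eqP + _ _ _ _]; rewrite !size_map.
have pre k (W : picture) Bs : cubes_ok W Bs -> pairwise (@precedes R) (map (slot_ball k) Bs).
  move=> /and5P[_ _ + _]; rewrite pairwise_map; elim: Bs => [//|B Bs IH] /=.
  move=> /andP[/allP BB h] /andP[Bb hb]; rewrite IH// andbT.
  apply/allP => B' B'B; apply: left_of_precedes => //; last by rewrite BB// Z.eqb_refl orbT.
  by move/allP: hb; apply.
have ord k k' (W W' : picture) Bs Bs' : Z.ltb k k' -> cubes_ok W Bs -> cubes_ok W' Bs' ->
    allrel (@precedes R) (map (slot_ball k) Bs) (map (slot_ball k') Bs').
  move=> kk /and5P[_ _ _ _ /allP h] /and5P[_ _ _ _ /allP h'].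
  apply/allrelP => _ _ /mapP[B /h hB ->] /mapP[B' /h' hB' ->].
  by apply: left_of_precedes => //; rewrite kk.
move=> [Bx hx] [By hy] [Bz hz] LE.
apply: (@split_union_balls _ L
  (map (slot_ball 0) Bx ++ map (slot_ball 1) By ++ map (slot_ball 2) Bz)).
- move=> p; rewrite LE !mem_cat => /or3P[] /mapP[p' p'X ->]; rewrite size_map.
  + by case/and4P: (diagramP X) => _ /allP /(_ p' p'X) /and3P[/ltnW/ltnW].
  + by case/and4P: (diagramP Y) => _ /allP /(_ p' p'X) /and3P[/ltnW/ltnW].
  + by case/and4P: (diagramP Z) => _ /allP /(_ p' p'X) /and3P[/ltnW/ltnW].
- rewrite LE all2E !size_cat (sz _ _ _ hx) (sz _ _ _ hy) (sz _ _ _ hz) eqxx /=.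
  rewrite (zip_cat _ _ (sz _ _ _ hx)) (zip_cat _ _ (sz _ _ _ hy)) !all_cat.
  have := cov 0%BZ X Bx hx; have := cov 1%BZ Y By hy; have := cov 2%BZ Z Bz hz.
  by rewrite !all2E => /andP[_ ->] /andP[_ ->] /andP[_ ->].
rewrite !pairwise_cat (pre _ X)// (pre _ Y)// (pre _ Z)// !andbT allrel_catr.
by rewrite (ord _ _ X Y)// (ord _ _ X Z)// (ord _ _ Y Z).
Qed.

End SplitPictures.

(** * Setting E = 1 in Laurent polynomials *)

Section FractionIdentities.
Variable F : fieldType.
Implicit Types (a b c d x y : F).

Lemma cross_mul x y a b : a != 0 -> b != 0 -> x / a = y / b -> x * b = y * a.
Proof. by move=> a0 b0 /eqP; rewrite eqr_div// => /eqP. Qed.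

Lemma div_eq x y a b : a != 0 -> b != 0 -> x * b = y * a -> x / a = y / b.
Proof. by move=> a0 b0 E; apply/eqP; rewrite eqr_div// E. Qed.

Lemma add_fractions x y a b c d : a != 0 -> b != 0 -> c != 0 -> d != 0 ->
  x / (a * b) + y / (c * d) = (x * (c * d) + y * (a * b)) / (a * c * (b * d)).
Proof. by move=> *; field; do ! (apply/andP; split). Qed.

Lemma add_fractions1 x y a c : a != 0 -> c != 0 ->
  x / a + y / c = (x * c + y * a) / (a * c).
Proof. by move=> *; field; do ! (apply/andP; split). Qed.

Lemma mul_fractions x y a b c d : a != 0 -> b != 0 -> c != 0 -> d != 0 ->
  x / (a * b) * (y / (c * d)) = (x * y) / (a * c * (b * d)).
Proof. by move=> *; field; do ! (apply/andP; split). Qed.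

Lemma mul_fractions1 x y a c : a != 0 -> c != 0 ->
  x / a * (y / c) = (x * y) / (a * c).
Proof. by move=> *; field; do ! (apply/andP; split). Qed.

End FractionIdentities.

Section EvaluationAtE1.
Variables (A : comNzRingType) (F : fieldType) (io : {rmorphism A -> F}) (ev : {rmorphism A -> A}).
Variables q E : A.
Hypotheses (io_inj : injective io) (q0 : io q != 0) (E0 : io E != 0).
Hypotheses (evq : ev q = q) (evE : ev E = 1).
Implicit Types (x y z : F) (p : A).

(* The extension of the evaluation ev : E |-> 1 to Laurent polynomials. *)
Definition at_E1 x y : Prop := exists p (n m : nat),
  x = io p / (io q ^+ n * io E ^+ m) /\ y = io (ev p) / io q ^+ n.

Let qn0 n : io q ^+ n != 0. Proof. exact: expf_neq0. Qed.
Let En0 n : io E ^+ n != 0. Proof. exact: expf_neq0. Qed.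

Let denE n m : io q ^+ n * io E ^+ m = io (q ^+ n * E ^+ m).
Proof. by rewrite rmorphM !rmorphXn. Qed.

Let ev_den n m : ev (q ^+ n * E ^+ m) = q ^+ n.
Proof. by rewrite rmorphM !rmorphXn /= evq evE expr1n mulr1. Qed.

(** Cross multiplication turns equal fractions into an identity in A, to which [ev] applies; the
    denominators become powers of q and stay nonzero. *)
Lemma at_E1_fun x y z : at_E1 x y -> at_E1 x z -> y = z.
Proof.
move=> [p [n [m [-> ->]]]] [p' [n' [m' [+ ->]]]].
move=> /(cross_mul (mulf_neq0 (qn0 n) (En0 m)) (mulf_neq0 (qn0 n') (En0 m'))).
rewrite !denE -!rmorphM => /io_inj /(congr1 ev).
rewrite (rmorphM ev p) (rmorphM ev p') !ev_den => e.
apply: (div_eq (qn0 n) (qn0 n')).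
by rewrite -!rmorphXn -!rmorphM e.
Qed.

Lemma at_E1D x y x' y' : at_E1 x y -> at_E1 x' y' -> at_E1 (x + x') (y + y').
Proof.
move=> [p [n [m [-> ->]]]] [p' [n' [m' [-> ->]]]].
exists (p * (q ^+ n' * E ^+ m') + p' * (q ^+ n * E ^+ m)), (n + n')%N, (m + m')%N.
rewrite (rmorphD ev) !(rmorphM ev _ (_ * _)) !ev_den !(rmorphD io) !(rmorphM io).
rewrite !rmorphXn !exprD; split.
  exact: (add_fractions _ _ (qn0 n) (En0 m) (qn0 n') (En0 m')).
exact: (add_fractions1 _ _ (qn0 n) (qn0 n')).
Qed.

Lemma at_E1M x y x' y' : at_E1 x y -> at_E1 x' y' -> at_E1 (x * x') (y * y').
Proof.
move=> [p [n [m [-> ->]]]] [p' [n' [m' [-> ->]]]].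
exists (p * p'), (n + n')%N, (m + m')%N.
rewrite (rmorphM ev) !(rmorphM io) !exprD; split.
  exact: (mul_fractions _ _ (qn0 n) (En0 m) (qn0 n') (En0 m')).
exact: (mul_fractions1 _ _ (qn0 n) (qn0 n')).
Qed.

Lemma at_E1N x y : at_E1 x y -> at_E1 (- x) (- y).
Proof.
move=> [p [n [m [-> ->]]]]; exists (- p), n, m.
by rewrite !(rmorphN ev) !(rmorphN io) !mulNr.
Qed.

Lemma at_E1_id p n : ev p = p -> at_E1 (io p / io q ^+ n) (io p / io q ^+ n).
Proof. by move=> evp; exists p, n, 0%N; rewrite evp expr0 mulr1. Qed.

Lemma at_E1_expE n : at_E1 (io E ^ n) 1.
Proof.
case: n => n.
  exists (E ^+ n), 0%N, 0%N; rewrite !rmorphXn /= evE rmorph1 expr1n !expr0 mulr1 !divr1.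
  by [].
exists 1, 0%N, n.+1; split; last by rewrite !rmorph1 expr0 divr1.
by rewrite rmorph1 expr0 !mul1r NegzE -exprnN.
Qed.

(** Evaluation is single valued and respects sums and products, and it fixes the coefficients, which
    involve q alone. *)
Lemma at_E1_skein (a b c a' b' c' : F) :
  at_E1 a a' -> at_E1 b b' -> at_E1 c c' ->
  io q ^- 2 * a - io q ^+ 2 * b = (io q - (io q)^-1) * c ->
  io q ^- 2 * a' - io q ^+ 2 * b' = (io q - (io q)^-1) * c'.
Proof.
move=> ha hb hc e.
have Q : at_E1 (io q) (io q) by have := at_E1_id 0 evq; rewrite expr0 divr1.
have QV : at_E1 (io q)^-1 (io q)^-1.
  by have := at_E1_id 1 (rmorph1 ev); rewrite rmorph1 expr1 div1r.
have Q2 : at_E1 (io q ^+ 2) (io q ^+ 2) by exact: at_E1M.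
have QV2 : at_E1 (io q ^- 2) (io q ^- 2) by rewrite -exprVn; exact: at_E1M.
have l : at_E1 (io q ^- 2 * a - io q ^+ 2 * b) (io q ^- 2 * a' - io q ^+ 2 * b').
  by apply: at_E1D; [exact: at_E1M|apply: at_E1N; exact: at_E1M].
have r : at_E1 ((io q - (io q)^-1) * c) ((io q - (io q)^-1) * c').
  by apply: at_E1M => //; apply: at_E1D => //; exact: at_E1N.
by rewrite e in l; exact: (at_E1_fun l r).
Qed.

Lemma skein_correction (x y z x1 y1 z1 x2 y2 z2 r s t : F) :
  r * x - s * y = t * z -> r * x1 - s * y1 = t * z1 -> r * x2 - s * y2 = t * z2 ->
  r * (x + (x1 - x2)) - s * (y + (y1 - y2)) = t * (z + (z1 - z2)).
Proof.
move=> h h1 h2; have -> : t * (z + (z1 - z2)) = t * z + (t * z1 - t * z2) by ring.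
by rewrite -h -h1 -h2; ring.
Qed.

End EvaluationAtE1.

Section ThetaAtE1.
Variable R : realType.
Local Notation tofrac := (@FracField.tofrac {poly {poly R[i]}}).

Lemma q_neq0 : q_ R != 0.
Proof. by rewrite /q_ tofrac_eq0 polyC_eq0 polyX_eq0. Qed.

Lemma E_neq0 : E_ R != 0.
Proof. by rewrite /E_ tofrac_eq0 polyX_eq0. Qed.

(** Evaluation at E = 1 followed by the inclusion of constants, so as to remain in the ring of
    polynomials in q and E. *)
Let ev := polyC \o horner_eval (1 : {poly R[i]}).

Let at1 := @at_E1 _ _ tofrac ev 'X%:P 'X.

Let tofrac_inj : injective tofrac.
Proof. by move=> x y /eqP; rewrite tofrac_eq => /eqP. Qed.

Let evq : ev 'X%:P = 'X%:P.
Proof. by rewrite /ev /= /horner_eval hornerC. Qed.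

Let evE : ev 'X = 1.
Proof. by rewrite /ev /= /horner_eval hornerX. Qed.

Let at1_fun x y z : at1 x y -> at1 x z -> y = z.
Proof. exact: (@at_E1_fun _ _ tofrac ev _ _ tofrac_inj q_neq0 E_neq0 evq evE). Qed.

Let at1_laurent (x : CqE R) : laurent_qE x -> exists y, at1 x y.
Proof. by move=> [p [n [m ->]]]; exists (tofrac (ev p) / q_ R ^+ n), p, n, m. Qed.

Let laurent_at1 x y : at1 x y -> laurent_qE x /\ laurent_qE y.
Proof.
move=> [p [n [m [-> ->]]]]; split; first by exists p, n, m.
by exists (ev p), n, 0%N; rewrite expr0 mulr1.
Qed.

Let at1_id (x : CqE R) : laurent_q x -> at1 x x.
Proof.
move=> [p [n ->]]; apply: (@at_E1_id _ _ tofrac ev).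
by rewrite /ev /= /horner_eval hornerC.
Qed.

(* The difference of theta(q,1) and V could be added to theta without violating
   the properties that characterize theta. *)
Lemma theta_determines_jones (V theta : link R -> CqE R) : is_jones V ->
  unique (is_theta V) theta -> forall L L', theta L = theta L' -> V L = V L'.
Proof.
move=> [iV lV _ sV] [[it lt st ut] uniq].
have [f Hf] : exists f : link R -> CqE R, forall L, at1 (theta L) (f L).
  exists (fun L => projT1 (cid (at1_laurent (lt L)))) => L.
  exact: (projT2 (cid (at1_laurent (lt L)))).
have atV L : at1 (V L) (V L) by exact: at1_id.
suff /uniq E : is_theta V (fun L => theta L + (f L - V L)).
  have fV L : f L = V L.
    have EL := congr1 (fun g => g L) E.
    apply: subr0_eq; apply: (addrI (theta L)); rewrite addr0; exact: esym EL.
  move=> L L' e; rewrite -!fV; have h := Hf L; rewrite e in h.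
  exact: (at1_fun h (Hf L')).
split.
- move=> L L' LL'; rewrite (it _ _ LL') (iV _ _ LL').
  have h := Hf L; rewrite (it _ _ LL') in h.
  by rewrite (at1_fun h (Hf L')).
- move=> L; have [lt' lf] := laurent_at1 (Hf L).
  have [y ty] := at1_laurent lt'; have [z fz] := at1_laurent lf.
  exact: (proj1 (laurent_at1 (at_E1D q_neq0 E_neq0 evq evE ty
    (at_E1D q_neq0 E_neq0 evq evE fz (at_E1N (atV L)))))).
- move=> Lp Lm L0 c; apply: skein_correction; [exact: (st _ _ _ c)| |].
    exact: (at_E1_skein tofrac_inj q_neq0 E_neq0 evq evE (Hf Lp) (Hf Lm) (Hf L0) (st _ _ _ c)).
  exact: (sV _ _ _ (or_introl c)).
(* At E = 1 the factor E^(1-r) becomes 1, so on split unions [f] is [V] and the correction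
   vanishes. *)
move=> K uK; have h := Hf K; rewrite (ut K uK) in h.
have hE : at1 (E_ R ^ (1 - (size K)%:Z)) 1 by rewrite /at1; apply: at_E1_expE.
have h' := at_E1M q_neq0 E_neq0 hE (atV K).
rewrite mul1r in h'; have e := at1_fun h h'.
by rewrite e subrr addr0 (ut K uK).
Qed.

End ThetaAtE1.

(* The numerator of the difference of the values of theta on the two links of
   the example, as a polynomial in q and E. *)
Definition gap_numerator (A : comNzRingType) (q E : A) : A :=
  let U := - (q ^+ 2 + 1) in let s := (q ^+ 3 - q) * q * E in
  q ^+ 4 * (q ^+ 8 * U + (q ^+ 4 + 1) * s) * (U - s) ^+ 2
  - (q ^+ 4 * (U - s) - (q ^+ 6 + q ^+ 2 - 1) * s) * (q ^+ 4 * U + s) ^+ 2.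

Lemma rmorph_gap_numerator (A B : comNzRingType) (f : {rmorphism A -> B}) q E :
  f (gap_numerator q E) = gap_numerator (f q) (f E).
Proof.
by rewrite /gap_numerator !(rmorphB, rmorphM, rmorphD, rmorphXn, rmorphN, rmorph1).
Qed.

(** A point where the polynomial does not vanish; the value is left factored because its factors are
    visibly nonzero in characteristic 0. *)
Lemma gap_numerator_22 (A : comNzRingType) :
  gap_numerator (2 : A) 2 = - (2 ^+ 7 * 3 ^+ 4 * 5 * 101).
Proof. by rewrite /gap_numerator; ring. Qed.

Lemma mulr_regroup (A : comNzRingType) (e1 e2 e3 e4 a b c w : A) :
  e1 * e2 * e3 * e4 * (a * b * c * w) = (e1 * a) * (e2 * b) * (e3 * c) * (e4 * w).
Proof. by ring. Qed.

(** * Algebra of the skein relations *)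

Section SkeinAlgebra.
Variables (F : fieldType) (q : F).
Hypothesis q0 : q != 0.
Implicit Types (A B C u v E : F).

Local Notation skein_rel A B C := (q ^- 2 * A - q ^+ 2 * B = (q - q^-1) * C).

Let t := q ^+ 3 - q.

Lemma skein_solve_p A B C : skein_rel A B C -> A = q ^+ 4 * B + t * C.
Proof.
move=> h; have -> : A = q ^+ 2 * (q ^- 2 * A - q ^+ 2 * B) + q ^+ 4 * B by field.
by rewrite h /t; field.
Qed.

Lemma skein_solve_m A B C : skein_rel A B C -> B = (A - t * C) / q ^+ 4.
Proof. by move=> /skein_solve_p ->; field. Qed.

Lemma skein_solve_0 A C : q ^+ 2 != 1 -> skein_rel A A C -> C = - (q + q^-1) * A.
Proof.
move=> q1 h; have q2 : q - q^-1 != 0.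
  apply: contra_neq q1 => e; have -> : q ^+ 2 = 1 + q * (q - q^-1) by field.
  by rewrite e mulr0 addr0.
by apply: (mulfI q2); rewrite -h; field.
Qed.

(** Factors of the pictures relative to one disc, when two discs have factor u. [sigma3_coef] does
    not depend on u: it is the value of [V] on the trefoil, where two discs have factor -(q +
    1/q). *)
Definition sigma2_coef u := (u - t) / q ^+ 4.
Definition sigma3_coef := (1 - t * sigma2_coef (- (q + q^-1))) / q ^+ 4.
Definition sigma4_coef u := (sigma2_coef u - t * sigma3_coef) / q ^+ 4.
Definition clasp1_coef u := q ^+ 4 * u + t.
Definition clasp2_coef u := q ^+ 4 * clasp1_coef u + t.

Section Slots.
Variables (T : Type) (d two s2 s3 s4 c1 c2 : T) (f : T -> T -> T -> F) (u K : F).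

Definition slot_relation (rel : (T -> F) -> Prop) := forall Y Z,
  [/\ rel (fun X => f X Y Z), rel (fun X => f Y X Z) & rel (fun X => f Y Z X)].

Hypothesis r2 : slot_relation (fun g => skein_rel (g two) (g s2) (g d)).
Hypothesis r4 : slot_relation (fun g => skein_rel (g s2) (g s4) (g s3)).
Hypothesis k1 : slot_relation (fun g => skein_rel (g c1) (g two) (g d)).
Hypothesis k2 : slot_relation (fun g => skein_rel (g c2) (g c1) (g d)).

Definition discs (X : T) (x : F) := (X = d /\ x = 1) \/ (X = two /\ x = u).

(** The trefoil is allowed in the first slot only, since it arises there from [sigma4]. *)
Hypothesis base : forall X x Y y Z z, discs X x \/ (X = s3 /\ x = sigma3_coef) ->
  discs Y y -> discs Z z -> f X Y Z = x * y * z * K.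

Let bd : discs d 1. Proof. by left. Qed.
Let bt : discs two u. Proof. by right. Qed.

(** The slots are resolved one at a time, the third one first; the relations being linear, each
    resolution contributes its factor independently of the other slots. *)
Lemma three_slots_value :
  f c2 s2 s2 = clasp2_coef u * sigma2_coef u ^+ 2 * K /\
  f s4 c1 c1 = sigma4_coef u * clasp1_coef u ^+ 2 * K.
Proof.
have S3 X x Y y : discs X x \/ (X = s3 /\ x = sigma3_coef) -> discs Y y ->
    f X Y s2 = x * y * sigma2_coef u * K /\ f X Y c1 = x * y * clasp1_coef u * K.
  move=> hX hY; have [_ _ /skein_solve_m ->] := r2 X Y; have [_ _ /skein_solve_p ->] := k1 X Y.
  rewrite (base hX hY bt) (base hX hY bd) /sigma2_coef /clasp1_coef.
  by split; field.
have S2 X x : discs X x \/ (X = s3 /\ x = sigma3_coef) ->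
    f X s2 s2 = x * sigma2_coef u ^+ 2 * K /\ f X c1 c1 = x * clasp1_coef u ^+ 2 * K.
  move=> hX; have [_ /skein_solve_m -> _] := r2 X s2; have [_ /skein_solve_p -> _] := k1 X c1.
  have [-> _] := S3 _ _ _ _ hX bt; have [-> _] := S3 _ _ _ _ hX bd.
  have [_ ->] := S3 _ _ _ _ hX bt; have [_ ->] := S3 _ _ _ _ hX bd.
  (* Only the factor of the slot being resolved is unfolded; the other one remains an atom for
     [field]. *)
  have E2 : sigma2_coef u ^+ 2 = sigma2_coef u * ((u - t) / q ^+ 4) by rewrite expr2.
  have E1 : clasp1_coef u ^+ 2 = clasp1_coef u * (q ^+ 4 * u + t) by rewrite expr2.
  by rewrite E2 E1; split; field.
have [D2 D1] := S2 _ _ (or_introl bd); have [T2 T1] := S2 _ _ (or_introl bt).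
have [_ P1] := S2 _ _ (or_intror (conj (erefl s3) (erefl sigma3_coef))).
split.
  have [/skein_solve_p -> _ _] := k2 s2 s2; have [/skein_solve_p -> _ _] := k1 s2 s2.
  by rewrite T2 D2 /clasp2_coef /clasp1_coef; ring.
have [/skein_solve_m -> _ _] := r4 c1 c1; have [/skein_solve_m -> _ _] := r2 c1 c1.
by rewrite T1 D1 P1 /sigma4_coef /sigma2_coef; field.
Qed.

End Slots.

Section JonesBase.
Variables (T : Type) (d two s2 s3 : T) (f : T -> T -> T -> F).
Hypothesis q1 : q ^+ 2 != 1.
Hypothesis r1 : slot_relation f (fun g => skein_rel (g d) (g d) (g two)).
Hypothesis r2 : slot_relation f (fun g => skein_rel (g two) (g s2) (g d)).
Hypothesis r3 : slot_relation f (fun g => skein_rel (g d) (g s3) (g s2)).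

(** For [V] self crossings may be resolved too: a kink splits off a disc with factor u, and the
    trefoil reduces to the Hopf link and a disc. *)
Lemma jones_base X x Y y Z z : let u := - (q + q^-1) in
  discs d two u X x \/ (X = s3 /\ x = sigma3_coef) ->
  discs d two u Y y -> discs d two u Z z -> f X Y Z = x * y * z * f d d d.
Proof.
move=> u hX hY hZ.
have -> : f X Y Z = x * f d Y Z.
  have E2 : f two Y Z = u * f d Y Z by have [/(skein_solve_0 q1)] := r1 Y Z.
  case: hX => [[[-> ->]|[-> ->]]|[-> ->]]; [by rewrite mul1r|by []|].
  have [/skein_solve_m -> _ _] := r3 Y Z; have [/skein_solve_m -> _ _] := r2 Y Z.
  by rewrite E2 /sigma3_coef /sigma2_coef /u; field.
have -> : f d Y Z = y * f d d Z.
  case: hY => [[-> ->]|[-> ->]]; first by rewrite mul1r.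
  by have [_ /(skein_solve_0 q1)] := r1 d Z.
have -> : f d d Z = z * f d d d.
  case: hZ => [[-> ->]|[-> ->]]; first by rewrite mul1r.
  by have [_ _ /(skein_solve_0 q1)] := r1 d d.
by rewrite !mulrA.
Qed.

End JonesBase.

(** The powers of q due to reversals cancel because the linking numbers add up to 0; here this is
    checked as an identity of rational functions. *)
Lemma jones_coefs : let u := - (q + q^-1) in
  clasp2_coef u * sigma2_coef u ^+ 2 = sigma4_coef u * clasp1_coef u ^+ 2.
Proof.
by rewrite /= /clasp2_coef /sigma4_coef /clasp1_coef /sigma3_coef /sigma2_coef /t; field.
Qed.

Lemma theta_gap E : E != 0 -> let u := E^-1 * - (q + q^-1) in
  clasp2_coef u * sigma2_coef u ^+ 2 - sigma4_coef u * clasp1_coef u ^+ 2 =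
  gap_numerator q E / (q ^+ 15 * E ^+ 3).
Proof.
move=> E0 /=.
rewrite /gap_numerator /clasp2_coef /sigma4_coef /clasp1_coef /sigma3_coef /sigma2_coef /t.
field.
by rewrite q0 E0.
Qed.

End SkeinAlgebra.

(** * The two links and their values *)

Section Separation.
Variable R : realType.
Variables V theta : link R -> CqE R.
Hypotheses (hV : is_jones V) (htheta : is_theta V theta).

Local Notation q := (q_ R).
Local Notation E := (E_ R).
Local Notation tofrac := (@FracField.tofrac {poly {poly R[i]}}).

Let iV : isotopy_invariant V. Proof. by case: hV. Qed.
Let it : isotopy_invariant theta. Proof. by case: htheta. Qed.
Let mV : mixed_skein V. Proof. by case: hV => _ _ _ h Lp Lm L0 c; apply: h; left. Qed.
Let sV : self_skein V. Proof. by case: hV => _ _ _ h Lp Lm L0 c; apply: h; right. Qed.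
Let mt : mixed_skein theta. Proof. by case: htheta. Qed.

Let q0 : q != 0 := q_neq0 R.
Let E0 : E != 0 := E_neq0 R.

(** The polynomial X^2 vanishes at 0, the constant a does not. The cases a = 1 and a = -1 make q -
    1/q and q + 1/q invertible. *)
Lemma q_expr2_neq (a : R[i]) : a != 0 -> q ^+ 2 != tofrac a%:P%:P.
Proof.
move=> a0; rewrite /q_ -tofracXn tofrac_eq -polyC_exp; apply: contra_neq a0 => /polyC_inj.
by move=> /(congr1 (horner^~ 0)); rewrite hornerXn hornerC expr0n.
Qed.

Let q21 : q ^+ 2 != 1.
Proof. by rewrite -(tofrac1 {poly {poly R[i]}}) -!polyC1; apply: q_expr2_neq; exact: oner_neq0. Qed.

Let q2N1 : q ^+ 2 + 1 != 0.
Proof.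
rewrite addr_eq0 -(tofrac1 {poly {poly R[i]}}) -tofracN -!polyC1 -!polyCN.
by apply: q_expr2_neq; rewrite oppr_eq0; exact: oner_neq0.
Qed.

Let u := - (q + q^-1).

Let u0 : u != 0.
Proof.
rewrite oppr_eq0; apply: contra_neq q2N1 => e.
have -> : q ^+ 2 + 1 = q * (q + q^-1) by rewrite mulrDr (mulfV q0) expr2.
by rewrite e mulr0.
Qed.

Let slots (F : link R -> CqE R) (rel : (picture -> CqE R) -> Prop) :
  isotopy_invariant F ->
  (forall o S, away o 10%BZ S -> good S -> rel (fun X => value F (place o X ++ S))) ->
  slot_relation (value3 F) rel.
Proof. by move=> iF H Y Z; exact: value3_rel. Qed.

Let rel_sigma4 F : isotopy_invariant F -> mixed_skein F -> slot_relation (value3 F)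
  (fun g : picture -> CqE R => skein_eq (g P_sigma2) (g P_sigma4) (g P_sigma3)).
Proof. by move=> iF mF; apply: slots => // o S aS gS; exact: sigma4_relation. Qed.

Let rel_sigma2 F : isotopy_invariant F -> mixed_skein F -> slot_relation (value3 F)
  (fun g : picture -> CqE R => skein_eq (g P_two) (g P_sigma2) (g P_disc)).
Proof. by move=> iF mF; apply: slots => // o S aS gS; exact: sigma2_relation. Qed.

Let rel_clasp2 F : isotopy_invariant F -> mixed_skein F -> slot_relation (value3 F)
  (fun g : picture -> CqE R => skein_eq (g P_clasp2) (g P_clasp1) (g P_disc)).
Proof. by move=> iF mF; apply: slots => // o S aS gS; exact: clasp2_relation. Qed.

Let rel_clasp1 F : isotopy_invariant F -> mixed_skein F -> slot_relation (value3 F)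
  (fun g : picture -> CqE R => skein_eq (g P_clasp1) (g P_two) (g P_disc)).
Proof. by move=> iF mF; apply: slots => // o S aS gS; exact: clasp1_relation. Qed.

Let rel_sigma3 : slot_relation (value3 V)
  (fun g : picture -> CqE R => skein_eq (g P_disc) (g P_sigma3) (g P_sigma2)).
Proof. by apply: slots => // o S aS gS; exact: sigma3_relation. Qed.

Let rel_sigma1 : slot_relation (value3 V)
  (fun g : picture -> CqE R => skein_eq (g P_disc) (g P_disc) (g P_two)).
Proof. by apply: slots => // o S aS gS; exact: sigma1_relation. Qed.

Let W := value3 V P_disc P_disc P_disc.

Lemma place_shift k p : place (slot R k) [:: p] = place (slot R 0) [:: shift (Z.mul 20 k) p].
Proof.
rewrite /place /= /zpoly /shift -map_comp; congr (_ :: _); apply: eq_map => a.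
by apply/rowP => -[[|[|[|i]]] iP] //; rewrite /= /pt !mxE /= ?zrD /zr /=; ring.
Qed.

Lemma value_disc o : value V (place o disc) = 1.
Proof.
have l : is_link (place o disc).
  rewrite -[place o disc]cats0.
  by apply: (link_place (diagramP P_disc)); [exact: away0|exact: good0].
rewrite -[place o disc]/(comps (Link l)) valueE; case: hV => _ _ h _; apply: h.
exists (Link l), (pt o (-1, 2, 0)%BZ), (pt o (-1, 4, 0)%BZ), (pt o (-5, 0, 0)%BZ); split => //.
exact: isotopic_perm.
Qed.

Lemma value_two_discs o S : away o 10%BZ S -> good S ->
  value V (place o two_discs ++ S) = u * value V (place o disc ++ S).
Proof. by move=> aS gS; apply: (skein_solve_0 q0 q21); exact: sigma1_relation. Qed.

(** Serves to show that the common factor is nonzero. The discs of the other slots are brought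
    beside the first one in turn, and each is removed at the cost of a factor u. *)
Lemma WE : W = u ^+ 2.
Proof.
have -> : W = value V
    (place (slot R 0) [:: left_disc; shift 20 left_disc; shift 40 left_disc] ++ [::]).
  rewrite cats0 /W /value3 (place_shift 1 left_disc : place (slot R 1) P_disc = _).
  by rewrite (place_shift 2 left_disc : place (slot R 2) P_disc = _).
have [m1 h1] := three_discs_deforms; have [m2 h2] := two_far_discs_deforms.
rewrite (deformsP h1 iV (@away0 _ _ _) (@good0 _)) cats0.
have -> : place (slot R 0) [:: left_disc; right_disc; shift 40 left_disc] =
    place (slot R 0) two_discs ++ place (slot R 2) disc by rewrite (place_shift 2).
rewrite value_two_discs; [|exact: (@away_slot _ 0%BZ 2%BZ P_disc)|exact: (good_slot _ P_disc)].
have -> : place (slot R 0) disc ++ place (slot R 2) disc =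
    place (slot R 0) [:: left_disc; shift 40 left_disc] ++ [::] by rewrite cats0 (place_shift 2).
rewrite (deformsP h2 iV (@away0 _ _ _) (@good0 _)) value_two_discs; [|exact: away0|exact: good0].
by rewrite cats0 value_disc mulr1 expr2.
Qed.

Let split_disc : split_picture P_disc.
Proof. by exists [:: ((-5, 0, 0)%BZ, 5%BZ)]. Qed.
Let split_two : split_picture P_two.
(* The closed cubes share a face in the plane x = 0, but balls are open. *)
Proof. by exists [:: ((-5, 0, 0)%BZ, 5%BZ); ((5, 0, 0)%BZ, 5%BZ)]. Qed.
Let split_sigma3 : split_picture P_sigma3.
Proof. by exists [:: ((0, 0, 0)%BZ, 10%BZ)]. Qed.

Lemma theta_split X Y Z : split_picture X -> split_picture Y -> split_picture Z ->
  value3 theta X Y Z =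
  E ^ (1 - (size (diagram X) + size (diagram Y) + size (diagram Z))%:Z) * value3 V X Y Z.
Proof.
move=> hX hY hZ; have l : is_link (place (slot R 0) X ++ place (slot R 1) Y ++ place (slot R 2) Z).
  exact: link3.
have := split_union3 hX hY hZ (erefl : comps (Link l) = _).
case: htheta => _ _ _ h /h.
by rewrite -!valueE /= /value3 !size_cat !size_map addnA.
Qed.

Let ut := E^-1 * u.

Let theta_base X x Y y Z z :
  discs P_disc P_two ut X x \/ (X = P_sigma3 /\ x = sigma3_coef q) ->
  discs P_disc P_two ut Y y -> discs P_disc P_two ut Z z ->
  value3 theta X Y Z = x * y * z * (E ^ (- 2) * W).
Proof.
have D A a : discs P_disc P_two ut A a -> exists2 b, discs P_disc P_two u A b &
    split_picture A /\ a = E ^ (1 - (size (diagram A))%:Z) * b.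
  case=> -[-> ->].
    exists 1; first by left.
    by split; [exact: split_disc|rewrite subrr expr0z mulr1].
  exists u; first by right.
  by split; [exact: split_two|rewrite /ut -exprN1].
have D3 : discs P_disc P_two ut X x \/ (X = P_sigma3 /\ x = sigma3_coef q) ->
    exists2 b, discs P_disc P_two u X b \/ (X = P_sigma3 /\ b = sigma3_coef q) &
    split_picture X /\ x = E ^ (1 - (size (diagram X))%:Z) * b.
  case=> [/D[b h1 h2]|[-> ->]]; first by exists b => //; left.
  exists (sigma3_coef q); first by right.
  by split; [exact: split_sigma3|rewrite subrr expr0z mul1r].
move=> /D3[bx hx [sx ->]] /D[b_y hy [sy ->]] /D[bz hz [sz ->]].
rewrite theta_split// (jones_base q0 q21 rel_sigma1 (rel_sigma2 iV mV) rel_sigma3 hx hy hz) -/W.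
(* Each slot absorbs its own exponent 1 - r; three slots use three units where the split union has
   one, which leaves the common factor E^(-2). *)
have -> : 1 - (size (diagram X) + size (diagram Y) + size (diagram Z))%:Z =
  (1 - (size (diagram X))%:Z) + (1 - (size (diagram Y))%:Z) +
  (1 - (size (diagram Z))%:Z) - 2 by lia.
rewrite !(expfzDr _ _ E0); exact: mulr_regroup.
Qed.

Lemma jones_agree : value3 V P_clasp2 P_sigma2 P_sigma2 = value3 V P_sigma4 P_clasp1 P_clasp1.
Proof.
have [e1 e2] := @three_slots_value _ q q0 _ P_disc P_two P_sigma2 P_sigma3 P_sigma4 P_clasp1
  P_clasp2 (value3 V) u W (rel_sigma2 iV mV) (rel_sigma4 iV mV) (rel_clasp1 iV mV)
  (rel_clasp2 iV mV) (jones_base q0 q21 rel_sigma1 (rel_sigma2 iV mV) rel_sigma3).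
exact: (etrans e1 (etrans (congr1 (fun x => x * W) (jones_coefs q0)) (esym e2))).
Qed.

Lemma gap_neq0 : gap_numerator q E != 0.
Proof.
rewrite /q_ /E_ -(rmorph_gap_numerator tofrac) tofrac_eq0.
(* The outer variable is E: it is set to 2 here, and q is set to 2 afterwards. *)
apply/eqP => /(congr1 (horner_eval (2%:P : {poly R[i]}))).
rewrite rmorph_gap_numerator rmorph0 /= /horner_eval hornerC hornerX.
move=> /(congr1 (horner_eval (2 : R[i]))).
rewrite rmorph_gap_numerator rmorph0 /= /horner_eval hornerC hornerX gap_numerator_22.
by apply/eqP; rewrite oppr_eq0 !mulf_neq0// ?expf_neq0// pnatr_eq0.
Qed.

Lemma theta_differ :
  value3 theta P_clasp2 P_sigma2 P_sigma2 <> value3 theta P_sigma4 P_clasp1 P_clasp1.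
Proof.
have [e1 e2] := @three_slots_value _ q q0 _ P_disc P_two P_sigma2 P_sigma3 P_sigma4 P_clasp1
  P_clasp2 (value3 theta) ut (E ^ (- 2) * W) (rel_sigma2 it mt) (rel_sigma4 it mt)
  (rel_clasp1 it mt) (rel_clasp2 it mt) theta_base.
have W0 : W != 0 by rewrite WE; exact: (expf_neq0 2 u0).
move=> e; have := etrans (esym e1) (etrans e e2).
move=> /(mulIf (mulf_neq0 (expfz_neq0 (- 2) E0) W0)) /eqP; rewrite -subr_eq0 => /eqP d0.
have := theta_gap q0 E0; rewrite /= -/u -/ut d0 => /esym/eqP.
by rewrite mulf_eq0 (negPf gap_neq0) invr_eq0 mulf_eq0 !expf_eq0 (negPf q0) (negPf E0) !andbF.
Qed.

End Separation.

Theorem theorem5 (R : realType) (V theta : link R -> CqE R)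
    (hV : is_jones V) (htheta : unique (is_theta V) theta) :
  (forall L L' : link R, theta L = theta L' -> V L = V L') /\
  (exists L L' : link R, V L = V L' /\ theta L <> theta L').
Proof.
split; first exact: (theta_determines_jones hV htheta).
have l (X Y Z : picture) : is_link (place (slot R 0) X ++ place (slot R 1) Y ++ place (slot R 2) Z).
  exact: link3.
pose L := Link (l P_clasp2 P_sigma2 P_sigma2); pose L' := Link (l P_sigma4 P_clasp1 P_clasp1).
exists L, L'; split.
  exact: (etrans (esym (valueE V L)) (etrans (jones_agree hV) (valueE V L'))).
move=> e; apply: (theta_differ hV (proj1 htheta)).
exact: (etrans (valueE theta L) (etrans e (esym (valueE theta L')))).
Qed.
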